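(* Let $q\geq5$ be a prime power with $q\equiv2\pmod3$, $m=(q+1)/3$. The number of distinct Weierstrass semigroups $H(P)$ as $P$ ranges over $\mathcal X_3(\mathbb F_{q^2})$ equals the number of positive divisors of $m$. The semigroups occurring, and the points at which they occur, are: (1) $H(P)=\langle q-2,q,q+1\rangle$ for the $q+1$ points $P\in\mathcal O$; (2) $H(P)=\langle q,\ q+1,\ (q-1)+j(q-2),\ (q-1)+i(q-2)-1\mid j=0,\dots,i-1\rangle$, where $1\le i\le m-2$ and $i+1$ divides $m$, for the $(q+1)^2\varphi(i+1)$ points $P\in\mathcal X_3(\mathbb F_{q^2})$ for which $\alpha(P)$ has $\mathcal P$-order $i$; (3) $H(P)=\langle q,\ q+1,\ (q-1)+j(q-2)\mid j=0,\dots,m-2\rangle$ for the $(q+1)^2\varphi(m)$ points $P\in\mathcal X_3(\mathbb F_{q^2})$ for which $\alpha(P)$ has $\mathcal P$-order $m-1$, as well as for the $2m(q+1)$ points $P\in\mathcal X_3(\mathbb F_{q^2})$ with $\alpha(P)^2-\alpha(P)+1=0$.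
   Context: $\varphi$ is Euler's totient function. Let $q$ be a prime power with $q\equiv2\pmod3$, $m=(q+1)/3$. Let $\mathcal X_3$ be the nonsingular projective model (defined over $\mathbb F_{q^2}$) of the plane curve $y^{q+1}+x^{2m}+x^m=0$. Let $\mathcal O_0$ be the $m$ points centered at the singular point $(0,0)$ (zeros of $x$) and $\mathcal O_\infty$ the $m$ points over the point at infinity (poles of $x$); every other point has affine coordinates $(a,b)$, $a\neq0$, and is denoted $P_{(a,b)}$. Let $\mathcal O_m=\{P_{(a,0)}:a^m+1=0\}$, $\mathcal O=\mathcal O_0\cup\mathcal O_\infty\cup\mathcal O_m$, and for $P=P_{(a,b)}\notin\mathcal O$ let $\alpha(P)=a^m/(1+a^m)$. Fix a primitive cube root of unity $\zeta_3\in\mathbb F_{q^2}$ and for $i\in\mathbb Z$ let $\mathcal P_i(s)=\frac{(s+\zeta_3)^{3i}-(s+\zeta_3^2)^{3i}}{3(\zeta_3-\zeta_3^2)s(s-1)}$. For $\alpha\in\overline{\mathbb F}_{q^2}\setminus\{0,1,-\zeta_3,-\zeta_3^2\}$ the $\mathcal P$-order of $\alpha$ is the smallest positive integer $i$ with $\mathcal P_{i+1}(\alpha)=0$. $H(P)$ is the Weierstrass semigroup at $P$ (integers $n\ge0$ such that some function has pole divisor exactly $nP$); $\langle\cdot\rangle$ is the semigroup generated. *)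

(* Defs.v *)
(* The curve X_3 is represented through its function field:
   L is a field containing a copy iota(K) of K = F_{q^2}, generated over it by
   x (transcendental) and y with y^(q+1) + x^(2m) + x^m = 0.  Points of X_3
   (over the algebraic closure) = places of L/K = normalized discrete
   valuations of L trivial on K; F_{q^2}-rational points = degree-one places. *)
From HB Require Import structures.
From mathcomp Require Import all_boot all_order all_algebra.
Set Implicit Arguments. Unset Strict Implicit. Unset Printing Implicit Defensive.
Import Order.TTheory GRing.Theory Num.Theory.
Local Open Scope ring_scope.

Definition mq (q : nat) : nat := (q.+1 %/ 3)%N.

Inductive gen_semigroup (S : nat -> Prop) : nat -> Prop :=
| gen_zero : gen_semigroup S 0
| gen_add n s : gen_semigroup S n -> S s -> gen_semigroup S (n + s).

Definition has_card {T : Type} (A : T -> Prop) (N : nat) : Prop :=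
  exists f : 'I_N -> T, injective f /\ forall P, A P <-> exists k, P = f k.

Section FunctionField.
Variables (K L : fieldType) (iota : {rmorphism K -> L}).

Definition eval2 (P : {poly {poly K}}) (a b : L) : L :=
  (map_poly (fun c : {poly K} => (map_poly iota c).[a]) P).[b].

(* a normalized discrete valuation of L trivial on iota(K); v 0 := 0 by convention *)
Definition is_place (v : L -> int) : Prop :=
  [/\ v 0 = 0,
      (forall c : K, c != 0 -> v (iota c) = 0),
      (forall a b : L, a != 0 -> b != 0 -> v (a * b) = v a + v b),
      (forall a b : L, a != 0 -> b != 0 -> a + b != 0 ->
         Num.min (v a) (v b) <= v (a + b))
    & (exists t : L, v t = 1)].

Definition residue (v : L -> int) (f : L) (c : K) : Prop :=
  f = iota c \/ 0 < v (f - iota c).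

Definition rational_place (v : L -> int) : Prop :=
  is_place v /\ forall f : L, f != 0 -> 0 <= v f -> exists c : K, residue v f c.

Definition weierstrass (P : L -> int) (n : nat) : Prop :=
  exists f : L, [/\ f != 0, P f = - (n%:Z)
    & forall Q : L -> int, is_place Q -> Q <> P -> 0 <= Q f].

Variables (q : nat) (x y : L).

Definition coords (P : L -> int) (a b : K) : Prop :=
  P x = 0 /\ residue P x a /\ residue P y b.

Definition in_O (P : L -> int) : Prop :=
  0 < P x \/ P x < 0 \/
  exists a : K, coords P a 0 /\ a ^+ (mq q) + 1 = 0.

Definition alpha_is (P : L -> int) (al : K) : Prop :=
  ~ in_O P /\ exists a b : K, coords P a b /\ al = a ^+ (mq q) / (1 + a ^+ (mq q)).
End FunctionField.

Section Porder.
Variable K : fieldType.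
(* P_i(s) evaluated at s (s not in {0,1}) *)
Definition Pval (zeta : K) (i : nat) (s : K) : K :=
  ((s + zeta) ^+ (3 * i) - (s + zeta ^+ 2) ^+ (3 * i)) /
  (3%:R * (zeta - zeta ^+ 2) * s * (s - 1)).

Definition has_Porder (zeta al : K) (i : nat) : Prop :=
  [/\ al != 0, al != 1, al != - zeta & al != - zeta ^+ 2] /\
  [/\ (0 < i)%N, Pval zeta i.+1 al = 0
    & forall j, (0 < j < i)%N -> Pval zeta j.+1 al != 0].
End Porder.

Definition H1 (q : nat) : nat -> Prop :=
  gen_semigroup (fun n => n = (q - 2)%N \/ n = q \/ n = q.+1).
Definition H2 (q i : nat) : nat -> Prop :=
  gen_semigroup (fun n => n = q \/ n = q.+1 \/
     (exists j, (j < i)%N /\ n = (q - 1 + j * (q - 2))%N) \/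
     n = (q - 1 + i * (q - 2) - 1)%N).
Definition H3 (q : nat) : nat -> Prop :=
  gen_semigroup (fun n => n = q \/ n = q.+1 \/
     exists j, (j <= mq q - 2)%N /\ n = (q - 1 + j * (q - 2))%N).

(* Main.v *)
(** With x = (u/w)^3 and y = uv/w^2 the curve is a quotient of the Hermitian curve
u^(q+1) + v^(q+1) + w^(q+1) = 0, and the product of the three conjugates t1, t2, t3
of a tangent line of the latter is a function T with divisor (q+1)P - D, D being
the polar divisor of x.  So (q+1)P ~ D, and every pole number at P is k(q+1) - o
with 0 <= o <= q, where o is the order at P of some function in L(kD); an explicit
basis bounds the dimension of L(kD).

The orders o < 3k - 1 come from products of functions of lower levels, and the
only question at a level 0 < k < m is whether o = 3k - 1 or o = 3k occurs.
Outside O, t1 has order at least q; if r and s are the values of t2 and t3 at P,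
then the traces of the forms (s t1 - r t2)^(3k-1) (l1 t1 + l2 t2) lie in L(kD) and
yield o = 3k if s^(3k) = (-r)^(3k) and o = 3k - 1 otherwise.  The smallest k with
s^(3k) = (-r)^(3k), or m if it is not less than m, determines H(P); for rational
r and s it is one plus the P-order of alpha(P) and divides m.  On O, whose three
parts are permuted by (x, y) -> (y^3/x^2, y/x), this number is 1. *)
Require Import Defs.
From HB Require Import structures.
From mathcomp Require Import all_boot all_order all_algebra all_field cyclic.
From mathcomp Require Import zify ring.
From mathcomp Require boolp.
Set Implicit Arguments. Unset Strict Implicit. Unset Printing Implicit Defensive.
Import Order.TTheory GRing.Theory Num.Theory.
Local Open Scope ring_scope.

(** Neither the genus nor the Riemann-Roch theorem enters. For [m <= k] the pole numbers produced at
    P and not exceeding k(q+1) are at least as many as the basis elements of L(kD), so one more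
    would give too many functions with distinct orders at P. Bounding L(kD) requires places at which
    a forbidden denominator vanishes, also over points that are not rational. They come from
    Frobenius: if F vanishes at a point fixed by N-th powers, N a power of q^2, then F^N - F is F
    times a unit and lies in the ideal of x^N - x and y^N - y, so a single function generates the
    maximal ideal.

    The Hermitian cover is never built. Its traces are traces of polynomials in a formal cube root
    of a^q x, and at P this root is approximated inside L to order q + 2, beyond the contact order q
    + 1.

    The condition s^(3k) = (-r)^(3k) arises as follows. Modulo t1, two of the three conjugates of
    the form become multiples of t2^(3k) and t3^(3k). If these multiples are equal, the trace of
    t1^(3k) removes both; this fixes (l1 : l2), and the value at P of the remaining linear factor is
    then proportional to s^(3k) - (-r)^(3k). *)

Section Eval2.
Variables (K L : fieldType) (iota : {rmorphism K -> L}).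

Definition evx (a : L) (p : {poly K}) : L := (map_poly iota p).[a].

Fact evx_additive a : zmod_morphism (evx a).
Proof. by move=> u v; rewrite /evx rmorphB hornerD hornerN. Qed.
HB.instance Definition _ a :=
  GRing.isZmodMorphism.Build {poly K} L (evx a) (evx_additive a).

Fact evx_multiplicative a : monoid_morphism (evx a).
Proof.
by split=> [|u v]; rewrite /evx ?rmorph1 ?hornerC // rmorphM hornerM.
Qed.
HB.instance Definition _ a :=
  GRing.isMonoidMorphism.Build {poly K} L (evx a) (evx_multiplicative a).

Lemma evxC a c : evx a c%:P = iota c.
Proof. by rewrite /evx map_polyC hornerC. Qed.

Lemma evxX a : evx a 'X = a.
Proof. by rewrite /evx map_polyX hornerX. Qed.

Lemma evxXn a n : evx a 'X^n = a ^+ n.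
Proof. by rewrite rmorphXn /= evxX. Qed.

Definition ev2 (a b : L) (P : {poly {poly K}}) : L := eval2 iota P a b.

Lemma ev2E a b P : ev2 a b P = (map_poly (evx a) P).[b].
Proof. by []. Qed.

Fact ev2_additive a b : zmod_morphism (ev2 a b).
Proof. by move=> u v; rewrite !ev2E rmorphB hornerD hornerN. Qed.
HB.instance Definition _ a b :=
  GRing.isZmodMorphism.Build {poly {poly K}} L (ev2 a b) (ev2_additive a b).

Fact ev2_multiplicative a b : monoid_morphism (ev2 a b).
Proof.
by split=> [|u v]; rewrite !ev2E ?rmorph1 ?hornerC // rmorphM hornerM.
Qed.
HB.instance Definition _ a b :=
  GRing.isMonoidMorphism.Build {poly {poly K}} L (ev2 a b)
    (ev2_multiplicative a b).

Lemma ev2C a b p : ev2 a b p%:P = evx a p.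
Proof. by rewrite ev2E map_polyC hornerC. Qed.

Lemma ev2CC a b c : ev2 a b c%:P%:P = iota c.
Proof. by rewrite ev2C evxC. Qed.

Lemma ev2X a b : ev2 a b 'X%:P = a.
Proof. by rewrite ev2C evxX. Qed.

Lemma ev2Y a b : ev2 a b 'X = b.
Proof. by rewrite ev2E map_polyX hornerX. Qed.

Lemma ev2_sum a b (P : {poly {poly K}}) :
  ev2 a b P = \sum_(i < size P) evx a P`_i * b ^+ i.
Proof.
rewrite ev2E (@horner_coef_wide _ (size P)) ?size_poly //.
by apply: eq_bigr => i _; rewrite coef_map.
Qed.

Lemma ev2N a b P : ev2 a b (- P) = - ev2 a b P.
Proof. by rewrite !ev2E raddfN hornerN. Qed.

Lemma ev2B a b P Q : ev2 a b (P - Q) = ev2 a b P - ev2 a b Q.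
Proof. by rewrite !ev2E raddfB hornerD hornerN. Qed.

Lemma ev2M a b P Q : ev2 a b (P * Q) = ev2 a b P * ev2 a b Q.
Proof. exact: rmorphM. Qed.

Lemma ev2D a b P Q : ev2 a b (P + Q) = ev2 a b P + ev2 a b Q.
Proof. exact: rmorphD. Qed.

Lemma ev2_1 a b : ev2 a b 1 = 1. Proof. exact: rmorph1. Qed.

Lemma ev2Xn a b P k : ev2 a b (P ^+ k) = ev2 a b P ^+ k. Proof. exact: rmorphXn. Qed.

End Eval2.

(** Until points are counted, the finiteness of [K] enters only through these properties and
    [periodic_closure]. *)
Definition admissible (q : nat) (K : fieldType) : Prop :=
  [/\ exists p k : nat, [/\ p \in [pchar K], (0 < k)%N & q = (p ^ k)%N],
      (5 <= q)%N, (q %% 3 = 2)%N, forall a : K, a ^+ (q ^ 2) = a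
    & exists z : K, (q ^ 2 - 1).-primitive_root z].

Definition model (K L : fieldType) (iota : {rmorphism K -> L}) (q : nat)
    (x y : L) : Prop :=
  [/\ y ^+ q.+1 + x ^+ (2 * mq q) + x ^+ mq q = 0,
      forall p : {poly K}, (map_poly iota p).[x] = 0 -> p = 0
    & forall f : L, exists P Q : {poly {poly K}},
        eval2 iota Q x y != 0 /\ f = eval2 iota P x y / eval2 iota Q x y].

Lemma admissible_fin (q : nat) (K : finFieldType) :
  (exists p k : nat, [/\ prime p, (0 < k)%N & q = (p ^ k)%N]) ->
  (5 <= q)%N -> (q %% 3 = 2)%N -> #|K| = (q ^ 2)%N -> admissible q K.
Proof.
move=> [p [k [pp k0 qE]]] q5 q3 cK.
have eK (a : K) : a ^+ (q ^ 2) = a by rewrite -cK expf_card.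
split=> //.
  by exists p, k; split=> //; apply: (@card_finPcharP _ p (k * 2)); rewrite // cK qE expnM.
have n1 : (0 < q ^ 2 - 1)%N by rewrite subn_gt0 -(exp1n 2) ltn_exp2r //; lia.
have /hasP[z _ hz] : has (q ^ 2 - 1).-primitive_root (enum (predC1 (0 : K))).
  apply: has_prim_root n1 _ _ _.
  - apply/allP => z; rewrite mem_enum inE => z0; apply/unity_rootP.
    apply: (mulfI z0); rewrite -exprS mulr1 subn1 prednK ?eK //.
    by rewrite expn_gt0; lia.
  - exact: enum_uniq.
  - by rewrite -cardE cardC1 cK subn1.
by exists z.
Qed.

(** * Arithmetic of q and m in K, and roots of unity *)

Section Base.
Variables (q : nat) (K : fieldType).
Hypothesis Hq : admissible q K.
Local Notation m := (mq q).

Lemma q1E : q.+1 = (3 * m)%N.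
Proof. by case: Hq => _ q5 q3 _ _; rewrite /mq; lia. Qed.

Lemma m_gt1 : (1 < m)%N.
Proof. by case: Hq => _ q5 q3 _ _; have := q1E; lia. Qed.

Lemma q_gt4 : (4 < q)%N. Proof. by case: Hq. Qed.

Section Ext.
Variables (M : fieldType) (j : {rmorphism K -> M}).

Lemma pchar_q : [pchar M].-nat q.
Proof.
case: Hq => [[p [k [pK k0 ->]]] _ _ _ _].
have pp := pcharf_prime pK.
have pM : p \in [pchar M] by exact: rmorph_pchar pK.
rewrite pnatX; apply/orP; left; by rewrite pnatE.
Qed.

Lemma exprDq (u v : M) : (u + v) ^+ q = u ^+ q + v ^+ q.
Proof. exact: exprDn_pchar pchar_q. Qed.

Lemma exprNq (u : M) : (- u) ^+ q = - u ^+ q.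
Proof. exact: exprNn_pchar pchar_q. Qed.

Lemma exprBq (u v : M) : (u - v) ^+ q = u ^+ q - v ^+ q.
Proof. by rewrite exprDq exprNq. Qed.

Lemma q_eq0 : q%:R = 0 :> M.
Proof.
have /pnatP := pchar_q; case: Hq => [[p [k [pK k0 ->]]] _ _ _ _] h; have pp := pcharf_prime pK.
have /h : (0 < p ^ k)%N by rewrite expn_gt0 prime_gt0.
move=> /(_ p pp); rewrite dvdn_exp // => /(_ isT) /andP[_ /eqP p0].
by rewrite natrX p0 expr0n; case: k k0 {h}.
Qed.

Lemma m3_eq1 : 3%:R * m%:R = 1 :> M.
Proof. by rewrite -natrM -q1E -natr1 q_eq0 add0r. Qed.

Lemma three_neq0 : 3%:R != 0 :> M.
Proof.
by apply/eqP => h; have := m3_eq1; rewrite h mul0r => /eqP; rewrite eq_sym oner_eq0.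
Qed.

Lemma m_neq0 : m%:R != 0 :> M.
Proof.
by apply/eqP => h; have := m3_eq1; rewrite h mulr0 => /eqP; rewrite eq_sym oner_eq0.
Qed.

Lemma sign_q1 : (-1) ^+ q.+1 = 1 :> M.
Proof. by rewrite exprS exprNq expr1n mulrNN mulr1. Qed.

Lemma sign_m : (-1) ^+ m = 1 :> M.
Proof.
have h : ((-1) ^+ m) ^+ 3 = 1 :> M by rewrite -exprM mulnC -q1E sign_q1.
rewrite -[RHS]h -exprM -signr_odd -[RHS]signr_odd; congr (_ ^+ _).
by rewrite oddM andbT.
Qed.

End Ext.

Lemma expq2 (a : K) : a ^+ (q ^ 2) = a.
Proof. by case: Hq. Qed.

Lemma expqq (a : K) : a ^+ q ^+ q = a.
Proof. by rewrite -exprM mulnn expq2. Qed.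

End Base.

Section Roots.
Variables (q : nat) (K : fieldType).
Hypothesis Hq : admissible q K.
Local Notation m := (mq q).

Lemma prim_root_exists n : (n %| q ^ 2 - 1)%N -> exists z : K, n.-primitive_root z.
Proof.
case: Hq => _ _ _ _ [z hz] dv.
by exists (z ^+ ((q ^ 2 - 1) %/ n)); exact: dvdn_prim_root hz _ dv.
Qed.

Lemma q1_dvd : (q.+1 %| q ^ 2 - 1)%N.
Proof. by apply/dvdnP; exists (q - 1)%N; have := q_gt4 Hq; lia. Qed.

Lemma m_dvd : (m %| q ^ 2 - 1)%N.
Proof. by apply: dvdn_trans q1_dvd; rewrite (q1E Hq) dvdn_mull. Qed.

(** For even q, -1 = 1. For odd q, 2m divides q^2 - 1, and the m-th power of an element of order 2m
    is -1. Such an [a] is the x-coordinate of a point of O_m. *)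
Lemma m_root_m1 : exists a : K, a ^+ m = -1.
Proof.
have [p2|p2] := boolP (odd q); last first.
  exists 1; rewrite expr1n; have := sign_q1 Hq (idfun : {rmorphism K -> K}).
  by rewrite -signr_odd /= p2 expr1 => ->.
have dv : (2 * m %| q ^ 2 - 1)%N.
  apply/dvdnP; exists (3 * (q - 1) %/ 2)%N.
  have e : ((3 * (q - 1)) %/ 2 * 2 = 3 * (q - 1))%N by lia.
  rewrite mulnA e; have := q1E Hq; have := q_gt4 Hq; nia.
have [z hz] := prim_root_exists dv; exists (z ^+ 1); rewrite -exprM mul1n.
have : (z ^+ m - 1) * (z ^+ m + 1) == 0.
  by rewrite -subr_sqr expr1n -exprM mulnC (prim_expr_order hz) subrr.
rewrite mulf_eq0 => /orP[|/eqP/addr0_eq <-]; last by rewrite opprK.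
rewrite subr_eq0 -(prim_order_dvd hz) => /dvdn_leq.
have := m_gt1 Hq; lia.
Qed.

End Roots.

(** * Irreducibility of the curve equation over K(x) *)

Section Independence.
Variables (q : nat) (K L : fieldType).
Variables (iota : {rmorphism K -> L}) (x y : L).
Hypothesis Hq : admissible q K.
Hypothesis Hxy : model iota q x y.
Local Notation m := (mq q).

Lemma curve_eq : y ^+ q.+1 = - (x ^+ m * (x ^+ m + 1)).
Proof.
case: Hxy => h _ _; apply/eqP; rewrite -addr_eq0 -h; apply/eqP.
by rewrite mul2n -addnn exprD; ring.
Qed.

Lemma evx_eq0 (p : {poly K}) : (evx iota x p == 0) = (p == 0).
Proof.
apply/eqP/eqP => [h|->]; last by rewrite rmorph0.
by case: Hxy => _ tr _; apply: tr.
Qed.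

Lemma x_neq0 : x != 0.
Proof. by rewrite -(evxX iota x) evx_eq0 polyX_eq0. Qed.

Lemma xm1_neq0 : x ^+ m + 1 != 0.
Proof.
rewrite -(evxXn iota x m) -(rmorph1 (evx iota x)) -rmorphD evx_eq0.
by rewrite -lead_coef_eq0 lead_coefXnaddC ?oner_eq0 // ltnW // (m_gt1 Hq).
Qed.

Lemma y_neq0 : y != 0.
Proof.
apply/eqP => h; have := curve_eq; rewrite h expr0n /= => /esym/eqP.
by rewrite oppr_eq0 mulf_eq0 expf_eq0 (negPf x_neq0) andbF (negPf xm1_neq0).
Qed.

Definition Cpol : {poly {poly K}} := 'X^(q.+1) + ('X^m * ('X^m + 1))%:P.

Lemma size_Cpol : size Cpol = q.+2.
Proof. by rewrite /Cpol size_XnaddC. Qed.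

Lemma monic_Cpol : Cpol \is monic.
Proof. by rewrite /Cpol monicE lead_coefXnaddC. Qed.

Lemma ev2_Cpol (M : fieldType) (j : {rmorphism K -> M}) a b :
  ev2 j a b Cpol = b ^+ q.+1 + a ^+ m * (a ^+ m + 1).
Proof.
by rewrite /Cpol rmorphD /= rmorphXn /= ev2Y ev2C rmorphM rmorphD rmorph1 /= evxXn.
Qed.

Lemma ev2_Cpol0 : ev2 iota x y Cpol = 0.
Proof. by rewrite ev2_Cpol curve_eq addNr. Qed.

Lemma Cx_split (z : K) : q.+1.-primitive_root z ->
  map_poly (evx iota x) Cpol =
  \prod_(i < q.+1) ('X - (iota (z ^+ i) * y)%:P).
Proof.
move=> hz; set rs := [seq iota (z ^+ i) * y | i : 'I_q.+1].
have -> : \prod_(i < q.+1) ('X - (iota (z ^+ i) * y)%:P) =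
          \prod_(w <- rs) ('X - w%:P) by rewrite big_map big_enum.
have szC : size (map_poly (evx iota x) Cpol) = q.+2.
  by rewrite size_map_poly_id0 ?size_Cpol // (monicP monic_Cpol) rmorph1 oner_eq0.
have mC : map_poly (evx iota x) Cpol \is monic.
  exact/monic_map/monic_Cpol.
rewrite [LHS](@all_roots_prod_XsubC _ _ rs) ?(monicP mC) ?scale1r //.
- by rewrite szC size_map size_enum_ord.
- apply/allP => w /mapP[i _ ->]; apply/rootP.
  rewrite -[_.[_]]/(ev2 iota x (iota (z ^+ i) * y) Cpol) ev2_Cpol exprMn curve_eq.
  by rewrite -rmorphXn -exprM mulnC exprM (prim_expr_order hz) expr1n rmorph1 mul1r addNr.
- rewrite uniq_rootsE map_inj_uniq ?enum_uniq // => i1 i2.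
  move=> /(mulIf y_neq0) /fmorph_inj /eqP; rewrite (eq_prim_root_expr hz).
  by rewrite !modn_small // => /eqP; apply: val_inj.
Qed.

(** Separability: the derivative at a is m a^(m-1), and m is invertible because 3m = q + 1 = 1 in
    K. *)
Lemma mup_Xm1 (a : K) : a ^+ m = -1 -> mup a ('X^m + 1) = 1%N.
Proof.
move=> ha; have sz : size ('X^m + 1 : {poly K}) = m.+1.
  by rewrite -[1]/(1%:P) size_XnaddC // ltnW // (m_gt1 Hq).
have n0 : ('X^m + 1 : {poly K}) != 0 by rewrite -size_poly_eq0 sz.
apply/eqP; rewrite eqn_leq mup_leq // mup_geq // expr1 dvdp_XsubCl rootE.
rewrite !hornerE ha addNr eqxx andbT.
have a0 : a != 0.
  by apply: contra_eq_neq ha => ->; rewrite expr0n; have := m_gt1 Hq; case: m => // n _;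
     rewrite eq_sym oppr_eq0 oner_eq0.
apply/negP => /dvdpP[u hu].
have := congr1 (fun p : {poly K} => p^`().[a]) hu.
rewrite derivD derivXn -[1]/(1%:P) derivC addr0 derivM !hornerE hornerMn hornerXn.
rewrite deriv_exp hornerMn hornerM horner_exp hornerXsubC subrr expr0n /=.
rewrite !(mulr0, mul0r, mul0rn) addr0 => /eqP.
rewrite -mulr_natr mulf_eq0 expf_eq0 (negPf a0) andbF.
by rewrite (negPf (m_neq0 Hq (idfun : {rmorphism K -> K}))).
Qed.

(** By induction the pseudo-remainder of [Cpol] by P is zero, so over L the polynomial P is its
    leading coefficient times a product over a subset s of the factors Y - z^i y. The constant
    coefficient raised to the power q+1 then equals the leading one to that power times (-(X^m (X^m
    + 1)))^|s|. Comparing multiplicities at a simple root of X^m + 1 shows that q+1 divides |s| <=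
    q. Hence s is empty and x being transcendental concludes. *)
Lemma ev2_small_eq0 (P : {poly {poly K}}) : (size P <= q.+1)%N -> ev2 iota x y P = 0 -> P = 0.
Proof.
move: {2}(size P) (leqnn (size P)) => n; elim: n P => [|n IH] P.
  by rewrite leqn0 size_poly_eq0 => /eqP.
move=> szn szq hP; apply/eqP/negPn/negP => P0.
have [a ha] := m_root_m1 Hq.
have [z hz] := prim_root_exists Hq (q1_dvd Hq).
have lx0 : evx iota x (lead_coef P) != 0 by rewrite evx_eq0 lead_coef_eq0.
have eP := Pdiv.Idomain.divp_eq Cpol P.
have rem0 : Cpol %% P = 0.
  apply: IH.
  - by rewrite -ltnS (leq_trans _ szn) // ltn_modp.
  - by rewrite (leq_trans _ szq) // ltnW // ltn_modp.
  have := congr1 (ev2 iota x y) eP.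
  rewrite rmorphD rmorphM /= hP mulr0 add0r => <-.
  by rewrite -mul_polyC rmorphM /= ev2_Cpol0 mulr0.
have dvP : map_poly (evx iota x) P %| map_poly (evx iota x) Cpol.
  rewrite -(@dvdpZr _ (evx iota x (lead_coef P) ^+ scalp Cpol P)) ?expf_neq0 //.
  have := congr1 (map_poly (evx iota x)) eP.
  rewrite rem0 addr0 rmorphM /= -mul_polyC rmorphM /= map_polyC /=.
  by rewrite (rmorphXn (evx iota x)) /= mul_polyC => ->; rewrite dvdp_mull.
move: dvP; rewrite (Cx_split hz) => /dvdp_prod_XsubC[b /eqp_eq].
set s := mask b _; set pr := \prod_(i <- s) _.
have szPx : size (map_poly (evx iota x) P) = size P by rewrite size_map_poly_id0.
have lcPx : lead_coef (map_poly (evx iota x) P) = evx iota x (lead_coef P).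
  by rewrite lead_coef_map_id0 ?rmorph0.
have mpr : pr \is monic by apply: monic_prod_XsubC.
rewrite (monicP mpr) scale1r lcPx => ePx.
have szs : (size s).+1 = size P.
  by rewrite -szPx ePx size_scale // size_prod_XsubC.
have := congr1 (horner^~ 0) ePx.
rewrite hornerZ horner_prod -[in LHS](addr0 0) => e0.
have {}e0 : evx iota x P`_0 = evx iota x (lead_coef P) * \prod_(i <- s) - (iota (z ^+ i) * y).
  move: e0; rewrite addr0 horner_coef0 coef_map => ->; congr (_ * _).
  by apply: eq_bigr => i _; rewrite !hornerE.
have pq (t : seq 'I_q.+1) :
    (\prod_(i <- t) - (iota (z ^+ i) * y)) ^+ q.+1 = (- (x ^+ m * (x ^+ m + 1))) ^+ size t.
  elim: t => [|i t IHt]; first by rewrite big_nil expr1n.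
  rewrite big_cons exprMn IHt /= [RHS]exprS; congr (_ * _).
  rewrite -[- (iota _ * y)]mulN1r exprMn (sign_q1 Hq iota) mul1r exprMn -rmorphXn -exprM mulnC exprM.
  by rewrite (prim_expr_order hz) expr1n rmorph1 mul1r curve_eq.
have {pq}e1 : P`_0 ^+ q.+1 = lead_coef P ^+ q.+1 * (- ('X^m * ('X^m + 1))) ^+ size s.
  apply/eqP; rewrite -subr_eq0 -evx_eq0 rmorphB !rmorphM !rmorphXn rmorphN !rmorphM.
  rewrite rmorphD rmorph1 /= evxXn e0 exprMn pq subrr //.
have lP0 : lead_coef P != 0 by rewrite lead_coef_eq0.
have Xm0 : ('X^m + 1 : {poly K}) != 0.
  by apply: contra_neq (xm1_neq0) => h; rewrite -(evxXn iota) -(rmorph1 (evx iota x)) -rmorphD h rmorph0.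
have XX0 : ('X^m : {poly K}) != 0 by rewrite monic_neq0 ?monicXn.
have N0 : - ('X^m * ('X^m + 1)) != 0 :> {poly K} by rewrite oppr_eq0 mulf_neq0.
have c0 : P`_0 != 0.
  have : P`_0 ^+ q.+1 != 0 by rewrite e1 mulf_neq0 ?expf_neq0.
  by rewrite expf_eq0.
have mupX (p : {poly K}) k : p != 0 -> mup a (p ^+ k) = (k * mup a p)%N.
  move=> p0; elim: k => [|k IHk]; first by rewrite expr0 mupNroot // root1.
  by rewrite exprS mupM ?expf_neq0 // IHk mulSn.
have := congr1 (mup a) e1; rewrite mupM ?expf_neq0 // !mupX //.
have -> : mup a (- ('X^m * ('X^m + 1))) = 1%N.
  rewrite -mulrN mupMr ?rootE ?hornerXn ?ha ?oppr_eq0 ?oner_eq0 //.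
  by rewrite -[- _]mulN1r mupMr ?mup_Xm1 // rootN root1.
rewrite muln1 => e2.
have : (q.+1 %| size s)%N.
  by rewrite -(dvdn_addr (size s) (dvdn_mulr (mup a (lead_coef P)) (dvdnn q.+1))) -e2 dvdn_mulr.
move=> /dvdn_leq; have := szs; move: szq; case: (size s) => [_ h _|]; last by lia.
move: hP; rewrite [P]size1_polyC -?h // ev2C => /eqP; rewrite evx_eq0 => /eqP c00.
by rewrite c00 eqxx in c0.
Qed.

Lemma ev2_eq0 (P : {poly {poly K}}) : ev2 iota x y P = 0 -> exists S, P = S * Cpol.
Proof.
move=> h; exists (Pdiv.Ring.rdivp P Cpol).
have e := Pdiv.RingMonic.rdivp_eq monic_Cpol P.
rewrite [LHS]e [X in _ + X]ev2_small_eq0 ?addr0 //.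
  by rewrite -ltnS -size_Cpol Pdiv.Ring.ltn_rmodpN0 // monic_neq0 // monic_Cpol.
by have := congr1 (ev2 iota x y) e; rewrite h rmorphD rmorphM /= ev2_Cpol0 mulr0 add0r.
Qed.

(** Evaluation at a point of the curve, over any extension of K, thus depends only on the function:
    this makes the local rings below well defined. *)
Lemma ev2_transfer (M : fieldType) (j : {rmorphism K -> M}) a b (P : {poly {poly K}}) :
  b ^+ q.+1 + a ^+ m * (a ^+ m + 1) = 0 ->
  ev2 iota x y P = 0 -> ev2 j a b P = 0.
Proof. by move=> hab /ev2_eq0[S ->]; rewrite rmorphM /= ev2_Cpol hab mulr0. Qed.

End Independence.

(** * The change of coordinates permuting O_0, O_infty and O_m *)

Section Generated.
Variables (K L : fieldType) (iota : {rmorphism K -> L}) (a b : L).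

Definition generated (f : L) : Prop := exists P Q : {poly {poly K}},
  ev2 iota a b Q != 0 /\ f = ev2 iota a b P / ev2 iota a b Q.

Lemma generated_ev2 P : generated (ev2 iota a b P).
Proof. by exists P, 1; rewrite rmorph1 oner_neq0 divr1. Qed.

Lemma generated_fst : generated a.
Proof. by have := generated_ev2 'X%:P; rewrite ev2X. Qed.

Lemma generated_snd : generated b.
Proof. by have := generated_ev2 'X; rewrite ev2Y. Qed.

Lemma generatedD f g : generated f -> generated g -> generated (f + g).
Proof.
move=> [P [Q [Q0 ->]]] [P' [Q' [Q0' ->]]].
by exists (P * Q' + P' * Q), (Q * Q'); rewrite rmorphD !rmorphM mulf_neq0 ?addf_div.
Qed.

Lemma generatedM f g : generated f -> generated g -> generated (f * g).
Proof.
move=> [P [Q [Q0 ->]]] [P' [Q' [Q0' ->]]].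
by exists (P * P'), (Q * Q'); rewrite !rmorphM mulf_neq0 ?mulf_div.
Qed.

Lemma generatedV f : generated f -> generated f^-1.
Proof.
move=> [P [Q [Q0 ->]]]; have [->|P0] := eqVneq (ev2 iota a b P) 0.
  by rewrite mul0r invr0 -(rmorph0 (ev2 iota a b)); apply: generated_ev2.
by exists Q, P; rewrite invf_div.
Qed.

Lemma generatedC c : generated (iota c).
Proof. by rewrite -(ev2CC iota a b c); apply: generated_ev2. Qed.

Lemma generatedX f n : generated f -> generated (f ^+ n).
Proof.
move=> hf; elim: n => [|n IH]; last by rewrite exprS; apply: generatedM.
by rewrite expr0 -(rmorph1 iota); apply: generatedC.
Qed.

Lemma generated_horner (p : {poly L}) u :
  (forall i, generated p`_i) -> generated u -> generated p.[u].
Proof.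
move=> hp hu; rewrite horner_coef; apply: (big_ind generated).
- by rewrite -(rmorph0 iota); apply: generatedC.
- exact: generatedD.
- by move=> i _; apply: generatedM => //; apply: generatedX.
Qed.

Lemma generated_ev2_trans u v P :
  generated u -> generated v -> generated (ev2 iota u v P).
Proof.
move=> hu hv; rewrite ev2E; apply: generated_horner => // i; rewrite coef_map.
by apply: generated_horner => // k; rewrite coef_map; apply: generatedC.
Qed.

End Generated.

Section Rotation.
Variables (q : nat) (K L : fieldType).
Variables (iota : {rmorphism K -> L}) (x y : L).
Hypothesis Hq : admissible q K.
Hypothesis Hxy : model iota q x y.
Local Notation m := (mq q).

Lemma algebraic_pow_root n (u : L) : (0 < n)%N ->
  algebraicOver iota (u ^+ n) -> algebraicOver iota u.
Proof.
move=> n0 [p p0 /rootP hp]; exists (p \Po 'X^n).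
  by rewrite comp_poly_eq0 // size_polyXn ltnS.
by apply/rootP; rewrite map_comp_poly map_polyXn horner_comp hornerXn.
Qed.

(* The substitution permutes cyclically the three coordinates of the covering
   Fermat curve u^(q+1) + v^(q+1) + w^(q+1) = 0, x = (u/w)^3, y = uv/w^2; hence
   it permutes cyclically O_0, O_infty and O_m. *)
Lemma model_rot : model iota q (y ^+ 3 / x ^+ 2) (y / x).
Proof.
have x0 := x_neq0 Hxy; have y0 := y_neq0 Hq Hxy.
have ce := curve_eq Hxy; have q1 := q1E Hq.
have xm0 : x ^+ m != 0 by rewrite expf_neq0.
have Em : (y ^+ 3 / x ^+ 2) ^+ m = - (1 + (x ^+ m)^-1).
  rewrite exprMn exprVn -!exprM -q1 ce mulnC exprM; field.
  by rewrite xm0.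
split.
- rewrite mulnC exprM Em exprMn exprVn ce q1 mulnC exprM; field.
  by rewrite xm0.
(* By [Em], x^m is a fractional linear function of (y^3/x^2)^m, so algebraicity would pass to x^m
   and then to x. *)
- move=> p hp; apply/eqP/negPn/negP => p0.
  have ax' : algebraicOver iota (y ^+ 3 / x ^+ 2) by exists p => //; apply/rootP.
  have axm : algebraicOver iota ((y ^+ 3 / x ^+ 2) ^+ m).
    elim: (m) => [|n IH]; first by rewrite expr0; apply: algebraic1.
    by rewrite exprS; apply: algebraic_mul.
  have : algebraicOver iota (x ^+ m).
    have -> : x ^+ m = (- 1 - (y ^+ 3 / x ^+ 2) ^+ m)^-1.
      by rewrite Em opprK addKr invrK.
    by apply/algebraic_inv/algebraic_sub => //; apply/algebraic_opp/algebraic1.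
  move=> /(algebraic_pow_root (ltnW (m_gt1 Hq))) [r r0 /rootP hr].
  by case: Hxy => _ /(_ r hr) r00 _; rewrite r00 eqxx in r0.
- move=> f; case: Hxy => _ _ /(_ f) [P [Q [Q0 ->]]].
  set x' := y ^+ 3 / x ^+ 2; set y' := y / x.
  have gx' : generated iota x' y' x' by apply: generated_fst.
  have gy' : generated iota x' y' y' by apply: generated_snd.
  have gx : generated iota x' y' x.
    have -> : x = x' / y' ^+ 3.
      by rewrite /x' /y'; field; rewrite x0 y0.
    by apply: generatedM => //; apply/generatedV/generatedX.
  have gy : generated iota x' y' y.
    have -> : y = y' * x by rewrite /y'; field; rewrite x0.
    exact: generatedM.
  by apply: generatedM; last apply: generatedV; apply: generated_ev2_trans.
Qed.

End Rotation.

(** * Valuations *)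

Section Place.
Variables (K L : fieldType) (iota : {rmorphism K -> L}) (v : L -> int).
Hypothesis Hv : is_place iota v.

(* [vge n f] puts [0] in every level, unlike [n <= v f] (where [v 0 = 0]). *)
Definition vge (n : int) (f : L) : bool := (f == 0) || (n <= v f).

Definition vis (n : int) (f : L) : bool := (f != 0) && (v f == n).

Lemma v0 : v 0 = 0. Proof. by case: Hv. Qed.

Lemma vC c : v (iota c) = 0.
Proof.
case: Hv => h0 hc _ _ _; have [->|c0] := eqVneq c 0; first by rewrite rmorph0.
exact: hc.
Qed.

Lemma v1 : v 1 = 0. Proof. by rewrite -(rmorph1 iota) vC. Qed.

Lemma vM a b : a != 0 -> b != 0 -> v (a * b) = v a + v b.
Proof. by case: Hv => _ _ h _ _; apply: h. Qed.

Lemma vN a : v (- a) = v a.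
Proof.
have [->|a0] := eqVneq a 0; first by rewrite oppr0.
by rewrite -mulN1r vM ?oppr_eq0 ?oner_eq0 // -(rmorph1 iota) -rmorphN vC add0r.
Qed.

Lemma vV a : v a^-1 = - v a.
Proof.
have [->|a0] := eqVneq a 0; first by rewrite invr0 v0 oppr0.
by apply/eqP; rewrite -addr_eq0 -vM ?invr_eq0 // mulVf // v1.
Qed.

Lemma vX a n : v (a ^+ n) = v a *+ n.
Proof.
have [->|a0] := eqVneq a 0.
  by rewrite expr0n v0 mul0rn; case: n => [|n] /=; rewrite ?v0 ?v1.
by elim: n => [|n IH]; rewrite ?expr0 ?v1 // exprS vM ?expf_neq0 // IH mulrS.
Qed.

Lemma vF a b : a != 0 -> b != 0 -> v (a / b) = v a - v b.
Proof. by move=> a0 b0; rewrite vM ?invr_eq0 // vV. Qed.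

Lemma vge0 n : vge n 0. Proof. by rewrite /vge eqxx. Qed.

Lemma vgeE n f : f != 0 -> vge n f = (n <= v f).
Proof. by rewrite /vge => /negPf ->. Qed.

Lemma vge_le n k f : k <= n -> vge n f -> vge k f.
Proof. by rewrite /vge => kn /orP[->//|h]; rewrite (le_trans kn h) orbT. Qed.

Lemma vgeN n f : vge n (- f) = vge n f.
Proof. by rewrite /vge oppr_eq0 vN. Qed.

Lemma vgeD n f g : vge n f -> vge n g -> vge n (f + g).
Proof.
have [->|f0] := eqVneq f 0; first by rewrite add0r.
have [->|g0] := eqVneq g 0; first by rewrite addr0.
have [->|s0] := eqVneq (f + g) 0; first by rewrite vge0.
rewrite !vgeE // => hf hg; case: Hv => _ _ _ /(_ f g f0 g0 s0) h _.
by apply: le_trans h; rewrite le_min hf.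
Qed.

Lemma vgeB n f g : vge n f -> vge n g -> vge n (f - g).
Proof. by move=> hf hg; rewrite vgeD ?vgeN. Qed.

Lemma vge_sym n f g : vge n (f - g) = vge n (g - f).
Proof. by rewrite -vgeN opprB. Qed.

Lemma vgeM n k f g : vge n f -> vge k g -> vge (n + k) (f * g).
Proof.
have [->|f0] := eqVneq f 0; first by rewrite mul0r !vge0.
have [->|g0] := eqVneq g 0; first by rewrite mulr0 !vge0.
by rewrite !vgeE ?mulf_neq0 // vM //; apply: lerD.
Qed.

Lemma vgeMl n f g : vge 0 f -> vge n g -> vge n (f * g).
Proof. by move=> hf hg; rewrite -[n]add0r vgeM. Qed.

Lemma vgeMr n f g : vge n f -> vge 0 g -> vge n (f * g).
Proof. by move=> hf hg; rewrite -[n]addr0 vgeM. Qed.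

Lemma vgeC c : vge 0 (iota c). Proof. by rewrite /vge vC lexx orbT. Qed.

Lemma vge1 : vge 0 1. Proof. by rewrite /vge v1 lexx orbT. Qed.

Lemma vge_nat n : vge 0 n%:R. Proof. by rewrite -(rmorph_nat iota) vgeC. Qed.

Lemma vgeX n f k : vge n f -> vge (n *+ k) (f ^+ k).
Proof.
by move=> hf; elim: k => [|k IH]; rewrite ?mulr0n ?vge1 // mulrS exprS vgeM.
Qed.

Lemma vgeX0 f k : vge 0 f -> vge 0 (f ^+ k).
Proof. by move=> /(vgeX k); rewrite mul0rn. Qed.

Lemma vge_sum n (I : Type) (r : seq I) (P : pred I) (F : I -> L) :
  (forall i, P i -> vge n (F i)) -> vge n (\sum_(i <- r | P i) F i).
Proof. by move=> h; apply: (big_ind (vge n)) => //; [exact: vge0|exact: vgeD]. Qed.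

Lemma vge_horner (p : {poly K}) f : vge 0 f -> vge 0 (map_poly iota p).[f].
Proof.
move=> hf; rewrite horner_coef vge_sum // => i _.
by rewrite vgeMl ?coef_map ?vgeC ?vgeX0.
Qed.

Lemma vis_ge n f : vis n f -> vge n f.
Proof. by case/andP=> f0 /eqP h; rewrite vgeE // h. Qed.

Lemma vis_lt n f k : n < k -> vis n f -> ~~ vge k f.
Proof. by move=> nk /andP[f0 /eqP h]; rewrite vgeE // h -ltNge. Qed.

Lemma visP n f : vge n f -> ~~ vge (n + 1) f -> vis n f.
Proof.
rewrite /vis /vge; case: eqP => //= _ h1; rewrite -ltNge ltzD1 => h2.
by rewrite eq_le h1 h2.
Qed.

Lemma vis_v n f : vis n f -> v f = n. Proof. by case/andP=> _ /eqP. Qed.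

Lemma vis_neq0 n f : vis n f -> f != 0. Proof. by case/andP. Qed.

Lemma v_vis f : f != 0 -> vis (v f) f. Proof. by rewrite /vis eqxx andbT. Qed.

Lemma visM n k f g : vis n f -> vis k g -> vis (n + k) (f * g).
Proof.
by case/andP=> f0 /eqP <- /andP[g0 /eqP <-]; rewrite /vis mulf_neq0 // vM /=.
Qed.

Lemma visV n f : vis n f -> vis (- n) f^-1.
Proof. by case/andP=> f0 /eqP <-; rewrite /vis invr_eq0 f0 vV /=. Qed.

Lemma visF n k f g : vis n f -> vis k g -> vis (n - k) (f / g).
Proof. by move=> hf /visV; apply: visM. Qed.

Lemma visX n f k : vis n f -> vis (n *+ k) (f ^+ k).
Proof. by case/andP=> f0 /eqP <-; rewrite /vis expf_neq0 // vX /=. Qed.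

Lemma visN n f : vis n (- f) = vis n f.
Proof. by rewrite /vis oppr_eq0 vN. Qed.

Lemma visD n f g : vis n f -> vge (n + 1) g -> vis n (f + g).
Proof.
move=> hf hg; apply: visP.
  by apply: (vgeD (vis_ge hf)); apply: (vge_le _ hg); rewrite lerDl.
apply/negP => h; have := vgeB h hg; rewrite addrK; apply/negP.
by apply: (vis_lt _ hf); rewrite ltzD1.
Qed.

Lemma visC c : c != 0 -> vis 0 (iota c).
Proof. by move=> c0; rewrite /vis fmorph_eq0 c0 vC /=. Qed.

Lemma vis1 : vis 0 1. Proof. by rewrite -(rmorph1 iota) visC ?oner_eq0. Qed.

Lemma vge1C c : vge 1 (iota c) = (c == 0).
Proof.
have [->|c0] := eqVneq c 0; first by rewrite rmorph0 vge0.
by apply/negbTE/(vis_lt _ (visC c0)).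
Qed.

Lemma vgeMK n k f g : vis k f -> vge (k + n) (f * g) -> vge n g.
Proof.
move=> hf h; have f0 := vis_neq0 hf.
have := vgeM (vis_ge (visV hf)) h.
by rewrite mulKf // addKr.
Qed.

Lemma vgeM0K n f g : vis 0 f -> vge n (f * g) -> vge n g.
Proof. by move=> hf; rewrite -{1}[n]add0r; apply: vgeMK. Qed.

Lemma vge_prime f g : vge 0 f -> vge 1 (f * g) -> vge 1 f || vge 1 g.
Proof.
move=> hf h; have [//|nf] := boolP (vge 1 f).
by rewrite /= (vgeM0K (visP hf _) h).
Qed.

Lemma vge_primeX f n : vge 0 f -> vge 1 (f ^+ n) -> vge 1 f.
Proof.
move=> hf; elim: n => [|n IH]; last by rewrite exprS => /(vge_prime hf)/orP[|/IH].
by rewrite expr0 => h; have := vis_lt _ vis1; move=> /(_ 1 isT); rewrite h.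
Qed.

Lemma vge1_sub0 f g : vge 1 (f - g) -> vge 0 g -> vge 0 f.
Proof. by move=> /(vge_le (le0z_nat 1)) h hg; rewrite -(subrK g f) vgeD. Qed.

Lemma vis_cong f c : c != 0 -> vge 1 (f - iota c) -> vis 0 f.
Proof. by move=> c0 h; rewrite -(subrK (iota c) f) addrC visD ?visC. Qed.

Lemma vge1_subX f g n : vge 0 f -> vge 0 g -> vge 1 (f - g) -> vge 1 (f ^+ n - g ^+ n).
Proof.
move=> hf hg h; rewrite subrXX vgeMr // vge_sum // => i _.
by rewrite vgeMl ?vgeX0.
Qed.

Lemma vge1_subM f f' g g' : vge 0 f' -> vge 0 g ->
  vge 1 (f - f') -> vge 1 (g - g') -> vge 1 (f * g - f' * g').
Proof.
move=> hf hg h1 h2.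
have -> : f * g - f' * g' = (f - f') * g + f' * (g - g') by ring.
by apply: vgeD; [apply: vgeMr|apply: vgeMl].
Qed.

Lemma residueE f c : residue iota v f c <-> vge 1 (f - iota c).
Proof.
split=> [[->|h]|]; first by rewrite subrr vge0.
- by rewrite /vge -gtz0_ge1 h orbT.
- by case/orP=> [/eqP/subr0_eq ->|]; [left|rewrite -gtz0_ge1; right].
Qed.

Lemma residue_uniq f c d : vge 1 (f - iota c) -> vge 1 (f - iota d) -> c = d.
Proof.
move=> h1 h2; apply/eqP; rewrite -subr_eq0 -vge1C rmorphB.
have -> : iota c - iota d = (f - iota d) - (f - iota c) by ring.
exact: vgeB.
Qed.

End Place.

(** The lowest nonzero coefficient of p is a multiple of the root z. This plays the role of a norm:
    it brings a function down to K[t] or K[x]. *)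
Lemma root_norm (R : comNzRingType) (L : fieldType) (g : {rmorphism R -> L})
    (p : {poly R}) (z : L) :
  p != 0 -> root (map_poly g p) z -> z != 0 ->
  exists c (p' : {poly R}), c != 0 /\ g c = z * (map_poly g p').[z].
Proof.
move=> p0 rz z0; elim/poly_ind: p p0 rz => [|p c IH]; first by rewrite eqxx.
rewrite rmorphD rmorphM /= map_polyX map_polyC rootE hornerMXaddC /=.
have [->|c0] := eqVneq c 0.
  rewrite addr0 rmorph0 addr0 mulf_eq0 (negPf z0) orbF => pX.
  by apply: IH; apply: contraNneq pX => ->; rewrite mul0r.
move=> _; rewrite addrC addr_eq0 => /eqP h; exists c, (- p); split=> //.
by rewrite h raddfN hornerN mulrN mulrC.
Qed.

(** u is a root of the monic polynomial p - p(u), whose coefficients are integral. *)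
Lemma integral_poly_val (R L : comNzRingType) (g : {rmorphism R -> L})
    (p : {poly L}) (u : L) : p \is monic -> (1 < size p)%N ->
  (forall i, integralOver g p`_i) -> integralOver g p.[u] -> integralOver g u.
Proof.
move=> mp sp hp hu; apply: (@integral_root_monic _ _ _ u (p - p.[u]%:P)).
- rewrite monicE lead_coefDl ?(monicP mp) // size_polyN.
  exact: leq_ltn_trans (size_polyC_leq1 _) sp.
- by rewrite rootE hornerD hornerN hornerC subrr.
- apply/integral_poly => i; rewrite coefB coefC.
  by apply: integral_sub => //; case: eqP => _ //; apply: integral0.
Qed.

(** * The local ring at a rational point *)

Section LocalRing.
Variables (q : nat) (K L M : fieldType).
Variables (iota : {rmorphism K -> L}) (j : {rmorphism K -> M}).
Variables (x y : L) (a b : M) (n : nat).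
Hypothesis Hq : admissible q K.
Hypothesis Hxy : model iota q x y.
Local Notation m := (mq q).
Local Notation N := ((q ^ 2) ^ n)%N.
Local Notation E := (ev2 iota x y).
Local Notation ev := (ev2 j a b).
Hypothesis hab : b ^+ q.+1 + a ^+ m * (a ^+ m + 1) = 0.
Hypothesis a_neq0 : a != 0.
Hypothesis n_gt0 : (0 < n)%N.
Hypothesis aN : a ^+ N = a.
Hypothesis bN : b ^+ N = b.

(** Where b is nonzero the projection to the x-line is unramified, and x^N - x has only simple
    zeros; where b = 0 it is totally ramified and y is the local parameter. Using x^N - x instead of
    x - a keeps the coefficients in K even if a lies only in M. *)
Definition unifpol : {poly {poly K}} :=
  if b == 0 then 'X else ('X^N - 'X)%:P.

Local Notation t := (E unifpol).

(** Divisibility by t in the local ring at (a, b), with the denominator, a polynomial not vanishing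
    there, multiplied out. *)
Definition tdiv (f : L) : Prop := exists P R : {poly {poly K}},
  ev R != 0 /\ f * E R = t * E P.

Lemma ev_unifpol : ev unifpol = 0.
Proof.
rewrite /unifpol; have [b0|_] := eqVneq b 0; first by rewrite (ev2Y j).
by rewrite (ev2C j) rmorphB /= (evxXn j) (evxX j) aN subrr.
Qed.

Lemma N_gt1 : (1 < N)%N.
Proof. by rewrite -(expn0 (q ^ 2)) ltn_exp2l //; have := q_gt4 Hq; nia. Qed.

Lemma unifE : t = if b == 0 then y else x ^+ N - x.
Proof.
rewrite /unifpol; have [b0|_] := eqVneq b 0; first by rewrite (ev2Y iota).
by rewrite (ev2C iota) rmorphB /= (evxXn iota) (evxX iota).
Qed.

Lemma unif_neq0 : t != 0.
Proof.
rewrite unifE; have [b0|_] := eqVneq b 0; first exact: y_neq0 Hq Hxy.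
rewrite -(evxXn iota) -[X in _ - X](evxX iota) -rmorphB (evx_eq0 Hxy).
rewrite -size_poly_eq0 size_polyDl size_polyXn //.
by rewrite size_polyN size_polyX ltnS N_gt1.
Qed.

Lemma tdivD f g : tdiv f -> tdiv g -> tdiv (f + g).
Proof.
move=> [P [R [R0 h]]] [P' [R' [R0' h']]]; exists (P * R' + P' * R), (R * R').
rewrite rmorphM mulf_neq0 // rmorphD !rmorphM /=; split=> //.
by rewrite mulrDl mulrA h mulrDr !mulrA; congr (_ + _); rewrite -h' -!mulrA [E R * _]mulrC.
Qed.

Definition inKxy (f : L) : Prop := exists P, f = E P.

Lemma inKxy_E P : inKxy (E P). Proof. by exists P. Qed.

Lemma inKxyD f g : inKxy f -> inKxy g -> inKxy (f + g).
Proof. by move=> [P ->] [Q ->]; exists (P + Q); rewrite rmorphD. Qed.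

Lemma inKxyM f g : inKxy f -> inKxy g -> inKxy (f * g).
Proof. by move=> [P ->] [Q ->]; exists (P * Q); rewrite rmorphM. Qed.

Lemma inKxyC c : inKxy (iota c).
Proof. by exists c%:P%:P; rewrite (ev2CC iota). Qed.

Lemma inKxyX f k : inKxy f -> inKxy (f ^+ k).
Proof. by move=> [P ->]; exists (P ^+ k); rewrite rmorphXn. Qed.

Lemma inKxy_sum (I : Type) (r : seq I) (F : I -> L) :
  (forall i, inKxy (F i)) -> inKxy (\sum_(i <- r) F i).
Proof.
move=> h; apply: big_ind => //; last exact: inKxyD.
by rewrite -(rmorph0 iota); apply: inKxyC.
Qed.

Lemma inKxy_evx f p : inKxy f -> inKxy (evx iota f p).
Proof.
move=> hf; rewrite /evx horner_coef; apply: inKxy_sum => i.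
by apply: inKxyM; [rewrite coef_map; apply: inKxyC|apply: inKxyX].
Qed.

Lemma tdivM f g : tdiv f -> inKxy g -> tdiv (f * g).
Proof.
move=> [P' [R [R0 h]]] [P ->]; exists (P' * P), R; split=> //.
by rewrite rmorphM mulrAC h mulrA.
Qed.

Lemma tdivN f : tdiv f -> tdiv (- f).
Proof.
move=> [P [R [R0 h]]]; exists (- P), R; split=> //.
by rewrite mulNr h -mulrN (ev2N iota).
Qed.

Lemma tdiv0 : tdiv 0.
Proof. by exists 0, 1; rewrite rmorph1 oner_neq0 rmorph0 mul0r mulr0. Qed.

Lemma tdiv_unif : tdiv t.
Proof. by exists 1, 1; rewrite !rmorph1 oner_neq0 mulr1. Qed.

Lemma tdivMK f R : ev R != 0 -> tdiv (f * E R) -> tdiv f.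
Proof.
move=> R0 [P [R' [R0' h]]]; exists P, (R * R').
by rewrite rmorphM mulf_neq0 // rmorphM mulrA.
Qed.

Lemma tdiv_sum (I : Type) (r : seq I) (F : I -> L) :
  (forall i, tdiv (F i)) -> tdiv (\sum_(i <- r) F i).
Proof. by move=> h; apply: big_ind => //; [exact: tdiv0|exact: tdivD]. Qed.

Lemma tdiv_subX f g k : inKxy f -> inKxy g -> tdiv (f - g) -> tdiv (f ^+ k - g ^+ k).
Proof.
move=> hf hg h; rewrite subrXX; apply: tdivM => //.
by apply: inKxy_sum => i; apply: inKxyM; apply: inKxyX.
Qed.

Lemma tdiv_subevx f g p : inKxy f -> inKxy g -> tdiv (f - g) ->
  tdiv (evx iota f p - evx iota g p).
Proof.
move=> hf hg h; rewrite /evx !horner_coef -sumrB; apply: tdiv_sum => i.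
by rewrite -mulrBr mulrC coef_map; apply: tdivM (inKxyC _); apply: tdiv_subX.
Qed.

Lemma tdiv_subev2 f g u v T : inKxy f -> inKxy g -> inKxy u -> inKxy v ->
  tdiv (f - g) -> tdiv (u - v) -> tdiv (ev2 iota f u T - ev2 iota g v T).
Proof.
move=> hf hg hu hv h1 h2; rewrite !ev2_sum -sumrB; apply: tdiv_sum => i.
have -> : evx iota f T`_i * u ^+ i - evx iota g T`_i * v ^+ i =
  (evx iota f T`_i - evx iota g T`_i) * u ^+ i +
  (u ^+ i - v ^+ i) * evx iota g T`_i by ring.
apply: tdivD; apply: tdivM.
- exact: tdiv_subevx.
- exact: inKxyX.
- exact: tdiv_subX.
- exact: inKxy_evx.
Qed.

Lemma pchar_N : [pchar L].-nat N.
Proof. by rewrite !pnatX (pchar_q Hq iota). Qed.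

Lemma cN (c : K) : c ^+ N = c.
Proof. by elim: (n) => [|k IH]; rewrite ?expr1 // expnS exprM (expq2 Hq). Qed.

Lemma sumN (I : Type) (r : seq I) (F : I -> L) :
  (\sum_(i <- r) F i) ^+ N = \sum_(i <- r) F i ^+ N.
Proof.
elim: r => [|i r IH]; first by rewrite !big_nil expr0n; have := N_gt1; case: N.
by rewrite !big_cons exprDn_pchar ?IH // pchar_N.
Qed.

Lemma evxN f p : evx iota f p ^+ N = evx iota (f ^+ N) p.
Proof.
rewrite /evx !horner_coef sumN; apply: eq_bigr => i _.
by rewrite exprMn coef_map -rmorphXn cN exprAC.
Qed.

Lemma ev2_expN P : E P ^+ N = ev2 iota (x ^+ N) (y ^+ N) P.
Proof.
rewrite !ev2_sum sumN; apply: eq_bigr => i _.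
by rewrite exprMn evxN exprAC.
Qed.

Lemma inKxyx : inKxy x. Proof. by exists 'X%:P; rewrite (ev2X iota). Qed.

Lemma inKxyy : inKxy y. Proof. by exists 'X; rewrite (ev2Y iota). Qed.

Lemma m_dvdN : (m %| N - 1)%N.
Proof.
apply: (dvdn_trans (m_dvd Hq)).
have -> : (N - 1 = (q ^ 2) ^ n - 1 ^ n)%N by rewrite exp1n.
by rewrite subn_exp dvdn_mulr.
Qed.

(** If b = 0, then t = y divides x^m + 1, because x^m (x^m + 1) = -y^(q+1) and x^m does not vanish
    at a. Hence x^m = -1 modulo t, and x^(N-1) = (-1)^((N-1)/m) = 1, since -1 is an m-th power in
    K. *)
Lemma tdiv_x : tdiv (x ^+ N - x).
Proof.
have [b0|b0] := eqVneq b 0; last first.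
  by have := tdiv_unif; rewrite unifE (negPf b0).
have ty : tdiv y by have := tdiv_unif; rewrite unifE b0 eqxx.
have tx : tdiv (x ^+ m + 1).
  apply: (@tdivMK _ 'X^m%:P).
    by rewrite (ev2C j) (evxXn j) expf_neq0.
  rewrite (ev2C iota) (evxXn iota) mulrC -[_ * _]opprK -(curve_eq Hxy).
  by apply: tdivN; rewrite exprS; apply: tdivM => //; apply/inKxyX/inKxyy.
have [a0 ha0] := m_root_m1 Hq.
have a00 : a0 != 0.
  apply: contra_eq_neq ha0 => ->; rewrite expr0n.
  by have := m_gt1 Hq; case: m => //= k _; rewrite eq_sym oppr_eq0 oner_eq0.
have eN : ((N - 1) %/ m * m = N - 1)%N by rewrite divnK ?m_dvdN.
have sg : (-1) ^+ ((N - 1) %/ m) = 1 :> L.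
  rewrite -(rmorph1 iota) -rmorphN -ha0 -rmorphXn -exprM mulnC eN; congr (iota _).
  by apply: (mulfI a00); rewrite -exprS subn1 prednK ?cN ?mulr1 // ltnW // N_gt1.
have -> : x ^+ N - x = ((x ^+ m) ^+ ((N - 1) %/ m) - (-1) ^+ ((N - 1) %/ m)) * x.
  by rewrite sg -exprM mulnC eN mulrBl mul1r -exprSr subn1 prednK // ltnW // N_gt1.
apply: tdivM inKxyx; apply: tdiv_subX; rewrite ?opprK //; first exact/inKxyX/inKxyx.
by rewrite -(rmorph1 iota) -rmorphN; apply: inKxyC.
Qed.

(** If b is nonzero, the curve equation makes the difference of the (q+1)-st powers of y^N and y a
    polynomial difference in x, and the cofactor R takes the value (q+1) b^q = b^q at the point. *)
Lemma tdiv_y : tdiv (y ^+ N - y).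
Proof.
have [b0|b0] := eqVneq b 0.
  have ty : tdiv y by have := tdiv_unif; rewrite unifE b0 eqxx.
  apply: tdivD; last exact: tdivN.
  have := N_gt1; case: N => // k _.
  by rewrite exprS; apply: tdivM => //; apply/inKxyX/inKxyy.
pose R : {poly {poly K}} := \sum_(i < q.+1) ('X ^+ N) ^+ (q.+1.-1 - i) * 'X ^+ i.
apply: (@tdivMK _ R).
  rewrite rmorph_sum /= (eq_bigr (fun=> b ^+ q)) => [|i _]; last first.
    rewrite rmorphM !rmorphXn /= (ev2Y j) bN -exprD subnK // -ltnS //.
  by rewrite sumr_const card_ord -mulr_natr -natr1 (q_eq0 Hq j) add0r mulr1 expf_neq0.
have -> : (y ^+ N - y) * E R = (y ^+ N) ^+ q.+1 - y ^+ q.+1.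
  rewrite subrXX rmorph_sum; congr (_ * _); apply: eq_bigr => i _.
  by rewrite rmorphM !rmorphXn /= (ev2Y iota).
have -> : (y ^+ N) ^+ q.+1 - y ^+ q.+1 =
   - (evx iota (x ^+ N) ('X^m * ('X^m + 1)) - evx iota x ('X^m * ('X^m + 1))).
  have cp (u : L) : evx iota u ('X^m * ('X^m + 1)) = u ^+ m * (u ^+ m + 1).
    by rewrite rmorphM rmorphD rmorph1 /= (evxXn iota).
  have wN : (x ^+ m * (x ^+ m + 1)) ^+ N = (x ^+ N) ^+ m * ((x ^+ N) ^+ m + 1).
    by rewrite exprMn exprDn_pchar ?pchar_N // expr1n (exprAC x m N).
  by rewrite !cp exprAC (curve_eq Hxy) exprNn_pchar ?pchar_N // wN opprK opprB addrC.
apply: tdivN; apply: tdiv_subevx.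
- exact/inKxyX/inKxyx.
- exact: inKxyx.
- exact: tdiv_x.
Qed.

(** The maximal ideal is generated by t: P (P^(N-1) - 1) = P(x^N, y^N) - P(x, y) is divisible by t,
    and P^(N-1) - 1 has the value -1 at the point. *)
Lemma tdiv_ev0 P : ev P = 0 -> tdiv (E P).
Proof.
move=> h; apply: (@tdivMK _ (P ^+ (N - 1) - 1)).
  rewrite (ev2B j) (ev2Xn j) h (ev2_1 j) expr0n subn_eq0 leqNgt N_gt1 /= add0r.
  by rewrite oppr_eq0 oner_eq0.
rewrite (ev2B iota) (ev2Xn iota) (ev2_1 iota) mulrBr mulr1 -exprS subn1 prednK; last first.
  by rewrite ltnW // N_gt1.
rewrite ev2_expN; apply: tdiv_subev2.
- exact/inKxyX/inKxyx.
- exact: inKxyx.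
- exact/inKxyX/inKxyy.
- exact: inKxyy.
- exact: tdiv_x.
- exact: tdiv_y.
Qed.

Lemma integral_self (u : L) : integralOver (evx iota u) u.
Proof. by have := integral_id (evx iota u) 'X; rewrite /= evxX. Qed.

Lemma integral_x : integralOver (evx iota t) x.
Proof.
rewrite unifE; have [b0|b0] := eqVneq b 0.
  apply: (integral_poly_val (p := ('X^(m + m) + 'X^m))).
  - rewrite monicE lead_coefDl ?lead_coefXn // !size_polyXn ltnS.
    by rewrite -addn1 leq_add2l ltnW // (m_gt1 Hq).
  - rewrite size_polyDl ?size_polyXn ?ltnS; last first.
      by rewrite -addn1 leq_add2l ltnW // (m_gt1 Hq).
    by rewrite addn_gt0 ltnW // (m_gt1 Hq).
  - by move=> i; rewrite coefD !coefXn -natrD; apply: integral_nat.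
  have -> : ('X^(m + m) + 'X^m).[x] = - y ^+ q.+1.
    by rewrite hornerD !hornerXn (curve_eq Hxy) opprK exprD; ring.
  apply: integral_opp; elim: q.+1 => [|k IH]; first exact: integral1.
  by rewrite exprS; apply: integral_mul => //; apply: integral_self.
apply: (integral_poly_val (p := ('X^N - 'X))).
- by rewrite monicE lead_coefDl ?lead_coefXn // size_polyN size_polyX size_polyXn ltnS N_gt1.
- rewrite size_polyDl ?size_polyXn ?ltnS ?size_polyN ?size_polyX ?ltnS ?N_gt1 //.
  by rewrite ltnW // N_gt1.
- by move=> i; rewrite coefB coefX coefXn; apply: integral_sub; apply: integral_nat.
rewrite hornerD hornerN hornerXn hornerX.
exact: integral_self.
Qed.

Lemma integral_evC c : integralOver (evx iota t) (iota c).
Proof. by rewrite -(evxC iota t); apply: integral_id. Qed.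

Lemma integral_exp f k :
  integralOver (evx iota t) f -> integralOver (evx iota t) (f ^+ k).
Proof.
move=> hf; elim: k => [|k IH]; first exact: integral1.
by rewrite exprS; apply: integral_mul.
Qed.

Lemma integral_y : integralOver (evx iota t) y.
Proof.
apply: (integral_poly_val (p := 'X^(q.+1))).
- exact: monicXn.
- by rewrite size_polyXn.
- by move=> i; rewrite coefXn; apply: integral_nat.
rewrite hornerXn (curve_eq Hxy); apply/integral_opp/integral_mul.
  exact/integral_exp/integral_x.
by apply: integral_add; [exact/integral_exp/integral_x|exact: integral1].
Qed.

Lemma integral_E P : integralOver (evx iota t) (E P).
Proof.
rewrite [E P]ev2_sum; elim/big_ind: _ => [||i _].
- exact: integral0.
- exact: integral_add.
apply: integral_mul; last exact/integral_exp/integral_y.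
rewrite /evx horner_coef; elim/big_ind: _ => [||k _].
- exact: integral0.
- exact: integral_add.
apply: integral_mul; last exact/integral_exp/integral_x.
by rewrite coef_map; apply: integral_evC.
Qed.

Lemma ev_inE (p : {poly K}) P :
  exists Q, evx iota (E P) p = E Q /\ ev Q = evx j (ev P) p.
Proof.
exists (\sum_(i < size p) (p`_i)%:P%:P * P ^+ i); split.
  rewrite rmorph_sum /evx horner_coef size_map_poly; apply: eq_bigr => i _.
  by rewrite [RHS]rmorphM /= (ev2Xn iota) (ev2CC iota) coef_map.
rewrite rmorph_sum /evx horner_coef size_map_poly; apply: eq_bigr => i _.
by rewrite [LHS]rmorphM /= (ev2Xn j) (ev2CC j) coef_map.
Qed.

(** P divides a nonzero polynomial c(t), P being integral over K[t]. The bound is the multiplicity e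
    of 0 as a root of c: for k > e, cancelling t^e and evaluating at the point would make the unit
    part of c vanish at 0. *)
Lemma unif_bound P : E P != 0 -> exists B : nat, forall k R P',
  ev R != 0 -> E P * E R = t ^+ k * E P' -> (k <= B)%N.
Proof.
move=> z0; case: (integral_E P) => p mp rp.
have [c [p' [c0 ec]]] := root_norm (monic_neq0 mp) rp z0.
have [Z eZ] : inKxy (map_poly (evx iota t) p').[E P].
  rewrite horner_coef; apply: inKxy_sum => i; apply: inKxyM; last exact/inKxyX/inKxy_E.
  by rewrite coef_map; apply/inKxy_evx/inKxy_E.
have [e [c1 c10 ece]] : exists e, exists2 c1 : {poly K}, ~~ root c1 0 & c = c1 * 'X^e.
  have [e [c1 h1 h2]] := multiplicity_XsubC c 0.
  by exists e, c1; [rewrite c0 in h1|rewrite h2 polyC0 subr0].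
exists e => k R P' R0 h; rewrite leqNgt; apply/negP => ek.
have [Q [eQ1 eQ2]] := ev_inE c1 unifpol.
have key : t ^+ e * E (Q * R - unifpol ^+ (k - e) * (P' * Z)) = 0.
  rewrite (ev2B iota) !(ev2M iota) (ev2Xn iota) mulrBr !mulrA -exprD subnKC 1?ltnW //.
  rewrite -h [_ * E R * E Z]mulrAC -eZ -ec ece.
  by rewrite (rmorphM (evx iota t)) /= (evxXn iota) eQ1 [E Q * _]mulrC subrr.
move/eqP: key; rewrite mulf_eq0 expf_eq0 (negPf unif_neq0) andbF /=.
move=> /eqP /(ev2_transfer Hq Hxy j hab) /eqP.
rewrite (ev2B j) !(ev2M j) (ev2Xn j) ev_unifpol expr0n subn_eq0 leqNgt ek mul0r subr0.
rewrite mulf_eq0 (negPf R0) orbF eQ2 ev_unifpol /evx horner_coef0 coef_map fmorph_eq0.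
by rewrite -horner_coef0; apply/negP.
Qed.

Lemma unif_factor P : E P != 0 -> exists k P' R,
  [/\ ev P' != 0, ev R != 0 & E P * E R = t ^+ k * E P'].
Proof.
move=> z0; have [B hB] := unif_bound z0.
have step k : (exists k P' R, [/\ ev P' != 0, ev R != 0 & E P * E R = t ^+ k * E P'])
  \/ exists P' R, ev R != 0 /\ E P * E R = t ^+ k * E P'.
  elim: k => [|k [|[P' [R [R0 h]]]]]; [right|by left|].
    by exists P, 1; rewrite !ev2_1 oner_neq0 mulr1 mul1r.
  have [P'0|P'0] := eqVneq (ev P') 0; last by left; exists k, P', R.
  right; have [P2 [R2 [R20 h2]]] := tdiv_ev0 P'0.
  exists P2, (R * R2); rewrite !ev2M mulf_neq0 //; split=> //.
  by rewrite mulrA h -mulrA h2 exprSr mulrA.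
have [//|[P' [R [R0 h]]]] := step B.+1.
by have := hB _ _ _ R0 h; rewrite ltnn.
Qed.

(** That f is t^k times a unit of the local ring; [place_exists] turns this relation into a function
    by choice. *)
Definition lval (f : L) (k : int) : Prop := exists P R,
  [/\ ev P != 0, ev R != 0 & f * E R = t ^ k * E P].

Lemma ev_E_neq0 P : ev P != 0 -> E P != 0.
Proof. by apply: contra_neq; exact: (ev2_transfer Hq Hxy j hab). Qed.

Lemma lval_exists f : f != 0 -> exists k, lval f k.
Proof.
case: Hxy => _ _ /(_ f) [P [Q []]]; rewrite -/(E P) -/(E Q) => Q0 -> PQ0.
have P0 : E P != 0 by apply: contraNneq PQ0 => ->; rewrite mul0r.
have [k1 [P1 [R1 [P10 R10 h1]]]] := unif_factor P0.
have [k2 [P2 [R2 [P20 R20 h2]]]] := unif_factor Q0.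
exists (k1%:Z - k2%:Z), (P1 * R2), (R1 * P2); rewrite !ev2M !mulf_neq0 //; split=> //.
rewrite expfzDr ?unif_neq0 // -invr_expz -!exprnP.
have E1 := ev_E_neq0 R10; have E2 := ev_E_neq0 R20; have E3 := ev_E_neq0 P20.
have t0 := unif_neq0.
have -> : E P = t ^+ k1 * E P1 / E R1 by rewrite -h1 mulfK.
have -> : E P2 = E Q * E R2 / t ^+ k2 by rewrite h2 mulrC mulKf ?expf_neq0.
by field; rewrite Q0 E1 expf_neq0.
Qed.

Lemma lval_uniq f k1 k2 : f != 0 -> lval f k1 -> lval f k2 -> k1 = k2.
Proof.
wlog le12 : k1 k2 / k1 <= k2.
  by move=> w f0 h1 h2; case/orP: (le_total k1 k2) => h; [|apply/esym]; apply: w.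
move=> f0 [P1 [R1 [P10 R10 h1]]] [P2 [R2 [P20 R20 h2]]].
apply/eqP; rewrite eq_le le12 /= leNgt; apply/negP => lt12.
have [d dE] : exists d : nat, k2 = k1 + d.+1%:Z.
  by exists (`|k2 - k1|.-1)%N; lia.
have key : t ^ k1 * E (P1 * R2 - unifpol ^+ d.+1 * (P2 * R1)) = 0.
  rewrite (ev2B iota) !(ev2M iota) (ev2Xn iota) mulrBr !mulrA -h1 exprnP.
  by rewrite -expfzDr ?unif_neq0 // -dE -h2; ring.
move/eqP: key; rewrite mulf_eq0 expfz_eq0 (negPf unif_neq0) andbF /=.
move=> /eqP /(ev2_transfer Hq Hxy j hab) /eqP.
rewrite (ev2B j) !(ev2M j) (ev2Xn j) ev_unifpol expr0n mul0r subr0 mulf_eq0.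
by rewrite (negPf P10) (negPf R20).
Qed.

Lemma lval_t : lval t 1.
Proof. by exists 1, 1; rewrite !ev2_1 oner_neq0 expr1z mulr1. Qed.

Lemma lvalE P : ev P != 0 -> lval (E P) 0.
Proof. by move=> P0; exists P, 1; rewrite !ev2_1 P0 oner_neq0 mulr1 mul1r. Qed.

Lemma lvalM f g k l : lval f k -> lval g l -> lval (f * g) (k + l).
Proof.
move=> [P1 [R1 [P10 R10 h1]]] [P2 [R2 [P20 R20 h2]]].
exists (P1 * P2), (R1 * R2); rewrite !ev2M !mulf_neq0 //; split=> //.
by rewrite mulrACA h1 h2 mulrACA expfzDr ?unif_neq0.
Qed.

Lemma lvalD f g k l n' : f + g != 0 -> lval f k -> lval g l -> k <= l ->
  lval (f + g) n' -> k <= n'.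
Proof.
move=> s0 [P1 [R1 [P10 R10 h1]]] [P2 [R2 [P20 R20 h2]]] kl hn.
have [d dE] : exists d : nat, l = k + d%:Z.
  by exists `|l - k|%N; lia.
have t0 := unif_neq0; have E1 := ev_E_neq0 R10; have E2 := ev_E_neq0 R20.
set S := P1 * R2 + unifpol ^+ d * P2 * R1.
have hS : (f + g) * E (R1 * R2) = t ^ k * E S.
  rewrite (ev2D iota) !(ev2M iota) (ev2Xn iota) mulrDl mulrDr !mulrA h1; congr (_ + _).
  by rewrite exprnP -expfzDr // -dE -h2; ring.
have S0 : E S != 0.
  apply: contra_neq s0 => S00; move/eqP: hS; rewrite S00 mulr0 mulf_eq0 => /orP[/eqP //|].
  by rewrite (ev2M iota) mulf_eq0 (negPf E1) (negPf E2).
have [e [P3 [R3 [P30 R30 h3]]]] := unif_factor S0.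
have : lval (f + g) (k + e%:Z).
  exists P3, (R1 * R2 * R3); rewrite !ev2M !mulf_neq0 //; split=> //.
  by rewrite mulrA -(ev2M iota) hS -mulrA h3 mulrA expfzDr // exprnP.
by move=> /(lval_uniq s0 hn) ->; rewrite lerDl.
Qed.

Lemma place_exists : exists v, [/\ is_place iota v,
  forall P, ev P != 0 -> v (E P) = 0, forall P, ev P = 0 -> vge v 1 (E P)
  & forall f k, f != 0 -> lval f k -> v f = k].
Proof.
have [v hv] : {v : L -> int & forall f, (f = 0 -> v f = 0) /\ (f != 0 -> lval f (v f))}.
  apply: (@boolp.choice L int (fun f k => (f = 0 -> k = 0) /\ (f != 0 -> lval f k))) => f.
  have [->|f0] := eqVneq f 0; first by exists 0.
  by have [k hk] := lval_exists f0; exists k; split=> // fe; rewrite fe eqxx in f0.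
have vk f k : f != 0 -> lval f k -> v f = k.
  by move=> f0 hk; exact: lval_uniq f0 ((hv f).2 f0) hk.
have vE P : ev P != 0 -> v (E P) = 0.
  by move=> P0; apply: vk (lvalE P0); apply: ev_E_neq0.
have vP : is_place iota v.
  split.
  - exact: (hv 0).1.
  - move=> c c0; rewrite -(ev2CC iota x y) vE // (ev2CC j) fmorph_eq0 //.
  - by move=> f g f0 g0; apply: vk; [rewrite mulf_neq0|apply: lvalM; apply: (hv _).2].
  - move=> f g f0 g0 s0.
    have hf := (hv f).2 f0; have hg := (hv g).2 g0; have hs := (hv _).2 s0.
    case/orP: (le_total (v f) (v g)) => h.
      by rewrite min_l //; apply: lvalD hf hg h hs.
    by rewrite min_r //; rewrite addrC in s0 hs *; apply: lvalD hg hf h hs.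
  - by exists t; apply: vk unif_neq0 lval_t.
exists v; split=> // P P0.
have [P' [R [R0 h]]] := tdiv_ev0 P0.
have vt : vge v 1 t by rewrite vgeE ?unif_neq0 // (vk _ _ unif_neq0 lval_t).
have vR : vis v 0 (E R) by rewrite /vis ev_E_neq0 // vE.
rewrite mulrC in h; apply: (vgeM0K vP vR); rewrite h (vgeMr vP) //.
have [P'0|P'0] := eqVneq (E P') 0; first by rewrite P'0 vge0.
have [k [P2 [R2 [P20 R20 h2]]]] := unif_factor P'0.
rewrite vgeE // (vk (E P') k%:Z) //; exists P2, R2; split=> //.
Qed.

End LocalRing.

(** An algebraically closed extension in which every point has coordinates fixed by some N-th power,
    as the construction of the local ring demands. *)
Definition periodic_closure (q : nat) (K : fieldType) : Prop :=
  exists (M : fieldType) (j : {rmorphism K -> M}),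
    (forall p : {poly M}, (1 < size p)%N -> exists a, root p a) /\
    (forall a : M, exists2 n : nat, (0 < n)%N & a ^+ ((q ^ 2) ^ n) = a).

(** The conjugates a^(Q^i) are all roots of the polynomial of a, so two of them coincide; Frobenius
    is injective, so the smaller exponent can be removed. *)
Lemma periodic_closure_fin (q : nat) (K : finFieldType) :
  admissible q K -> periodic_closure q K.
Proof.
move=> Hq; have [M [j intj]] := countable_algebraic_closure K.
exists M, j; split=> [p sp|a]; first by apply/closed_rootP; rewrite gtn_eqF.
have [p mp rp] := intj a; set Q := (q ^ 2)%N.
have fx i : root (map_poly j p) (a ^+ (Q ^ i)).
  elim: i => [|i IH]; first by rewrite expr1.
  rewrite expnSr exprM; move: (a ^+ (Q ^ i)) IH => u /rootP ru; apply/rootP.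
  have pQ : [pchar M].-nat Q by rewrite pnatX (pchar_q Hq j).
  have -> : (map_poly j p).[u ^+ Q] = (map_poly j p).[u] ^+ Q.
    rewrite !horner_coef.
    have sQ (I : Type) (r : seq I) (F : I -> M) :
        (\sum_(i <- r) F i) ^+ Q = \sum_(i <- r) F i ^+ Q.
      elim: r => [|k r IH]; last by rewrite !big_cons exprDn_pchar ?IH.
      rewrite !big_nil expr0n /Q; have := q_gt4 Hq; case: (q) => //.
    rewrite sQ; apply: eq_bigr => k _.
    by rewrite exprMn coef_map -rmorphXn (expq2 Hq) exprAC.
  by rewrite ru expr0n /Q; have := q_gt4 Hq; case: (q).
pose s := [seq a ^+ (Q ^ i) | i <- iota 0 (size p)].
have [us|] := boolP (uniq s).
  have ar : all (root (map_poly j p)) s by apply/allP => w /mapP[i _ ->].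
  have := max_poly_roots (monic_neq0 (monic_map j mp)) ar us.
  by rewrite size_map size_iota size_map_poly ltnn.
move=> /(uniqPn 0)[i [k [ik ks eik]]].
rewrite size_map size_iota in ks.
rewrite !(nth_map 0%N) ?size_iota ?nth_iota ?add0n // in eik; try exact: ltn_trans ks.
exists (k - i)%N; first by rewrite subn_gt0.
have pQ : [pchar M].-nat (Q ^ i)%N by rewrite !pnatX (pchar_q Hq j).
have : (a ^+ (Q ^ (k - i)) - a) ^+ (Q ^ i) = 0.
  rewrite exprDn_pchar // exprNn_pchar // -exprM -expnD subnK 1?ltnW //.
  by rewrite -eik subrr.
by move/eqP; rewrite expf_eq0 subr_eq0 => /andP[_ /eqP].
Qed.

Lemma vXz (K L : fieldType) (iota : {rmorphism K -> L}) (v : L -> int) :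
  is_place iota v -> forall a n, v (a ^+ n) = v a * n%:Z.
Proof. by move=> Hv a n; rewrite (vX Hv) -mulr_natr natz. Qed.

(** * Orders of x and y at places; places centred at affine points *)

Section Points.
Variables (q : nat) (K L : fieldType) (iota : {rmorphism K -> L}) (x y : L).
Hypothesis Hq : admissible q K.
Hypothesis Hxy : model iota q x y.
Local Notation m := (mq q).
Local Notation idK := (idfun : {rmorphism K -> K}).

Section OnePlace.
Variable v : L -> int.
Hypothesis Hv : is_place iota v.

Let x0 := x_neq0 Hxy.
Let y0 := y_neq0 Hq Hxy.
Let xm0 := xm1_neq0 Hq Hxy.

Lemma v_curve : v y * q.+1%:Z = v x * m%:Z + v (x ^+ m + 1).
Proof.
have := congr1 v (curve_eq Hxy).
by rewrite (vN Hv) (vM Hv) ?expf_neq0 // !(vXz Hv).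
Qed.

Lemma v_xm1_pos : 0 < v x -> v (x ^+ m + 1) = 0.
Proof.
move=> h; rewrite addrC; apply: (vis_v (v := v)); apply: (visD Hv) (vis1 Hv) _.
rewrite vgeE ?expf_neq0 // (vXz Hv) add0r.
have := m_gt1 Hq; nia.
Qed.

Lemma v_xm1_neg : v x < 0 -> v (x ^+ m + 1) = v x * m%:Z.
Proof.
move=> h; rewrite -(vXz Hv); apply: (vis_v (v := v)).
apply: (visD Hv); first by rewrite v_vis ?expf_neq0.
rewrite vgeE ?oner_neq0 // (v1 Hv) (vXz Hv).
have := m_gt1 Hq; nia.
Qed.

Lemma vy_pos : 0 < v x -> v x = v y * 3.
Proof.
move=> h; have := v_curve; rewrite v_xm1_pos // (q1E Hq).
have := m_gt1 Hq; nia.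
Qed.

Lemma vy_neg : v x < 0 -> v x * 2 = v y * 3.
Proof.
move=> h; have := v_curve; rewrite v_xm1_neg // (q1E Hq).
have := m_gt1 Hq; nia.
Qed.

Lemma vy_ge0 : 0 <= v x -> 0 <= v y.
Proof.
move=> h; have := v_curve; have hx : vge v 0 x by rewrite vgeE.
have := vgeD Hv (vgeX0 Hv m hx) (vge1 Hv); rewrite vgeE // => h2 hc.
have h3 : 0 <= v y * q.+1%:Z by rewrite hc addr_ge0 // mulr_ge0.
by rewrite pmulr_lge0 in h3.
Qed.

Lemma vge_y : 0 <= v x -> vge v 0 y.
Proof. by move=> h; rewrite vgeE // vy_ge0. Qed.

End OnePlace.

Section RationalPoint.
Variables a b : K.
Hypothesis hab : b ^+ q.+1 + a ^+ m * (a ^+ m + 1) = 0.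
Hypothesis a_neq0 : a != 0.

Local Notation E := (ev2 iota x y).
Local Notation ev := (ev2 idK a b).
Let a1 : a ^+ ((q ^ 2) ^ 1) = a. Proof. by rewrite expn1 (expq2 Hq). Qed.
Let b1 : b ^+ ((q ^ 2) ^ 1) = b. Proof. by rewrite expn1 (expq2 Hq). Qed.
Let rval := lval q iota idK x y a b 1.
Let t := E (unifpol q K b 1).

Let t0 : t != 0. Proof. exact: (unif_neq0 b Hq Hxy a_neq0 (ltn0Sn 0)). Qed.

Lemma rat_place_exists : exists v,
  [/\ rational_place iota v, v x = 0, vge v 1 (x - iota a) & vge v 1 (y - iota b)].
Proof.
have [v [vP v0 v1 vk]] := place_exists idK Hq Hxy hab a_neq0 (ltn0Sn 0) a1 b1.
have ec c : E c%:P%:P = iota c by rewrite (ev2CC iota).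
have evc c : ev c%:P%:P = c by rewrite (ev2CC idK).
exists v; split.
- split=> // f f0 vf.
  have [k hk] := lval_exists idK Hq Hxy hab a_neq0 (ltn0Sn 0) a1 b1 f0.
  have [k0|k0] := eqVneq k 0; last first.
    exists 0; right; rewrite rmorph0 subr0 lt_neqAle vf eq_sym (vk _ _ f0 hk).
    by rewrite k0.
  move: hk; rewrite k0 => -[P [R [P0 R0 h]]]; rewrite expr0z mul1r in h.
  exists (ev P / ev R); apply: (proj2 (residueE iota v _ _)).
  have vR : vis v 0 (E R).
    by rewrite /vis v0 // eqxx andbT; apply: (ev_E_neq0 (j := idK) Hq Hxy hab R0).
  apply: (vgeM0K vP vR); rewrite mulrC mulrBl h -ec -(ev2M iota) -(ev2B iota).
  by apply: v1; rewrite (ev2B idK) (ev2M idK) evc divfK ?subrr.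
- have := v0 'X%:P; rewrite (ev2X iota) => -> //.
  by rewrite (ev2X idK).
- rewrite -(ev2X iota x y) -ec -(ev2B iota); apply: v1.
  by rewrite (ev2B idK) (ev2X idK) evc subrr.
- rewrite -[X in _ (X - _)](ev2Y iota x y) -ec -(ev2B iota); apply: v1.
  by rewrite (ev2B idK) (ev2Y idK) evc subrr.
Qed.

Section AtPoint.
Variable v : L -> int.
Hypothesis Hv : is_place iota v.
Hypothesis vxa : vge v 1 (x - iota a).
Hypothesis vyb : vge v 1 (y - iota b).

Lemma at_x0 : vge v 0 x. Proof. apply: (vge1_sub0 Hv vxa); exact: (vgeC Hv). Qed.
Lemma at_y0 : vge v 0 y. Proof. apply: (vge1_sub0 Hv vyb); exact: (vgeC Hv). Qed.

Lemma at_ev P : vge v 1 (E P - iota (ev P)).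
Proof.
rewrite !ev2_sum rmorph_sum -sumrB; apply: (vge_sum Hv) => i _.
rewrite rmorphM rmorphXn /=; apply: (vge1_subM Hv).
- exact: (vgeC Hv).
- exact/(vgeX0 Hv)/at_y0.
- rewrite /evx !horner_coef rmorph_sum /= !size_map_poly -sumrB.
  apply: (vge_sum Hv) => k _; rewrite !coef_map rmorphM rmorphXn /= -mulrBr.
  apply: (vgeMl Hv); first exact: (vgeC Hv).
  by apply: (vge1_subX Hv) => //; [exact: at_x0|exact: (vgeC Hv)].
- by apply: (vge1_subX Hv) => //; [exact: at_y0|exact: (vgeC Hv)].
Qed.

Lemma at_unit P : ev P != 0 -> vis v 0 (E P).
Proof. by move=> h; apply: (vis_cong Hv h); apply: at_ev. Qed.

Lemma vXint f (k : int) : v (f ^ k) = v f * k.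
Proof.
case: k => n; first by rewrite -exprnP (vXz Hv).
by rewrite NegzE -invr_expz (vV Hv) -exprnP (vXz Hv) mulrN.
Qed.

Lemma at_lval_scale f k : f != 0 -> rval f k -> v f = v t * k.
Proof.
move=> f0 [P [R [P0 R0 h]]]; have := congr1 v h; rewrite -/t.
have [vP vR] := (at_unit P0, at_unit R0).
rewrite (vM Hv) ?(vis_neq0 vR) // (vM Hv) ?(vis_neq0 vP) ?expfz_neq0 //.
by rewrite (vis_v vP) (vis_v vR) !addr0 vXint.
Qed.

(** Any place centred at (a, b) is a multiple of the constructed valuation, by [at_lval_scale]; it
    takes the value 1, so the factor is 1. This also gives uniqueness of the place. *)
Lemma at_unif : v t = 1.
Proof.
have [_ _ _ _ [s vs]] := Hv.
have s0 : s != 0 by apply: contra_eq_neq vs => ->; rewrite (v0 Hv).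
have [k hk] := lval_exists idK Hq Hxy hab a_neq0 (ltn0Sn 0) a1 b1 s0.
have hs := at_lval_scale s0 hk; rewrite vs in hs.
have : vge v 1 t by have := at_ev (unifpol q K b 1); rewrite (ev_unifpol idK b a1) rmorph0 subr0.
rewrite vgeE // => ht; have k1 : k = 1 by nia.
by rewrite hs k1 mulr1.
Qed.

Lemma at_val f k : f != 0 -> rval f k -> v f = k.
Proof. by move=> f0 hk; rewrite (at_lval_scale f0 hk) at_unif mul1r. Qed.

Lemma at_unif_x : b != 0 -> vis v 1 (x - iota a).
Proof.
move=> b0; have := at_unif; rewrite /t unifE (negPf b0) => ht.
set N := ((q ^ 2) ^ 1)%N in ht.
have xN0 : x ^+ N - x != 0.
  by apply: contra_eq_neq ht => ->; rewrite (v0 Hv).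
apply: (visP vxa); apply/negP => h2.
suff : vge v (1 + 1) (x ^+ N - x) by rewrite vgeE // ht.
have -> : x ^+ N - x = (x ^+ N - iota a ^+ N) - (x - iota a).
  by rewrite -rmorphXn a1; ring.
apply: (vgeB Hv _ h2); rewrite subrXX; apply: (vgeMr Hv) => //.
apply: (vge_sum Hv) => i _; apply: (vgeMl Hv); apply: (vgeX0 Hv); first exact: at_x0.
exact: (vgeC Hv).
Qed.

Lemma at_unif_y : b = 0 -> vis v 1 y.
Proof.
by move=> b0; have := at_unif; rewrite /t unifE b0 eqxx /vis (y_neq0 Hq Hxy) => ->.
Qed.

Lemma at_x_unit : vis v 0 x. Proof. exact: (vis_cong Hv a_neq0 vxa). Qed.

(** Here a^m = -1, so x^m + 1 is x - a times a unit (its residue is m a^(m-1)), while x^m (x^m + 1)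
    = -y^(q+1) and y has order 1. *)
Lemma at_b0_x : b = 0 -> vis v q.+1%:Z (x - iota a).
Proof.
move=> b0; have am : a ^+ m + 1 = 0.
  apply/eqP; move/eqP: hab; rewrite b0 expr0n add0r mulf_eq0 expf_eq0.
  by rewrite (negPf a_neq0) andbF.
have e1 : x ^+ m + 1 = (x - iota a) * (\sum_(i < m) x ^+ (m.-1 - i) * iota a ^+ i).
  rewrite -subrXX -rmorphXn; congr (_ + _); apply/eqP.
  by rewrite -subr_eq0 opprK -(rmorph1 iota) -rmorphD addrC am rmorph0.
have vs : vis v 0 (\sum_(i < m) x ^+ (m.-1 - i) * iota a ^+ i).
  have c0 : m%:R * a ^+ m.-1 != 0 by rewrite mulf_neq0 ?expf_neq0 ?(m_neq0 Hq idK).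
  apply: (vis_cong Hv c0).
  have -> : iota (m%:R * a ^+ m.-1) = \sum_(i < m) iota a ^+ m.-1.
    by rewrite sumr_const card_ord rmorphM rmorph_nat rmorphXn mulr_natl.
  rewrite -sumrB; apply: (vge_sum Hv) => i _.
  rewrite -[in X in _ - X](@subnK i m.-1); last by rewrite -ltnS prednK // ltnW // (m_gt1 Hq).
  rewrite exprD -mulrBl; apply: (vgeMr Hv); last exact/(vgeX0 Hv)/(vgeC Hv).
  by apply: (vge1_subX Hv) => //; [exact: at_x0|exact: (vgeC Hv)].
have vy : vis v q.+1%:Z (y ^+ q.+1).
  by have := visX Hv q.+1 (at_unif_y b0); rewrite -mulr_natr mul1r natz.
have := vy; rewrite (curve_eq Hxy) (visN Hv) e1 => hh.
have xs : vis v 0 (x ^+ m) by have := visX Hv m at_x_unit; rewrite mul0rn.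
have := visF Hv (visF Hv hh xs) vs; rewrite !subr0.
by rewrite [x ^+ m * _]mulrC mulfK ?mulfK ?(vis_neq0 vs) ?(vis_neq0 xs).
Qed.

End AtPoint.

Lemma rat_place_uniq v v' : is_place iota v -> is_place iota v' ->
  vge v 1 (x - iota a) -> vge v 1 (y - iota b) ->
  vge v' 1 (x - iota a) -> vge v' 1 (y - iota b) -> v = v'.
Proof.
move=> Hv Hv' h1 h2 h3 h4; apply: boolp.functional_extensionality_dep => f.
have [->|f0] := eqVneq f 0; first by rewrite (v0 Hv) (v0 Hv').
have [k hk] := lval_exists idK Hq Hxy hab a_neq0 (ltn0Sn 0) a1 b1 f0.
by rewrite (at_val Hv h1 h2 f0 hk) (at_val Hv' h3 h4 f0 hk).
Qed.

End RationalPoint.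

Lemma rational_coords v : rational_place iota v -> v x = 0 -> exists a b : K,
  [/\ a != 0, b ^+ q.+1 + a ^+ m * (a ^+ m + 1) = 0,
      vge v 1 (x - iota a) & vge v 1 (y - iota b)].
Proof.
move=> [Hv hr] vx; have x0 := x_neq0 Hxy; have y0 := y_neq0 Hq Hxy.
have vx0 : 0 <= v x by rewrite vx.
have [a /(residueE iota v _ _) ha] := hr x x0 vx0.
have [b /(residueE iota v _ _) hb] := hr y y0 (vy_ge0 Hv vx0).
exists a, b; split=> //.
  apply: contraTneq ha => ->; rewrite rmorph0 subr0.
  by apply: (@vis_lt _ _ 0); rewrite // /vis x0 vx.
apply/eqP; rewrite -(vge1C Hv).
have hx : vge v 0 x by rewrite vgeE.
have hy : vge v 0 y by rewrite vgeE ?(vy_ge0 Hv).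
have -> : iota (b ^+ q.+1 + a ^+ m * (a ^+ m + 1)) =
   - ((y ^+ q.+1 - iota b ^+ q.+1) + (x ^+ m * (x ^+ m + 1) - iota a ^+ m * (iota a ^+ m + 1))).
  by rewrite (curve_eq Hxy) !rmorphD !rmorphM !rmorphD !rmorphXn rmorph1; ring.
rewrite (vgeN Hv); apply: (vgeD Hv).
  by apply: (vge1_subX Hv) => //; apply: (vgeC Hv).
have hm : vge v 1 (x ^+ m - iota a ^+ m) by apply: (vge1_subX Hv) => //; apply: (vgeC Hv).
apply: (vge1_subM Hv) => //.
- exact/(vgeX0 Hv)/(vgeC Hv).
- by apply: (vgeD Hv); [exact: (vgeX0 Hv)|exact: (vge1 Hv)].
- by have -> : x ^+ m + 1 - (iota a ^+ m + 1) = x ^+ m - iota a ^+ m by ring.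
Qed.

(** Supplies, for a polynomial denominator d(x), a place where d(x) vanishes but neither x nor y has
    a zero or pole; the root of d may lie outside K. *)
Lemma place_over (d : {poly K}) : periodic_closure q K -> (1 < size d)%N ->
  ~~ root d 0 -> (forall a : K, a ^+ m = -1 -> ~~ root d a) ->
  exists v, [/\ is_place iota v, v x = 0, v y = 0 & vge v 1 (evx iota x d)].
Proof.
move=> [M [j [cl per]]] sd d0 da.
have [|a ra] := cl (map_poly j d); first by rewrite size_map_poly.
have a0 : a != 0.
  apply: contraNneq d0 => a0; rewrite a0 rootE horner_coef0 coef_map fmorph_eq0 in ra.
  by rewrite rootE horner_coef0.
(* All m-th roots of -1 already lie in K, where they are excluded as roots of d by hypothesis. *)
have am : a ^+ m + 1 != 0.
  apply/eqP => /eqP; rewrite addr_eq0 => /eqP am.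
  have [w hw] := m_root_m1 Hq; have [z hz] := prim_root_exists Hq (m_dvd Hq).
  have jz : m.-primitive_root (j z) by rewrite fmorph_primitive_root.
  have m1M : (-1 : M) = j w ^+ m by rewrite -rmorphXn hw rmorphN1.
  have /(prim_rootP jz)[i hi] : (a / j w) ^+ m = 1.
    by rewrite exprMn exprVn am m1M divff // -m1M oppr_eq0 oner_eq0.
  have w0 : j w != 0.
    apply: contra_eq_neq m1M => ->; rewrite expr0n.
    by have := m_gt1 Hq; case: m => // k _; rewrite oppr_eq0 oner_eq0.
  have aE : a = j (z ^+ i * w) by rewrite rmorphM rmorphXn -hi divfK.
  have := da (z ^+ i * w); rewrite exprMn hw exprAC (prim_expr_order hz) expr1n mul1r.
  by move=> /(_ erefl); rewrite -(fmorph_root j) -aE ra.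
have [|b] := cl ('X^(q.+1) + (a ^+ m * (a ^+ m + 1))%:P).
  by rewrite size_XnaddC.
rewrite rootE hornerD hornerXn hornerC => /eqP hab.
have b0 : b != 0.
  apply: contra_eq_neq hab => ->.
  by rewrite expr0n add0r mulf_neq0 ?expf_neq0.
have [n1 n10 e1] := per a; have [n2 n20 e2] := per b.
have it (u : M) k l : u ^+ ((q ^ 2) ^ k) = u -> u ^+ ((q ^ 2) ^ (k * l)) = u.
  move=> h; elim: l => [|l IH]; first by rewrite muln0 expr1.
  by rewrite mulnS expnD exprM h IH.
have n12 : (0 < n1 * n2)%N by rewrite muln_gt0 n10.
have e2' : b ^+ ((q ^ 2) ^ (n1 * n2)) = b by rewrite mulnC it.
have [v [vP v0 v1 _]] := place_exists j Hq Hxy hab a0 n12 (it _ _ n2 e1) e2'.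
exists v; split=> //.
- by have := v0 'X%:P; rewrite (ev2X iota) (ev2X j); apply.
- by have := v0 'X; rewrite (ev2Y iota) (ev2Y j); apply.
- have := v1 d%:P; rewrite (ev2C iota) (ev2C j); apply.
  exact/eqP.
Qed.

End Points.

(** * The automorphisms y -> zeta y and the special places *)

Section Conjugation.
Variables (q : nat) (K L : fieldType) (iota : {rmorphism K -> L}) (x y : L).
Variable z : K.
Hypothesis Hq : admissible q K.
Hypothesis Hxy : model iota q x y.
Hypothesis zq : z ^+ q.+1 = 1.
Local Notation m := (mq q).
Local Notation E := (ev2 iota x y).
Local Notation E' := (ev2 iota x (iota z * y)).

Let z0 : iota z != 0.
Proof.
rewrite fmorph_eq0; apply: contra_eq_neq zq => ->.
by rewrite expr0n eq_sym oner_eq0.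
Qed.

Lemma model_conj : model iota q x (iota z * y).
Proof.
case: (Hxy) => c tr gen; split=> //.
  by rewrite exprMn -rmorphXn zq rmorph1 mul1r.
move=> f; have [P [Q [Q0 ->]]] := gen f; set y' := iota z * y.
have gx := generated_fst iota x y'; have gy : generated iota x y' y.
  have -> : y = (iota z)^-1 * y' by rewrite /y' mulKf.
  apply: generatedM; last exact: generated_snd.
  exact/generatedV/generatedC.
by apply: generatedM; last apply: generatedV; apply: generated_ev2_trans.
Qed.

Lemma conj_curve : (iota z * y) ^+ q.+1 + x ^+ m * (x ^+ m + 1) = 0.
Proof. by rewrite (curve_eq model_conj) addNr. Qed.

Lemma conj_eq0 P : E P = 0 -> E' P = 0.
Proof. exact: (ev2_transfer Hq Hxy iota conj_curve). Qed.

Lemma conj_neq0 P : E P != 0 -> E' P != 0.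
Proof.
apply: contra_neq; apply: (ev2_transfer Hq model_conj iota).
by rewrite (curve_eq Hxy) addNr.
Qed.

Lemma conj_place v : is_place iota v -> exists s : L -> L,
  is_place iota (v \o s) /\
  forall P Q, E Q != 0 -> s (E P / E Q) = E' P / E' Q.
Proof.
move=> Hv.
have [s hs] : {s : L -> L & forall f, exists P Q,
    [/\ E Q != 0, f = E P / E Q & s f = E' P / E' Q]}.
  apply: (@boolp.choice L L (fun f g => exists P Q,
    [/\ E Q != 0, f = E P / E Q & g = E' P / E' Q])) => f.
  have [_ _ /(_ f) [P [Q [Q0 ->]]]] := Hxy.
  by exists (E' P / E' Q), P, Q.
have sE P Q : E Q != 0 -> s (E P / E Q) = E' P / E' Q.
  move=> Q0; have [P1 [Q1 [Q10 e1 ->]]] := hs (E P / E Q).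
  have : E (P * Q1 - P1 * Q) = 0.
    rewrite (ev2B iota) !(ev2M iota); move/eqP: e1; rewrite eqr_div // => /eqP ->.
    by rewrite subrr.
  move=> /conj_eq0 /eqP; rewrite (ev2B iota) !(ev2M iota) subr_eq0 => /eqP h.
  by apply/eqP; rewrite eqr_div ?conj_neq0 // h.
have sE1 P : s (E P) = E' P.
  by have := @sE P 1; rewrite !ev2_1 !divr1; apply; apply: oner_neq0.
have fE f : exists P Q, E Q != 0 /\ f = E P / E Q.
  by have [P1 [Q1 [Q10 e1 _]]] := hs f; exists P1, Q1.
have s_neq0 f : f != 0 -> s f != 0.
  have [P [Q [Q0 ->]]] := fE f; rewrite sE //.
  rewrite mulf_eq0 negb_or => /andP[P0 _].
  by rewrite mulf_neq0 ?invr_eq0 ?conj_neq0.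
exists s; split=> //; split=> /=.
- by have := sE1 0; rewrite !rmorph0 => ->; rewrite (v0 Hv).
- move=> c c0; have := sE1 c%:P%:P; rewrite !ev2CC => ->.
  by rewrite (vC Hv).
- move=> f g f0 g0.
  have -> : s (f * g) = s f * s g.
    have [P [Q [Q0 ->]]] := fE f; have [P1 [Q1 [Q10 ->]]] := fE g.
    by rewrite mulf_div -!(ev2M iota) !sE ?(ev2M iota) ?mulf_neq0 // mulf_div.
  by rewrite (vM Hv) ?s_neq0.
- move=> f g f0 g0 fg0.
  have e : s (f + g) = s f + s g.
    have [P [Q [Q0 ->]]] := fE f; have [P1 [Q1 [Q10 ->]]] := fE g.
    rewrite addf_div // -!(ev2M iota) -(ev2D iota) !sE ?(ev2M iota) ?mulf_neq0 //.
    by rewrite addf_div ?conj_neq0 // (ev2D iota) !(ev2M iota).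
  rewrite e; case: Hv => _ _ _ h _; apply: h; rewrite -?e; exact: s_neq0.
- have [_ _ _ _ [t vt]] := Hv.
  have [_ _ /(_ t) [P [Q [Q0 tE]]]] := model_conj.
  exists (E P / E Q); rewrite sE //; first by rewrite -vt tE.
  by apply: contra_neq Q0; apply: conj_eq0.
Qed.

End Conjugation.

Lemma sum_root_unity (K : fieldType) (n : nat) (w : K) :
  w ^+ n = 1 -> w != 1 -> \sum_(l < n) w ^+ l = 0.
Proof.
move=> wn w1; apply/eqP; move: (subrX1 w n); rewrite wn subrr => /esym/eqP.
by rewrite mulf_eq0 subr_eq0 (negPf w1).
Qed.

Section SpecialPlaces.
Variables (q : nat) (K L : fieldType) (iota : {rmorphism K -> L}) (x y : L).
Hypothesis Hq : admissible q K.
Hypothesis Hxy : model iota q x y.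
Local Notation m := (mq q).

Lemma a_neq0_m (a : K) : a ^+ m = -1 -> a != 0.
Proof.
move=> am; apply: contra_eq_neq am => ->; rewrite expr0n.
by have := m_gt1 Hq; case: m => // k _; rewrite eq_sym oppr_eq0 oner_eq0.
Qed.

Lemma place_Om (a : K) : a ^+ m = -1 -> exists v,
  [/\ rational_place iota v, vge v 1 (x - iota a), v x = 0, v y = 1 &
      v (x - iota a) = q.+1%:Z].
Proof.
move=> am; have a0 := a_neq0_m am.
have hab : 0 ^+ q.+1 + a ^+ m * (a ^+ m + 1) = 0 :> K.
  by rewrite am addNr mulr0 expr0n addr0.
have [v [rv vx vxa vyb]] := rat_place_exists Hq Hxy hab a0.
exists v; split=> //.
- exact/vis_v/(at_unif_y Hq Hxy hab a0 rv.1 vxa vyb).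
- exact/vis_v/(at_b0_x Hq Hxy hab a0 rv.1 vxa vyb).
Qed.

End SpecialPlaces.

Section PlacesOffUnits.
Variables (q : nat) (K L : fieldType) (iota : {rmorphism K -> L}) (x y : L).
Hypothesis Hq : admissible q K.
Hypothesis Hxy : model iota q x y.

(** A place of O_m for the rotated coordinates (y^3/x^2, y/x): the orders 0 and 1 there solve to -3
    for x and -2 for y. Rotating once more yields [place_zero]. *)
Lemma place_infty : exists v, [/\ is_place iota v, v x = -3 & v y = -2].
Proof.
have [a am] := m_root_m1 Hq.
have [v [[Hv _] _ vx' vy' _]] := place_Om Hq (model_rot Hq Hxy) am.
have x0 := x_neq0 Hxy; have y0 := y_neq0 Hq Hxy.
rewrite (vF Hv) ?expf_neq0 // !(vXz Hv) in vx'; rewrite (vF Hv) // in vy'.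
by exists v; split=> //; lia.
Qed.

End PlacesOffUnits.

Lemma place_zero (q : nat) (K L : fieldType) (iota : {rmorphism K -> L}) (x y : L) :
  admissible q K -> model iota q x y ->
  exists v, [/\ is_place iota v, v x = 3 & v y = 1].
Proof.
move=> Hq Hxy; have [v [Hv vx' vy']] := place_infty Hq (model_rot Hq Hxy).
have x0 := x_neq0 Hxy; have y0 := y_neq0 Hq Hxy.
rewrite (vF Hv) ?expf_neq0 // !(vXz Hv) in vx'; rewrite (vF Hv) // in vy'.
by exists v; split=> //; lia.
Qed.

(** * Spaces of functions with poles bounded by multiples of the polar divisor of x *)

Section UpperBound.
Variables (q : nat) (K L : fieldType) (iota : {rmorphism K -> L}) (x y : L).
Hypothesis Hq : admissible q K.
Hypothesis Hxy : model iota q x y.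
Hypothesis Hcl : periodic_closure q K.
Local Notation m := (mq q).
Local Notation E := (ev2 iota x y).

(** The space L(kD), D the polar divisor of x: at a pole v of x its multiplicity in D is -v(x). *)
Definition LD (k : nat) (f : L) : Prop := forall v, is_place iota v ->
  (0 <= v x -> vge v 0 f) /\ (v x < 0 -> vge v (v x * k%:Z) f).

Lemma norm_to_x Q : E Q != 0 -> exists c Z, c != 0 /\ evx iota x c = E Q * E Z.
Proof.
move=> Q0.
have ix : integralOver (evx iota x) x by exact: integral_self.
have ie u n : integralOver (evx iota x) u -> integralOver (evx iota x) (u ^+ n).
  by move=> hu; elim: n => [|n IH]; [exact: integral1|rewrite exprS; apply: integral_mul].
have iy : integralOver (evx iota x) y.
  apply: (integral_poly_val (p := 'X^(q.+1))).
  - exact: monicXn.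
  - by rewrite size_polyXn.
  - by move=> i; rewrite coefXn; apply: integral_nat.
  rewrite hornerXn (curve_eq Hxy); apply/integral_opp/integral_mul; first exact: ie.
  by apply: integral_add; [exact: ie|exact: integral1].
have iE : integralOver (evx iota x) (E Q).
  rewrite [E Q]ev2_sum; elim/big_ind: _ => [||i _].
  - exact: integral0.
  - exact: integral_add.
  apply: integral_mul; last exact: ie.
  exact: integral_id.
have [p mp rp] := iE.
have [c [p' [c0 ec]]] := root_norm (monic_neq0 mp) rp Q0.
have [Z eZ] : inKxy iota x y (map_poly (evx iota x) p').[E Q].
  rewrite horner_coef; apply: inKxy_sum => i; apply: inKxyM; last exact/inKxyX/inKxy_E.
  by rewrite coef_map; apply/inKxy_evx/inKxyx.
by exists c, Z; rewrite ec eZ.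
Qed.

(** The denominator is moved into K[x] by [norm_to_x], the numerator is then reduced modulo the
    monic curve polynomial. *)
Lemma kummer_form f : exists (R : {poly {poly K}}) (c : {poly K}),
  [/\ (size R <= q.+1)%N, c != 0 & f = E R / evx iota x c].
Proof.
have [_ _ /(_ f) [P [Q [Q0 ->]]]] := Hxy.
have [c [Z [c0 ec]]] := norm_to_x Q0.
have ex0 : evx iota x c != 0 by rewrite (evx_eq0 Hxy).
exists (Pdiv.Ring.rmodp (P * Z) (Cpol q K)), c; split=> //.
  by rewrite -ltnS -(size_Cpol q K) Pdiv.Ring.ltn_rmodpN0 // monic_neq0 // monic_Cpol.
have e := Pdiv.RingMonic.rdivp_eq (monic_Cpol q K) (P * Z).
have := congr1 E e; rewrite (ev2D iota) !(ev2M iota) (ev2_Cpol0 Hxy) mulr0 add0r => <-.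
rewrite -/(E P) -/(E Q) ec.
have Z0 : E Z != 0 by apply: contraNneq ex0 => h; rewrite ec h mulr0.
by field; rewrite Z0 Q0.
Qed.

(** The maps y -> z^l y fix x and therefore preserve L(kD). The i-th component is the sum of z^(-il)
    times the l-th conjugate; no division is required, as q + 1 = 1 in K. *)
Lemma LD_component k f (R : {poly {poly K}}) (c : {poly K}) (i : nat) : LD k f -> (size R <= q.+1)%N -> c != 0 ->
  f = E R / evx iota x c -> (i < q.+1)%N ->
  LD k (evx iota x R`_i / evx iota x c * y ^+ i).
Proof.
move=> hf szR c0 fE iq v Hv.
have [z hz] := prim_root_exists Hq (q1_dvd Hq).
have zq l : (z ^+ l) ^+ q.+1 = 1 by rewrite exprAC (prim_expr_order hz) expr1n.
have ex0 : evx iota x c != 0 by rewrite (evx_eq0 Hxy).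
pose s (l : 'I_q.+1) := ev2 iota x (iota (z ^+ l) * y) R / evx iota x c.
have hs (l : 'I_q.+1) : (0 <= v x -> vge v 0 (s l)) /\ (v x < 0 -> vge v (v x * k%:Z) (s l)).
  have [sg [Hsg sgE]] := conj_place Hq Hxy (zq l) Hv.
  have := hf _ Hsg.
  have sx : sg x = x.
    by have := @sgE 'X%:P 1; rewrite !(ev2X iota) !ev2_1 !divr1; apply; apply: oner_neq0.
  have sf : sg f = s l.
    have Ec : E c%:P = evx iota x c by rewrite (ev2C iota).
    by rewrite fE -Ec sgE ?Ec // (ev2C iota).
  rewrite /= sx.
  have tr n : vge (v \o sg) n f -> vge v n (s l).
    rewrite /vge /= sf => /orP[/eqP f0|->]; last by rewrite orbT.
    have := @sgE 0 1; rewrite !ev2_1 !divr1 !rmorph0 => /(_ (oner_neq0 _)) sg0.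
    by rewrite -sf f0 sg0 eqxx.
  by move=> [h1 h2]; split=> h; apply: tr; [apply: h1|apply: h2].
have -> : evx iota x R`_i / evx iota x c * y ^+ i = \sum_(l < q.+1) iota (z ^- (i * l)) * s l.
  have hw (l : 'I_q.+1) : ev2 iota x (iota (z ^+ l) * y) R =
      \sum_(j < q.+1) evx iota x R`_j * y ^+ j * iota (z ^+ l) ^+ j.
    rewrite ev2E (@horner_coef_wide _ q.+1) ?(leq_trans (size_poly _ _)) //.
    by apply: eq_bigr => j _; rewrite coef_map exprMn mulrAC mulrA.
  have zX n : z ^+ n != 0.
    apply: expf_neq0; apply: contra_eq_neq (prim_expr_order hz) => ->.
    by rewrite expr0n eq_sym oner_eq0.
  rewrite /s; under eq_bigr => l _ do rewrite mulrA hw mulr_sumr.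
  rewrite -mulr_suml mulrAC; congr (_ / _); rewrite exchange_big.
  rewrite (bigD1 (Ordinal iq)) //= [RHS]addrC big1 ?add0r.
    rewrite (eq_bigr (fun=> evx iota x R`_i * y ^+ i)) => [|l _].
      by rewrite sumr_const card_ord -mulr_natr -natr1 (q_eq0 Hq iota) add0r mulr1.
    rewrite mulrCA -rmorphXn -exprM -rmorphM [(l * i)%N]mulnC mulVf //.
    by rewrite rmorph1 mulr1.
  move=> j ji.
  transitivity (evx iota x R`_j * y ^+ j * iota (\sum_(l < q.+1) (z ^+ j / z ^+ i) ^+ l)).
    rewrite rmorph_sum mulr_sumr; apply: eq_bigr => l _.
    rewrite mulrCA -rmorphXn -rmorphM; congr (_ * iota _).
    by rewrite exprMn exprVn -!exprM mulrC [(l * j)%N]mulnC.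
  rewrite sum_root_unity ?rmorph0 ?mulr0 //.
    by rewrite exprMn exprVn !zq invr1 mulr1.
  apply: contra ji => /eqP h; apply/eqP/val_inj => /=.
  have : z ^+ j = z ^+ i by rewrite -[LHS](@divfK _ (z ^+ i)) ?h ?mul1r.
  by move/eqP; rewrite (eq_prim_root_expr hz) !modn_small // => /eqP.
split=> h; apply: (vge_sum Hv) => l _; apply: (vgeMl Hv).
- exact: (vgeC Hv).
- exact: (hs l).1.
- exact: (vgeC Hv).
- exact: (hs l).2.
Qed.

(** Bounds the number of coefficients of p in p(x) x^(-floor(i/3)) y^i of L(kD): at a place with
    orders -3 of x and -2 of y, deg p <= k + floor(i/3) - ceil(2i/3). The truncated subtraction
    gives 0 when only p = 0 is left. *)
Definition ncoef (k i : nat) : nat := (k + i %/ 3 + 1 - (2 * i + 2) %/ 3)%N.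

Lemma vis_evx (v : L -> int) (p : {poly K}) : is_place iota v -> v x < 0 -> p != 0 ->
  vis v (v x * (size p).-1%:Z) (evx iota x p).
Proof.
move=> Hv vx p0; have x0 := x_neq0 Hxy.
have sp : (0 < size p)%N by rewrite size_poly_gt0.
rewrite /evx horner_coef size_map_poly -(prednK sp) big_ord_recr /= addrC coef_map.
apply: (visD Hv).
  rewrite -[_ * _]add0r; apply: (visM Hv); first by rewrite (visC Hv) // -lead_coefE lead_coef_eq0.
  by rewrite /vis expf_neq0 // (vXz Hv) eqxx.
apply: (vge_sum Hv) => i _; rewrite coef_map; apply: (vgeMl Hv); first exact: (vgeC Hv).
rewrite vgeE ?expf_neq0 // (vXz Hv); have := ltn_ord i; nia.
Qed.

(** In lowest terms, y^i must cancel each zero of the denominator. It can do so only over x = 0,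
    which leaves a power of x as denominator. *)
Lemma LD_coef k (r s : {poly K}) (i : nat) : s != 0 -> (i < q.+1)%N ->
  LD k (evx iota x r / evx iota x s * y ^+ i) ->
  exists2 p : {poly K}, (size p <= ncoef k i)%N &
    evx iota x r / evx iota x s * y ^+ i = evx iota x p / x ^+ (i %/ 3) * y ^+ i.
Proof.
have x0 := x_neq0 Hxy; have y0 := y_neq0 Hq Hxy.
move=> s0 iq; have [->|r0] := eqVneq r 0.
  by move=> _; exists 0; rewrite ?size_poly0 // rmorph0 !mul0r.
pose g := gcdp r s; have g0 : g != 0 by rewrite gcdp_eq0 negb_and r0.
pose r1 := r %/ g; pose s1 := s %/ g.
have er : r = r1 * g by rewrite divpK ?dvdp_gcdl.
have es : s = s1 * g by rewrite divpK ?dvdp_gcdr.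
have cop : coprimep r1 s1 by rewrite coprimep_div_gcd ?r0.
have r10 : r1 != 0 by apply: contra_neq r0; rewrite er => ->; rewrite mul0r.
have s10 : s1 != 0 by apply: contra_neq s0; rewrite es => ->; rewrite mul0r.
have ex p : p != 0 -> evx iota x p != 0 by rewrite (evx_eq0 Hxy).
have -> : evx iota x r / evx iota x s = evx iota x r1 / evx iota x s1.
  by rewrite er es !rmorphM -mulf_div divff ?mulr1 ?ex.
move=> hL.
(* A Bezout relation shows that the numerator is a unit wherever the denominator vanishes. *)
have cop_v v : is_place iota v -> 0 <= v x -> vge v 1 (evx iota x s1) ->
    v (evx iota x r1) = 0.
  move=> Hv vx hs; have hx : vge v 0 x by rewrite vgeE.
  have hr : vge v 0 (evx iota x r1) by apply: (vge_horner Hv).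
  apply/vis_v/(visP hr)/negP => h.
  have /Bezout_eq1_coprimepP [[u w] uw] := cop.
  have := congr1 (evx iota x) uw; rewrite rmorphD !rmorphM rmorph1 /= => e1.
  have := vis_lt (v := v) (ltr01 : 0 < 1 :> int) (vis1 Hv); rewrite -e1 => /negP; apply.
  by apply: (vgeD Hv); apply: (vgeMl Hv) => //; apply: (vge_horner Hv).
have vt v : is_place iota v -> v (evx iota x r1 / evx iota x s1 * y ^+ i) =
    v (evx iota x r1) - v (evx iota x s1) + v y * i%:Z.
  by move=> Hv; rewrite (vM Hv) ?mulf_neq0 ?invr_eq0 ?expf_neq0 ?ex // (vF Hv) ?ex // (vXz Hv).
have t0 : evx iota x r1 / evx iota x s1 * y ^+ i != 0.
  by rewrite !mulf_neq0 ?invr_eq0 ?expf_neq0 ?ex.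
have [e [s2 s20 es1]] := multiplicity_XsubC s1 0.
rewrite s10 /= in s20; rewrite polyC0 subr0 in es1.
have s2n0 : s2 != 0 by apply: contraNneq s20 => ->; rewrite root0.
have evs1 : evx iota x s1 = evx iota x s2 * x ^+ e by rewrite es1 rmorphM /= evxXn.
have ssz : size s2 = 1%N.
  apply/eqP; rewrite eqn_leq size_poly_gt0 s2n0 andbT leqNgt; apply/negP => sz.
  (* At a point of O_m a factor x - a has order q+1, more than the order i <= q of y^i. At the other
     zeros of s2 the order of y is 0. *)
  have [[a [am ra]]|na] := boolp.EM (exists a : K, a ^+ m = -1 /\ root s2 a).
    have [v [[Hv _] vxa vx vy vxa2]] := place_Om Hq Hxy am.
    have /factor_theorem [s3 es3] := ra.
    have vx0 : 0 <= v x by rewrite vx.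
    have s3n : s3 != 0 by apply: contra_neq s2n0; rewrite es3 => ->; rewrite mul0r.
    have vs : q.+1%:Z <= v (evx iota x s1).
      have hx : vge v 0 x by rewrite vgeE.
      have vs3 : 0 <= v (evx iota x s3).
        by rewrite -vgeE ?ex //; apply: (vge_horner Hv).
      have xa0 : x - iota a != 0.
        by apply: contra_eq_neq vxa2 => ->; rewrite (v0 Hv).
      rewrite evs1 es3 rmorphM rmorphB /= evxX evxC.
      rewrite !(vM Hv) ?mulf_neq0 ?expf_neq0 ?ex // vxa2 (vXz Hv) vx mul0r addr0.
      by rewrite lerDr.
    have hs1 : vge v 1 (evx iota x s1) by move: vs; rewrite vgeE ?ex //; apply: le_trans.
    have := (hL v Hv).1 vx0; rewrite vgeE // vt // (cop_v v) // vy.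
    by move: (v _) vs iq => w; clear; lia.
  have na' (a : K) : a ^+ m = -1 -> ~~ root s2 a.
    by move=> am; apply/negP => ra; apply: na; exists a.
  have [v [Hv vx vy vs]] := place_over Hq Hxy Hcl sz s20 na'.
  have vx0 : 0 <= v x by rewrite vx.
  have hs1 : vge v 1 (evx iota x s1).
    by rewrite evs1; apply: (vgeMr Hv) => //; apply: (vgeX0 Hv); rewrite vgeE.
  have := (hL v Hv).1 vx0; rewrite vgeE // vt // (cop_v v) // vy.
  by rewrite vgeE ?ex // in hs1; move: (v _) hs1 => w; clear; lia.
have [c c0 s2E] : exists2 c : K, c != 0 & s2 = c%:P.
  by apply/size_poly1P; rewrite ssz.
(* At a place with orders 3 of x and 1 of y, the inequality 3e <= i is forced. *)
have ei : (e <= i %/ 3)%N.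
  have [->//|e0] := posnP e.
  have [v [Hv vx vy]] := place_zero Hq Hxy.
  have vx0 : 0 <= v x by rewrite vx.
  have vs1 : v (evx iota x s1) = 3 * e%:Z.
    rewrite evs1 s2E evxC (vM Hv) ?fmorph_eq0 ?expf_neq0 // (vC Hv) (vXz Hv) vx add0r //.
  have hs1 : vge v 1 (evx iota x s1) by rewrite vgeE ?ex // vs1; move: e0; clear; lia.
  have := (hL v Hv).1 vx0; rewrite vgeE // vt // (cop_v v) // vs1 vy; clear; lia.
pose p := c^-1 *: (r1 * 'X^(i %/ 3 - e)).
have pE : evx iota x r1 / evx iota x s1 = evx iota x p / x ^+ (i %/ 3).
  rewrite /p -mul_polyC !rmorphM /= evxC evxXn evs1 s2E evxC fmorphV.
  have -> : x ^+ (i %/ 3) = x ^+ (i %/ 3 - e) * x ^+ e by rewrite -exprD subnK.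
  by field; rewrite !expf_neq0 // fmorph_eq0 c0.
exists p; last by rewrite pE.
have p0 : p != 0 by rewrite scaler_eq0 invr_eq0 negb_or c0 mulf_neq0 // monic_neq0 ?monicXn.
have [v [Hv vx vy]] := place_infty Hq Hxy.
have vx0 : v x < 0 by rewrite vx.
have := (hL v Hv).2 vx0; rewrite pE in t0 *; rewrite vgeE //.
rewrite (vM Hv) ?expf_neq0 ?mulf_neq0 ?invr_eq0 ?expf_neq0 ?ex // (vF Hv) ?expf_neq0 ?ex //.
rewrite !(vXz Hv) (vis_v (vis_evx Hv vx0 p0)) vx vy /ncoef.
have : (0 < size p)%N by rewrite size_poly_gt0.
by move: (size p) => sz; clear; lia.
Qed.

End UpperBound.

(** * Linear algebra: distinct orders against dimension *)

Section Span.
Variables (K L : fieldType) (iota : {rmorphism K -> L}).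

Fixpoint in_span (B : seq L) (f : L) : Prop :=
  if B is b :: B' then exists c, in_span B' (f - iota c * b) else f = 0.

Lemma span_cat B1 B2 f g : in_span B1 f -> in_span B2 g -> in_span (B1 ++ B2) (f + g).
Proof.
elim: B1 f => [|b B1 IH] f /=; first by move=> ->; rewrite add0r.
move=> [c hc] hg; exists c.
by rewrite addrAC; apply: IH.
Qed.

Lemma span_flatten (I : eqType) (r : seq I) (B : I -> seq L) (F : I -> L) :
  (forall i, i \in r -> in_span (B i) (F i)) ->
  in_span (flatten [seq B i | i <- r]) (\sum_(i <- r) F i).
Proof.
elim: r => [|i r IH] h /=; first by rewrite big_nil.
rewrite big_cons; apply: span_cat; first by apply: h; rewrite mem_head.
by apply: IH => j jr; apply: h; rewrite in_cons jr orbT.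
Qed.

Lemma span_coefs (T : eqType) (r : seq T) (F : T -> L) (c : T -> K) :
  in_span [seq F e | e <- r] (\sum_(e <- r) iota (c e) * F e).
Proof.
elim: r => [|e r IH] /=; first by rewrite big_nil.
by exists (c e); rewrite big_cons addrAC subrr add0r.
Qed.

Lemma span_row B f : in_span B f ->
  exists w : 'I_(size B) -> K, f = \sum_(l < size B) iota (w l) * B`_l.
Proof.
elim: B f => [|b B IH] f /=; first by move=> ->; exists (fun=> 0); rewrite big_ord0.
move=> [c /IH[w hw]]; exists (fun l => if unlift ord0 l is Some l' then w l' else c).
rewrite big_ord_recl unlift_none; move/eqP: hw; rewrite subr_eq addrC => /eqP ->.
by congr (_ + _); apply: eq_bigr => l _; rewrite liftK.
Qed.

Lemma span_dep B N (h : 'I_N -> L) : (size B < N)%N ->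
  (forall j, in_span B (h j)) ->
  exists w : 'I_N -> K, (exists j, w j != 0) /\ \sum_j iota (w j) * h j = 0.
Proof.
move=> BN hB.
have [c hc] := @boolp.choice _ _ _ (fun j => span_row (hB j)).
pose C := \matrix_(j < N, l < size B) c j l.
have kC : kermx C != 0.
  rewrite -mxrank_eq0 mxrank_ker subn_eq0 -ltnNge.
  exact: leq_ltn_trans (rank_leq_col _) BN.
have /rowV0Pn[w /sub_kermxP wC w0] := kC.
exists (fun j => w ord0 j); split.
  apply/existsP; apply: contraNT w0; rewrite negb_exists => /forallP h0.
  by apply/eqP/rowP => j; rewrite mxE; apply/eqP; have := h0 j; rewrite negbK.
under eq_bigr => j _ do rewrite hc mulr_sumr.
rewrite exchange_big big1 // => l _.
transitivity (iota ((w *m C) ord0 l) * B`_l); last by rewrite wC mxE rmorph0 mul0r.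
rewrite mxE rmorph_sum mulr_suml; apply: eq_bigr => j _.
by rewrite mxE rmorphM mulrA.
Qed.

(** Among the terms with nonzero coefficient the one of least order cannot be cancelled. *)
Lemma indep_val v N (F : 'I_N -> L) (d : 'I_N -> int) (w : 'I_N -> K) :
  is_place iota v -> injective d -> (forall j, vis v (d j) (F j)) ->
  (exists j, w j != 0) -> \sum_j iota (w j) * F j != 0.
Proof.
move=> Hv dinj hF [j0 wj0].
case: (@Order.TotalTheory.arg_minP _ _ _ j0 (fun j => w j != 0) d wj0) => j wj hj.
rewrite (bigD1 j) //=; apply/(vis_neq0 (v := v) (n := d j))/(visD Hv).
  by rewrite -[d j]add0r; apply: (visM Hv) => //; apply: (visC Hv).
apply: (vge_sum Hv) => i ij; have [->|wi] := eqVneq (w i) 0.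
  by rewrite rmorph0 mul0r vge0.
apply: (vgeMl Hv); first exact: (vgeC Hv).
have := vis_ge (hF i); apply: vge_le.
rewrite -ltzD1 ltrD2r lt_neqAle hj // andbT.
by apply: contra ij => /eqP /dinj ->.
Qed.

End Span.

Section SemigroupBound.
Variables (q : nat) (K L : fieldType) (iota : {rmorphism K -> L}) (x y : L).
Hypothesis Hq : admissible q K.
Hypothesis Hxy : model iota q x y.
Hypothesis Hcl : periodic_closure q K.
Local Notation E := (ev2 iota x y).

Definition LDbasis k : seq L := flatten [seq
  [seq x ^+ e / x ^+ (i %/ 3) * y ^+ i | e <- seq.iota 0 (ncoef k i)] | i <- seq.iota 0 q.+1].

Lemma size_LDbasis k : size (LDbasis k) = (\sum_(i < q.+1) ncoef k i)%N.
Proof.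
rewrite size_flatten /shape -map_comp sumnE big_map -(big_mkord xpredT) /index_iota subn0.
by apply: eq_bigr => i _; rewrite /= size_map size_iota.
Qed.

Lemma LD_span k f : LD iota x k f -> in_span iota (LDbasis k) f.
Proof.
move=> hf; have [R [c [szR c0 fE]]] := kummer_form Hxy f.
have -> : f = \sum_(i <- seq.iota 0 q.+1) evx iota x R`_i / evx iota x c * y ^+ i.
  rewrite fE ev2E (@horner_coef_wide _ q.+1) ?(leq_trans (size_poly _ _)) //.
  rewrite mulr_suml -[seq.iota 0 q.+1]/(index_iota 0 q.+1) big_mkord.
  by apply: eq_bigr => i _; rewrite coef_map mulrAC.
apply: span_flatten => i; rewrite mem_iota /= add0n => iq.
have hi := LD_component Hq Hxy hf szR c0 fE iq.
have [p sp ->] := LD_coef Hq Hxy Hcl c0 iq hi.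
rewrite /evx (@horner_coef_wide _ (ncoef k i)) ?size_map_poly //.
rewrite !mulr_suml -(big_mkord xpredT (fun e => (map_poly iota p)`_e * x ^+ e / x ^+ (i %/ 3) * y ^+ i)).
rewrite /index_iota subn0.
pose F e := x ^+ e / x ^+ (i %/ 3) * y ^+ i.
rewrite (eq_bigr (fun e => iota p`_e * F e)) => [|e _].
  exact: (span_coefs iota _ F (fun e => p`_e)).
by rewrite coef_map /F !mulrA.
Qed.

(** Multiplying a function with pole divisor h P by T^k puts it in L(kD) with order k(q+1) - h at P.
    Distinct h give distinct orders, hence independent functions. *)
Lemma weierstrass_bound v T k (hs : seq nat) : is_place iota v -> 0 <= v x ->
  vis v q.+1%:Z T -> LD iota x 1 T -> uniq hs ->
  (forall h, h \in hs -> weierstrass iota v h /\ (h <= k * q.+1)%N) ->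
  (size hs <= \sum_(i < q.+1) ncoef k i)%N.
Proof.
move=> Hv vx vT hT uhs hhs; rewrite -size_LDbasis leqNgt; apply/negP => sz.
have h2 (j : 'I_(size hs)) : exists f, [/\ f != 0, v f = - (nth 0%N hs j)%:Z
    & forall Q, is_place iota Q -> Q <> v -> 0 <= Q f].
  by have [] := hhs _ (mem_nth 0%N (ltn_ord j)).
have [f hf] := @boolp.choice _ _ _ h2.
pose F j := f j * T ^+ k.
have vF (j : 'I_(size hs)) : vis v ((k * q.+1)%N%:Z - (nth 0%N hs j)%:Z) (F j).
  have [f0 vf _] := hf j; rewrite addrC; apply: (visM Hv); first by rewrite /vis f0 vf eqxx.
  by have := visX Hv k vT; rewrite -mulr_natr natz -PoszM mulnC.
have hF (j : 'I_(size hs)) : in_span iota (LDbasis k) (F j).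
  apply: LD_span => Q HQ; have [f0 vf fQ] := hf j; have T0 := vis_neq0 vT.
  have [hT1 hT2] := hT Q HQ.
  have [->|QP] := boolp.EM (Q = v).
    split=> h; last by rewrite ltNge vx in h.
    apply: vge_le (vis_ge (vF j)); rewrite subr_ge0 lez_nat.
    by have [] := hhs _ (mem_nth 0%N (ltn_ord j)).
  have fQ0 : vge Q 0 (f j) by rewrite vgeE // fQ.
  split=> h; first by apply: (vgeMl HQ) => //; apply: (vgeX0 HQ); apply: hT1.
  apply: (vgeMl HQ) => //; have := vgeX HQ k (hT2 h).
  by rewrite mulr1 -mulr_natr natz.
have [w [w0 ws]] := span_dep sz hF.
have dinj : injective (fun j : 'I_(size hs) => (k * q.+1)%N%:Z - (nth 0%N hs j)%:Z).
  move=> i j /addrI /oppr_inj [] /eqP; rewrite nth_uniq // => /eqP.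
  exact: val_inj.
by have := indep_val Hv dinj vF w0; rewrite ws eqxx.
Qed.

End SemigroupBound.

(** * The numerical semigroups *)

Section Nongaps.
Local Open Scope nat_scope.
Variables (q m d : nat).
Hypothesis q1 : q.+1 = 3 * m.
Hypothesis m1 : 1 < m.
Hypothesis dm : d %| m.

(* [order_ok k o] characterizes the vanishing orders [o <= q] at the point of the
   sections of k times the class of [q.+1] P; the corresponding pole number is
   [k * q.+1 - o]. *)
Definition order_ok (k o : nat) : bool :=
  if k < m then [|| o < 3 * k - 1, (o == 3 * k - 1) && ~~ (d %| k) |
                    (o == 3 * k) && (d %| k)]
  else (m < k) || (o != q).

(** [k] is the ceiling of n/(q+1), the only level at which n = k(q+1) - o with 0 <= o <= q. *)
Definition nongap (n : nat) : bool :=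
  let k := (n + q) %/ q.+1 in order_ok k (k * q.+1 - n).

Lemma nongap_level k o : 0 < k -> o <= q -> nongap (k * q.+1 - o) = order_ok k o.
Proof.
move=> k0 oq; rewrite /nongap.
have -> : (k * q.+1 - o + q) %/ q.+1 = k.
  have -> : k * q.+1 - o + q = k * q.+1 + (q - o) by nia.
  by rewrite divnMDl // divn_small ?addn0 //; lia.
by congr order_ok; nia.
Qed.

Lemma nongap0 : nongap 0.
Proof. by rewrite /nongap add0n divn_small // /order_ok (ltn_trans _ m1) // dvdn0. Qed.

Lemma level_exists n : 0 < n -> exists k o, [/\ 0 < k, o <= q & n = k * q.+1 - o].
Proof.
move=> n0; exists ((n + q) %/ q.+1), ((n + q) %/ q.+1 * q.+1 - n).
have := divn_eq (n + q) q.+1; have := ltn_pmod (n + q) (ltn0Sn q).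
set k := _ %/ _; set r := _ %% _ => h1 h2; split; nia.
Qed.

Section Generation.
Variable S : nat -> Prop.
Hypothesis S0 : S 0.
Hypothesis SD : forall a b, S a -> S b -> S (a + b).
Hypothesis Sq : S q.
Hypothesis Sq1 : S q.+1.
Hypothesis Snonflex : forall k, 0 < k < d -> k < m -> S (k * q.+1 - (3 * k - 1)).
Hypothesis Sflex : d < m -> S (d * q.+1 - 3 * d).

Let W k o := S (k * q.+1 - o).

Let WD k o k' o' : o <= k * q.+1 -> o' <= k' * q.+1 -> W k o -> W k' o' ->
  W (k + k') (o + o').
Proof.
move=> h1 h2 a b; have := SD a b; rewrite /W; congr S; nia.
Qed.

Let W10 : W 1 0. Proof. by rewrite /W mul1n subn0. Qed.
Let W11 : W 1 1. Proof. by rewrite /W mul1n subn1. Qed.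

Let d_gt0 : 0 < d. Proof. by apply: dvdn_gt0 dm; lia. Qed.

Let flex_multiple k : k < m -> d %| k -> W k (3 * k).
Proof.
move=> km /dvdnP[a ak]; rewrite {k}ak in km *.
elim: a km => [|a IH] km; first by rewrite /W.
have h : W d (3 * d) by apply: Sflex; nia.
have := WD _ _ (IH _) h; rewrite -mulnDr -mulSnr; apply; nia.
Qed.

(** Writing k = ad + b with 0 < b < d, order 3ad at level ad and order 3b - 1 at level b add up. *)
Let last_nonflex k : k < m -> ~~ (d %| k) -> W k (3 * k - 1).
Proof.
move=> km nd; have k_eq := divn_eq k d; have rd := ltn_pmod k d_gt0.
have r0 : 0 < k %% d by rewrite lt0n.
have h1 : W (k %/ d * d) (3 * (k %/ d * d)).
  by apply: flex_multiple; rewrite ?dvdn_mull //; lia.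
have h2 : W (k %% d) (3 * (k %% d) - 1) by apply: Snonflex; [rewrite r0|exact: leq_ltn_trans (leq_mod _ _) km].
have := WD _ _ h1 h2; rewrite -k_eq => h.
move: k_eq r0 h; set a := k %/ d * d; set b := k %% d => k_eq r0 h.
clearbody a b; have -> : 3 * k - 1 = 3 * a + (3 * b - 1) by lia.
by apply: h; nia.
Qed.

(** Level k+1 is reached from level k by adding orders 0 and 1 of level 1. Only o = 3k and 3k+1 need
    more: if d divides k, start from order 3k; otherwise from 3k-1 and add 1 or 2. Order 2 is
    available at level 1 because then d > 1. *)
Let interior k o : 0 < k <= m -> o <= 3 * k - 2 -> W k o.
Proof.
elim: k o => [//|k IH] o; rewrite ltnS /= => km ok.
have [k0|k0] := posnP k.
  by move: ok; rewrite k0; case: o => [|[|o]].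
have W1 i : i <= 1 -> W 1 i by case: i => [|[|i]].
have IHk i : i <= 3 * k - 2 -> W k i by apply: IH; rewrite k0 ltnW.
rewrite -addn1.
have [h1|h1] := leqP o (3 * k - 1).
  have [h2|h2] := leqP o (3 * k - 2).
    by rewrite -[o]addn0; apply: WD => //; [nia|exact: IHk].
  have -> : o = 3 * k - 2 + 1 by lia.
  by apply: WD => //; [nia|exact: IHk].
have [dk|dk] := boolP (d %| k).
  have -> : o = 3 * k + (o - 3 * k) by lia.
  by apply: WD; [nia|lia|exact: flex_multiple|apply: W1; lia].
have -> : o = 3 * k - 1 + (o - (3 * k - 1)) by lia.
apply: WD; [nia|lia|exact: last_nonflex|].
have [h2|h2] := leqP (o - (3 * k - 1)) 1; first exact: W1.
have -> : o - (3 * k - 1) = 3 * 1 - 1 by lia.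
apply: last_nonflex => //; rewrite dvdn1; apply: contra dk => /eqP ->.
exact: dvd1n.
Qed.

Let beyond k o : m < k -> o <= q -> W k o.
Proof.
elim: k o => // k IH o; rewrite ltnS leq_eqVlt => /orP[/eqP mk|mk] oq; last first.
  by rewrite -addn1 -[o]addn0; apply: WD => //; [nia|exact: IH].
rewrite -addn1 -mk; have [h|h] := leqP o (3 * m - 2).
  by rewrite -[o]addn0; apply: WD => //; [nia|apply: interior => //; lia].
have -> : o = 3 * m - 2 + 1 by lia.
by apply: WD => //; [nia|apply: interior => //; lia].
Qed.

Lemma nongap_generated n : nongap n -> S n.
Proof.
case: n => [//|n]; have [k [o [k0 oq ->]]] := level_exists (ltn0Sn n).
rewrite nongap_level // /order_ok; case: ltnP => km.
  case/or3P=> [h|/andP[/eqP -> h]|/andP[/eqP -> h]].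
  - by apply: interior; [rewrite k0 ltnW|lia].
  - exact: last_nonflex.
  - exact: flex_multiple.
case/orP=> [h|h]; first exact: beyond.
have [h2|h2] := ltnP m k; first exact: beyond.
by apply: interior; lia.
Qed.

End Generation.

(** Level k occupies the q+1 integers ending at k(q+1). For k < m it has the orders 0, ..., 3k-2 and
    one of 3k-1 and 3k, whichever of the two: the count 3k is the same for every d. *)
Lemma size_block k : 0 < k ->
  (if k < m then 3 * k else if k == m then q else q.+1) <=
  count nongap (iota (k.-1 * q.+1).+1 q.+1).
Proof.
move=> k0.
pose O := if k < m then rcons (iota 0 (3 * k - 1)) (if d %| k then 3 * k else 3 * k - 1)
          else if k == m then iota 0 q else iota 0 q.+1.
have sO : size O = if k < m then 3 * k else if k == m then q else q.+1.
  rewrite /O; case: ifP => h; last by case: ifP; rewrite size_iota.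
  by rewrite size_rcons size_iota; lia.
have Oq o : o \in O -> o <= q.
  rewrite /O; case: ifP => h.
    by rewrite mem_rcons in_cons mem_iota => /orP[/eqP->|]; [case: ifP|]; lia.
  by case: ifP; rewrite mem_iota; lia.
have Ook o : o \in O -> order_ok k o.
  rewrite /O /order_ok; case: ifP => h.
    rewrite mem_rcons in_cons mem_iota add0n => /orP[/eqP->|/andP[_ ->] //].
    by case: (d %| k); rewrite !eqxx ?orbT.
  case: ifP => [_|hk _]; first by rewrite mem_iota; lia.
  by rewrite ltn_neqAle eq_sym hk leqNgt h.
have uO : uniq O.
  rewrite /O; case: ifP => h; last by case: ifP; rewrite iota_uniq.
  by rewrite rcons_uniq iota_uniq mem_iota andbT; case: ifP; lia.
rewrite -sO -size_filter -(size_map (fun o => k * q.+1 - o) O); apply: uniq_leq_size.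
  rewrite map_inj_in_uniq // => o1 o2 /Oq h1 /Oq h2; nia.
move=> n /mapP[o hO ->]; have oq := Oq o hO.
rewrite mem_filter nongap_level // Ook // andTb mem_iota.
by move: oq k0; case: (k) => // k' oq _; rewrite succnK; nia.
Qed.

(** Both sides are 3km - 3m(m-1)/2 if the lower bounds of [size_block] are taken. The assumption m
    <= k keeps the subtractions in [ncoef] from truncating. *)
Lemma count_nongap k : m <= k ->
  \sum_(i < q.+1) ncoef k i <= count nongap (iota 0 (k * q.+1).+1).
Proof.
move=> mk.
have blk j : count nongap (iota 0 (j.+1 * q.+1).+1) =
    count nongap (iota 0 (j * q.+1).+1) + count nongap (iota (j.+1.-1 * q.+1).+1 q.+1).
  by rewrite mulSn addnC -addSn iotaD count_cat add0n.
have low j : j < m -> 1 + \sum_(i < j.+1) 3 * i <= count nongap (iota 0 (j * q.+1).+1).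
  elim: j => [|j IH] jm; first by rewrite big_ord_recl big_ord0 /= nongap0.
  have -> : \sum_(i < j.+2) 3 * i = \sum_(i < j.+1) 3 * i + 3 * j.+1 by rewrite big_ord_recr.
  rewrite blk addnA.
  by apply: leq_add; [apply: IH; lia|have := size_block (ltn0Sn j); rewrite jm].
have high j : 1 + \sum_(i < m) 3 * i + q + j * q.+1 <=
    count nongap (iota 0 ((m + j) * q.+1).+1).
  elim: j => [|j IH].
    rewrite mul0n !addn0 -[in X in _ <= X](prednK (ltnW m1)) blk prednK ?(ltnW m1) //.
    apply: leq_add; last by have := size_block (ltnW m1); rewrite ltnn eqxx.
    by have := low m.-1; rewrite prednK ?(ltnW m1) //; apply.
  rewrite addnS blk mulSnr addnA; apply: leq_add => //.
  have := size_block (ltn0Sn (m + j)).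
  have -> : ((m + j).+1 < m) = false by lia.
  by have -> : ((m + j).+1 == m) = false by lia.
apply: leq_trans (_ : 1 + \sum_(i < m) 3 * i + q + (k - m) * q.+1 <= _); last first.
  by have := high (k - m); rewrite subnKC.
rewrite q1; have tri n : (\sum_(i < n) 3 * i) * 2 = 3 * n * (n - 1).
  by elim: n => [|n IH]; rewrite ?big_ord0 // big_ord_recr /= mulnDl IH; nia.
(* Three consecutive indices 3n, 3n+1, 3n+2 contribute k-n+1, k-n and k-n-1. *)
have nc n : n <= m -> \sum_(i < 3 * n) ncoef k i + 3 * n * (n - 1) = 3 * k * n + \sum_(i < n) 3 * i.
  elim: n => [|n IH] nm; first by rewrite !muln0 !big_ord0.
  rewrite mulnS ![3 + _]addnC !addnS addn0 !big_ord_recr /=.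
  have e0 : ncoef k (3 * n) = k - n + 1 by rewrite /ncoef; lia.
  have e1 : ncoef k (3 * n).+1 = k - n by rewrite /ncoef; lia.
  have e2 : ncoef k (3 * n).+2 = k - n - 1 by rewrite /ncoef; lia.
  rewrite e0 e1 e2; have := IH (ltnW nm); have : n < k by lia.
  move: (\sum_(i < 3 * n) _) (\sum_(i < n) _) => A B; nia.
have := nc m (leqnn m); have := tri m.
move: (\sum_(i < 3 * m) _) (\sum_(i < m) _) => A B; nia.
Qed.

End Nongaps.

Section Injectivity.
Local Open Scope nat_scope.

(** For d1 < d2 the order 3 d1 at level d1 is allowed for d1 but not for d2, which does not divide
    d1. *)
Lemma nongap_inj (q m d1 d2 : nat) : q.+1 = 3 * m -> 0 < d1 -> 0 < d2 ->
  d1 %| m -> d2 %| m -> 0 < m -> (forall n, nongap q m d1 n = nongap q m d2 n) -> d1 = d2.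
Proof.
move=> q1; wlog : d1 d2 / d1 < d2.
  move=> w h1 h2 dv1 dv2 m0 h; have [lt|gt|//] := ltngtP d1 d2; first exact: w.
  by apply/esym/w.
move=> lt d10 d20 dv1 dv2 m0 h.
have d2m : d2 <= m by apply: dvdn_leq.
have d1m : d1 < m by exact: leq_trans lt d2m.
have := h (d1 * q.+1 - 3 * d1); rewrite !nongap_level //; try lia.
rewrite /order_ok d1m eqxx dvdnn !orbT; have -> : (d2 %| d1) = false.
  by apply: contraTF lt => /dvdn_leq; rewrite -leqNgt; apply.
rewrite andbF orbF; have -> : (3 * d1 == 3 * d1 - 1) = false by lia.
by rewrite orbF; lia.
Qed.

End Injectivity.

(** * Pole numbers from vanishing orders *)

Section Tangent.
Variables (q : nat) (K L : fieldType) (iota : {rmorphism K -> L}) (x y : L).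
Hypothesis Hq : admissible q K.
Hypothesis Hxy : model iota q x y.
Hypothesis Hcl : periodic_closure q K.
Local Notation m := (mq q).

(* The divisor of [T] is [q.+1] times the place [v], minus the divisor of poles
   of [x]. *)
Definition tangent (v : L -> int) (T : L) : Prop :=
  [/\ 0 <= v x, vis v q.+1%:Z T &
      forall Q, is_place iota Q -> Q <> v ->
        (0 <= Q x -> vis Q 0 T) /\ (Q x < 0 -> vis Q (Q x) T)].

Variables (v : L -> int) (T : L).
Hypothesis Hv : is_place iota v.
Hypothesis HT : tangent v T.

Lemma tangent_LD : LD iota x 1 T.
Proof.
move=> Q HQ; have [vx vT hT] := HT.
have [->|Qv] := boolp.EM (Q = v).
  by split=> h; [apply: vge_le (vis_ge vT)|rewrite ltNge vx in h].
by have [h1 h2] := hT Q HQ Qv; split=> h; rewrite ?mulr1; apply/vis_ge; auto.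
Qed.

Lemma weierstrass_of_LD k F o : LD iota x k F -> vis v o%:Z F -> (o <= k * q.+1)%N ->
  weierstrass iota v (k * q.+1 - o).
Proof.
move=> hF vF ok; have [vx vT hT] := HT; have T0 := vis_neq0 vT; have F0 := vis_neq0 vF.
exists (F / T ^+ k); split.
- by rewrite mulf_neq0 ?invr_eq0 ?expf_neq0.
- apply: vis_v; have := visF Hv vF (visX Hv k vT).
  by rewrite -mulr_natr natz -subzn // opprB PoszM [_ * k%:Z]mulrC.
move=> Q HQ Qv; have [h1 h2] := hT Q HQ Qv; have [f1 f2] := hF Q HQ.
rewrite -vgeE ?mulf_neq0 ?invr_eq0 ?expf_neq0 //.
have [h|h] := leP 0 (Q x).
  have := vgeM HQ (f1 h) (vis_ge (visV HQ (visX HQ k (h1 h)))).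
  by rewrite mul0rn oppr0 addr0.
have := vgeM HQ (f2 h) (vis_ge (visV HQ (visX HQ k (h2 h)))).
by rewrite -mulr_natr natz subrr.
Qed.

Lemma weierstrass0 : weierstrass iota v 0.
Proof.
exists 1; split; [exact: oner_neq0|by rewrite (v1 Hv) oppr0|].
by move=> Q HQ _; rewrite (v1 HQ).
Qed.

Lemma weierstrassD n1 n2 :
  weierstrass iota v n1 -> weierstrass iota v n2 -> weierstrass iota v (n1 + n2).
Proof.
move=> [f [f0 vf hf]] [g [g0 vg hg]]; exists (f * g); split.
- by rewrite mulf_neq0.
- by rewrite (vM Hv) // vf vg PoszD opprD.
by move=> Q HQ Qv; rewrite (vM HQ) // addr_ge0 //; [exact: hf|exact: hg].
Qed.

Lemma weierstrass_q : (exists2 F, LD iota x 1 F & vis v 1 F) -> weierstrass iota v q.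
Proof.
move=> [F hF vF]; have := @weierstrass_of_LD 1 F 1 hF vF.
by rewrite mul1n subn1; apply.
Qed.

Lemma weierstrass_q1 : weierstrass iota v q.+1.
Proof.
have := @weierstrass_of_LD 1 1 0; rewrite mul1n subn0; apply=> //; last exact: (vis1 Hv).
move=> Q HQ; split=> h; first exact: (vge1 HQ).
by apply: vge_le (vge1 HQ); rewrite mulr1 ltW.
Qed.

(** The three kinds of functions generate every nongap, and up to k(q+1) these already exhaust the
    dimension bound. A pole number outside the set would exceed it. *)
Lemma weierstrass_nongap d : (d %| m)%N ->
  (exists2 F, LD iota x 1 F & vis v 1 F) ->
  (forall k, (0 < k < d)%N -> (k < m)%N ->
     exists2 F, LD iota x k F & vis v (3 * k - 1)%N%:Z F) ->
  ((d < m)%N -> exists2 F, LD iota x d F & vis v (3 * d)%N%:Z F) ->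
  forall n, weierstrass iota v n <-> nongap q m d n.
Proof.
move=> dm h1 h2 h3.
have q1 := q1E Hq; have m1 := m_gt1 Hq; have q4 := q_gt4 Hq.
have NW n : nongap q m d n -> weierstrass iota v n.
  apply: (nongap_generated q1 m1 dm).
  - exact: weierstrass0.
  - exact: weierstrassD.
  - exact: weierstrass_q.
  - exact: weierstrass_q1.
  - move=> k kd km; have [F hF vF] := h2 k kd km.
    by apply: weierstrass_of_LD hF vF _; nia.
  - by move=> dm'; have [F hF vF] := h3 dm'; apply: weierstrass_of_LD hF vF _; nia.
move=> n; split; last exact: NW.
move=> Hn; apply/negPn/negP => nn.
(* The level must be at least m for the count and large enough that n <= k(q+1). *)
pose k := maxn m n; pose hs := n :: filter (nongap q m d) (seq.iota 0 (k * q.+1).+1).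
have uhs : uniq hs by rewrite cons_uniq mem_filter (negPf nn) filter_uniq ?iota_uniq.
have hhs h : h \in hs -> weierstrass iota v h /\ (h <= k * q.+1)%N.
  rewrite in_cons mem_filter mem_iota add0n ltnS => /orP[/eqP->|/andP[/NW] //].
  by split=> //; rewrite /k; nia.
have [vx vT _] := HT.
have := weierstrass_bound Hq Hxy Hcl Hv vx vT tangent_LD uhs hhs.
rewrite -[size hs]/(size _).+1 size_filter ltnNge => /negP; apply.
have mk : (m <= k)%N by exact: leq_maxl.
by apply: (count_nongap q1 m1).
Qed.

End Tangent.

(** * The points of O_m *)

Section PointOm.
Variables (q : nat) (K L : fieldType) (iota : {rmorphism K -> L}) (x y : L).
Hypothesis Hq : admissible q K.
Hypothesis Hxy : model iota q x y.
Hypothesis Hcl : periodic_closure q K.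
Local Notation m := (mq q).
Variables (v : L -> int) (a : K).
Hypothesis Hv : is_place iota v.
Hypothesis am : a ^+ m = -1.
Hypothesis vxa : vge v 1 (x - iota a).
Hypothesis vy0 : vge v 1 y.

Let hab : 0 ^+ q.+1 + a ^+ m * (a ^+ m + 1) = 0 :> K.
Proof. by rewrite am addNr mulr0 expr0n addr0. Qed.
Let a0 : a != 0. Proof. exact: (a_neq0_m Hq am). Qed.
Let vyb : vge v 1 (y - iota 0). Proof. by rewrite rmorph0 subr0. Qed.
Let x0 := x_neq0 Hxy.
Let y0 := y_neq0 Hq Hxy.

(** Where x has residue a, y^(q+1) = -x^m (x^m + 1) has residue 0; so P is the only zero of x -
    a. *)
Lemma tangent_Om : tangent q iota x v (x - iota a).
Proof.
split.
- by rewrite (vis_v (at_x_unit a0 Hv vxa)).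
- exact: (at_b0_x Hq Hxy hab a0 Hv vxa vyb).
move=> Q HQ Qv; split=> h; last first.
  apply: (visD HQ); first by rewrite v_vis.
  by rewrite (vgeN HQ); apply: vge_le (vgeC HQ a); lia.
have hx : vge Q 0 x by rewrite vgeE.
apply: visP; first by apply: (vgeB HQ hx (vgeC HQ _)).
apply/negP => hxa; apply: Qv.
apply: (rat_place_uniq Hq Hxy hab a0 HQ Hv hxa _ vxa vyb).
rewrite rmorph0 subr0; apply: (vge_primeX (n := q.+1) HQ).
  by rewrite vgeE // (vy_ge0 Hq Hxy HQ).
have hm : vge Q 1 (x ^+ m - iota a ^+ m) by apply: (vge1_subX HQ) => //; apply: (vgeC HQ).
rewrite (curve_eq Hxy) (vgeN HQ); apply: (vgeMl HQ); first exact: (vgeX0 HQ).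
by move: hm; rewrite -rmorphXn am rmorphN1 opprK.
Qed.

Lemma LD_y : LD iota x 1 y.
Proof.
move=> Q HQ; split=> h; first exact: (vge_y Hq Hxy HQ).
by rewrite vgeE // mulr1; have := vy_neg Hq Hxy HQ h; lia.
Qed.

Lemma LD_y3x : LD iota x 1 (y ^+ 3 / x).
Proof.
move=> Q HQ; rewrite !vgeE ?mulf_neq0 ?invr_eq0 ?expf_neq0 // (vF HQ) ?expf_neq0 //.
rewrite (vXz HQ) mulr1; split=> h; last by have := vy_neg Hq Hxy HQ h; lia.
have := vy_ge0 Hq Hxy HQ h; have := @vy_pos _ _ _ _ _ _ Hq Hxy Q HQ.
by lia.
Qed.

(** Here d = 1: y and y^3/x lie in L(D) and have orders 1 and 3 at P. *)
Lemma nongap_Om n : weierstrass iota v n <-> nongap q m 1 n.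
Proof.
have vy := at_unif_y Hq Hxy hab a0 Hv vxa vyb (erefl 0).
apply: (weierstrass_nongap Hq Hxy Hcl Hv tangent_Om (dvd1n m)).
- by exists y => //; apply: LD_y.
- by move=> [|k]; rewrite ?ltnn //= ltnS; case: k.
move=> _; exists (y ^+ 3 / x); first exact: LD_y3x.
have := visF Hv (visX Hv 3 vy) (at_x_unit a0 Hv vxa).
by rewrite subr0.
Qed.

End PointOm.

(** * Curves with prescribed contact at a point outside O *)

Section Gauss.
Variables (K L : fieldType) (iota : {rmorphism K -> L}).

(* [p] has Gauss valuation at least [s] when the indeterminate gets weight [w]. *)
Definition gauss_ge (Q : L -> int) (w s : int) (p : {poly L}) : Prop :=
  forall i, vge Q (s - w * i%:Z) p`_i.

(* One third of the trace of [p] evaluated at a cube root of [X]. *)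
Definition cube_trace (X : L) (p : {poly L}) : L :=
  \sum_(i < size p) p`_i * (if (3 %| i)%N then X ^+ (i %/ 3) else 0).

Variable Q : L -> int.
Hypothesis HQ : is_place iota Q.

Lemma gauss_geD w s p1 p2 : gauss_ge Q w s p1 -> gauss_ge Q w s p2 ->
  gauss_ge Q w s (p1 + p2).
Proof. by move=> h1 h2 i; rewrite coefD; apply: (vgeD HQ). Qed.

Lemma gauss_ge_monom w s u n : vge Q (s - w * n%:Z) u -> gauss_ge Q w s (u *: 'X^n).
Proof.
move=> h i; rewrite coefZ coefXn; have [->|_] := eqVneq i n; first by rewrite mulr1.
by rewrite mulr0 vge0.
Qed.

Lemma gauss_geM w s1 s2 p1 p2 : gauss_ge Q w s1 p1 -> gauss_ge Q w s2 p2 ->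
  gauss_ge Q w (s1 + s2) (p1 * p2).
Proof.
move=> h1 h2 i; rewrite coefM; apply: (vge_sum HQ) => j _.
have -> : s1 + s2 - w * i%:Z = (s1 - w * j%:Z) + (s2 - w * (i - j)%N%:Z).
  by rewrite -subzn ?leq_ord //; ring.
exact: (vgeM HQ).
Qed.

Lemma gauss_geZ w s c p : vge Q 0 c -> gauss_ge Q w s p -> gauss_ge Q w s (c *: p).
Proof. by move=> hc h i; rewrite coefZ; apply: (vgeMl HQ). Qed.

Lemma gauss_geX w s p n : gauss_ge Q w s p -> gauss_ge Q w (s * n%:Z) (p ^+ n).
Proof.
move=> h; elim: n => [|n IH].
  rewrite mulr0 expr0 => i; rewrite coefC; case: eqP => [->|_]; last exact: vge0.
  by rewrite mulr0 subr0; apply: (vge1 HQ).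
have -> : s * n.+1%:Z = s + s * n%:Z by rewrite -addn1 PoszD mulrDr mulr1 addrC.
by rewrite exprS; apply: gauss_geM.
Qed.

(** Since Q(X) = 3w, a cube root of X has weight w; only exponents divisible by 3 survive, and for
    them this weight is the true order. *)
Lemma vge_cube_trace w s X p : X != 0 -> Q X = 3 * w -> gauss_ge Q w s p ->
  vge Q s (cube_trace X p).
Proof.
move=> X0 QX h; apply: (vge_sum HQ) => i _; case: ifP => i3; last by rewrite mulr0 vge0.
have -> : s = (s - w * i%:Z) + w * i%:Z by rewrite subrK.
apply: (vgeM HQ) => //; rewrite vgeE ?expf_neq0 // (vXz HQ) QX -{1}(divnK i3).
by rewrite PoszM; move: (i %/ 3)%N => e; rewrite le_eqVlt; apply/orP; left; apply/eqP; ring.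
Qed.

(** An approximate cube root U suffices: 1 + z^i + z^(2i) is 3 or 0 according as 3 divides i, and
    U^(3e) differs from X^e by a multiple of U^3 - X. *)
Lemma cube_trace_approx N (X U z : L) (p : {poly L}) :
  (forall i, vge Q 0 p`_i) -> vge Q 0 X -> vge Q 0 U -> z ^+ 2 = - z - 1 ->
  vge Q N (U ^+ 3 - X) ->
  vge Q N (p.[U] + p.[z * U] + p.[z ^+ 2 * U] - 3%:R * cube_trace X p).
Proof.
move=> hp hX hU z2 hN.
rewrite !horner_coef /cube_trace mulr_sumr -!big_split -sumrB /=.
apply: (vge_sum HQ) => i _.
have z3 : z ^+ 3 = 1 by rewrite exprS z2 mulrBr mulrN -expr2 z2; ring.
have zs : 1 + z ^+ i + z ^+ 2 ^+ i = if (3 %| i)%N then 3%:R else 0.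
  rewrite (divn_eq i 3) [z ^+ 2 ^+ _]exprAC exprD [(_ * 3)%N]mulnC exprM z3 expr1n mul1r.
  rewrite dvdn_addr ?dvdn_mulr //; have := ltn_pmod i (isT : (0 < 3)%N).
  case: (i %% 3)%N => [|[|[|//]]] _ /=.
  - by rewrite !expr0 expr1n; ring.
  - by rewrite expr1 z2; ring.
  by rewrite z2 sqrrB sqrrN expr1n z2; ring.
have -> : p`_i * U ^+ i + p`_i * (z * U) ^+ i + p`_i * (z ^+ 2 * U) ^+ i =
    p`_i * U ^+ i * (1 + z ^+ i + z ^+ 2 ^+ i) by rewrite !exprMn; ring.
rewrite zs; case: ifP => [i3|_]; last by rewrite !mulr0 subr0 vge0.
have -> : p`_i * U ^+ i * 3%:R - 3%:R * (p`_i * X ^+ (i %/ 3)) =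
    3%:R * p`_i * ((U ^+ 3) ^+ (i %/ 3) - X ^+ (i %/ 3)).
  by rewrite -exprM mulnC divnK //; ring.
apply: (vgeMl HQ); first by apply: (vgeMl HQ) => //; apply: (vge_nat HQ).
rewrite subrXX; apply: (vgeMr HQ) => //; apply: (vge_sum HQ) => j _.
by apply: (vgeMl HQ); do ?apply: (vgeX0 HQ).
Qed.

End Gauss.

(* Residues at the point of the second and third conjugate tangent lines. *)
Definition res2 (K : fieldType) (zeta c : K) : K := (zeta - zeta ^+ 2) * (c - zeta).
Definition res3 (K : fieldType) (zeta c : K) : K := (zeta ^+ 2 - zeta) * (c - zeta ^+ 2).

(** * Points outside O: the tangent function and forms of prescribed order *)

Section PointNotO.
Variables (q : nat) (K L : fieldType) (iota : {rmorphism K -> L}) (x y : L).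
Hypothesis Hq : admissible q K.
Hypothesis Hxy : model iota q x y.
Local Notation m := (mq q).
Local Notation idK := (idfun : {rmorphism K -> K}).
Variables (a b : K).
Hypothesis hab : b ^+ q.+1 + a ^+ m * (a ^+ m + 1) = 0.
Hypothesis a0 : a != 0.
Hypothesis b0 : b != 0.

Let x0 := x_neq0 Hxy.
Let y0 := y_neq0 Hq Hxy.
(** Let (u0 : v0 : 1) lie over (a, b) on the Hermitian curve, so u0^3 = a. The tangent there is U +
    V + 1 = 0 with U = u0^q u and V = v0^q v, whence U^3 = [X], U V = [tau] and V^3 = [Y]. At the
    point, U = u0^(q+1) = c and V = -(c+1). At its image under the q^2-Frobenius, where the tangent
    meets the curve again, U = c^q = [c']. *)
Let c := a ^+ m.
Let c' := c ^+ q.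
Let X := iota (a ^+ q) * x.
Let tau := iota (b ^+ q) * y.
Let Y := tau ^+ 3 / X.

(** The product of the conjugates 1 + U + V, 1 + zU + z^2 V and 1 + z^2 U + zV, which equals 1 + U^3
    + V^3 - 3UV. *)
Definition tangentT : L := X + Y + 1 - 3%:R * tau.
Local Notation T := tangentT.

Let c3 : c ^+ 3 = a ^+ q.+1.
Proof. by rewrite -exprM mulnC -(q1E Hq). Qed.

Let c'3 : c' ^+ 3 = a ^+ q.+1.
Proof. by rewrite /c' exprAC c3 exprS exprMn (expqq Hq) mulrC. Qed.

Let bq1 : b ^+ q.+1 = - (c * (c + 1)).
Proof. by apply/eqP; rewrite -addr_eq0 hab. Qed.

Let bq1q : (b ^+ q.+1) ^+ q = b ^+ q.+1.
Proof. by rewrite exprS exprMn (expqq Hq) mulrC. Qed.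

Let cc' : c' * (c' + 1) = c * (c + 1).
Proof.
apply: oppr_inj; rewrite -bq1 -[RHS]bq1q bq1 (exprNq Hq idK) exprMn (exprDq Hq idK).
by rewrite expr1n.
Qed.

Let c0 : c != 0. Proof. by rewrite expf_neq0. Qed.
Let c'0 : c' != 0. Proof. by rewrite expf_neq0. Qed.
Let c'1 : c' + 1 != 0.
Proof.
have : b ^+ q.+1 != 0 by rewrite expf_neq0.
by rewrite bq1 -cc' oppr_eq0 mulf_eq0 negb_or => /andP[].
Qed.
Let X0 : X != 0. Proof. by rewrite mulf_neq0 ?fmorph_eq0 ?expf_neq0. Qed.
Let tau0 : tau != 0. Proof. by rewrite mulf_neq0 ?fmorph_eq0 ?expf_neq0. Qed.

Let tX0 : tau / X != 0. Proof. by rewrite mulf_neq0 // invr_eq0. Qed.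
Let Y0 : Y != 0. Proof. by rewrite mulf_neq0 ?invr_eq0 // expf_neq0. Qed.
Let YX0 : Y / X != 0. Proof. by rewrite mulf_neq0 // invr_eq0. Qed.

Let Xm : X ^+ m = iota c' * x ^+ m.
Proof. by rewrite exprMn -rmorphXn /c' /c exprAC. Qed.

Let curveT : iota c' * tau ^+ q.+1 = (iota c' + 1) * (X ^+ m * (X ^+ m + iota c')).
Proof.
rewrite exprMn -rmorphXn exprAC bq1q bq1 -cc' (curve_eq Hxy) Xm.
by rewrite rmorphN rmorphM rmorphD rmorph1; ring.
Qed.

Let XT : X * T = X ^+ 2 + tau ^+ 3 + X - 3%:R * tau * X.
Proof. by rewrite /T /Y; field. Qed.

Let YmE : Y ^+ m = tau ^+ q.+1 / X ^+ m.
Proof. by rewrite /Y expr_div_n -exprM -(q1E Hq). Qed.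

Section Elsewhere.
Variable Q : L -> int.
Hypothesis HQ : is_place iota Q.

Let QX : Q X = Q x.
Proof. by rewrite (vM HQ) ?fmorph_eq0 ?expf_neq0 // (vC HQ) add0r. Qed.
Let Qtau : Q tau = Q y.
Proof. by rewrite (vM HQ) ?fmorph_eq0 ?expf_neq0 // (vC HQ) add0r. Qed.

Let Q1 : ~~ vge Q 1 1. Proof. by apply: vis_lt (vis1 HQ). Qed.

(** T has the residue of Y + 1. If it vanished, then Y^m would have residue (-1)^m = 1, whereas the
    curve equation gives c' Y^m = (c'+1) c' there; so c'^2 = 0. At infinity the same argument
    applies to T/X and Y/X. *)
Lemma tangentT_zero : 0 < Q x -> vis Q 0 T.
Proof.
move=> h; have hy := vy_pos Hq Hxy HQ h.
have hX : vge Q 1 X by rewrite vgeE // QX -gtz0_ge1.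
have ht : vge Q 1 tau by rewrite vgeE // Qtau; move: h hy; clear; lia.
have vY : vis Q 0 Y.
  by rewrite /vis Y0 (vF HQ) ?expf_neq0 // (vXz HQ) Qtau QX hy subrr.
have h3t : vge Q 1 (3%:R * tau) by apply: (vgeMl HQ) => //; apply: (vge_nat HQ).
have hY1 : vge Q 0 (Y + 1) by apply: (vgeD HQ (vis_ge vY)); apply: (vge1 HQ).
suff vY1 : vis Q 0 (Y + 1).
  have -> : T = Y + 1 + (X - 3%:R * tau) by rewrite /T; ring.
  by apply: (visD HQ vY1); apply: (vgeB HQ).
apply: (visP hY1); apply/negP => hn.
have hm : vge Q 1 (Y ^+ m - (-1) ^+ m).
  apply: (vge1_subX HQ); [exact: vis_ge|by rewrite (vgeN HQ) (vge1 HQ)|by rewrite opprK].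
have Ym : iota c' * Y ^+ m = (iota c' + 1) * (X ^+ m + iota c').
  have Xm0 : X ^+ m != 0 by rewrite expf_neq0.
  apply: (mulfI Xm0); rewrite [in RHS]mulrCA -curveT YmE.
  by field.
rewrite (sign_m Hq iota) in hm.
have hXm : vge Q 1 (X ^+ m).
  have := m_gt1 Hq; case: (m) => // k _; rewrite exprS.
  by apply: (vgeMr HQ) => //; apply: (vgeX0 HQ); apply: vge_le hX.
have : vge Q 1 (iota (c' ^+ 2)).
  have -> : iota (c' ^+ 2) = iota c' * (Y ^+ m - 1) - (iota c' + 1) * X ^+ m.
    by rewrite mulrBr Ym rmorphXn; ring.
  apply: (vgeB HQ); apply: (vgeMl HQ) => //; first exact: (vgeC HQ).
  by apply: (vgeD HQ); [exact: (vgeC HQ)|exact: (vge1 HQ)].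
by rewrite (vge1C HQ) expf_eq0 (negPf c'0).
Qed.

Lemma tangentT_infty : Q x < 0 -> vis Q (Q x) T.
Proof.
move=> h; have hy := vy_neg Hq Hxy HQ h.
have hX : vge Q 1 X^-1 by rewrite vgeE ?invr_eq0 // (vV HQ) QX; move: h; clear; lia.
have ht : vge Q 1 (tau / X).
  by rewrite vgeE ?tX0 // (vF HQ) // QX Qtau; move: h hy; clear; lia.
pose Z := Y / X.
have vZ : vis Q 0 Z.
  rewrite /vis YX0 (vF HQ) // [Q Y](vF HQ) ?expf_neq0 // (vXz HQ) Qtau QX.
  by apply/eqP; move: h hy; clear; lia.
have hZ1 : vge Q 0 (Z + 1) by apply: (vgeD HQ (vis_ge vZ)); apply: (vge1 HQ).
suff vZ1 : vis Q 0 (Z + 1).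
  have -> : T = X * (Z + 1 + (X^-1 - 3%:R * (tau / X))).
    by rewrite /T /Z; field.
  rewrite -[Q x]addr0; apply: (visM HQ); first by rewrite /vis X0 QX eqxx.
  apply: (visD HQ vZ1); apply: (vgeB HQ) => //.
  by apply: (vgeMl HQ) => //; apply: (vge_nat HQ).
apply: (visP hZ1); apply/negP => hn.
have hm : vge Q 1 (Z ^+ m - (-1) ^+ m).
  apply: (vge1_subX HQ); [exact: vis_ge|by rewrite (vgeN HQ) (vge1 HQ)|by rewrite opprK].
have Zm : iota c' * Z ^+ m = (iota c' + 1) * (1 + iota c' * (X^-1) ^+ m).
  have Xm0 : X ^+ m != 0 by rewrite expf_neq0.
  apply: (mulfI (mulf_neq0 Xm0 Xm0)).
  have -> : X ^+ m * X ^+ m * (iota c' * Z ^+ m) = iota c' * tau ^+ q.+1.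
    by rewrite /Z expr_div_n YmE; field.
  by rewrite curveT exprVn; field.
rewrite (sign_m Hq iota) in hm.
have hXm : vge Q 1 ((X^-1) ^+ m).
  have := m_gt1 Hq; case: (m) => // k _; rewrite exprS.
  by apply: (vgeMr HQ) => //; apply: (vgeX0 HQ); apply: vge_le hX.
have : vge Q 1 1.
  have -> : 1 = iota c' * (Z ^+ m - 1) - (iota c' + 1) * (iota c' * (X^-1) ^+ m).
    by rewrite mulrBr Zm; ring.
  apply: (vgeB HQ); apply: (vgeMl HQ) => //; first exact: (vgeC HQ).
    by apply: (vgeD HQ); [exact: (vgeC HQ)|exact: (vge1 HQ)].
  by apply: (vgeMl HQ) => //; apply: (vgeC HQ).
by apply/negP.
Qed.

(* Modulo [Q], [T = 0] is a nodal cubic parametrized by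
   [X = U ^+ 3], [tau = - U * (U + 1)] with [U = (X - tau) / (1 - tau)], and on it
   [curveT] becomes [(U - c') * (U - c) ^+ q = 0]. *)
Lemma tangentT_affine : Q x = 0 -> vge Q 1 T ->
  vge Q 1 (x - iota a) /\ vge Q 1 (y - iota b).
Proof.
move=> Qx hT; have hx0 : 0 <= Q x by rewrite Qx.
have gx : vge Q 0 x by rewrite vgeE.
have gy : vge Q 0 y by rewrite vgeE // (vy_ge0 Hq Hxy HQ).
have gX : vge Q 0 X by apply: (vgeMl HQ) => //; apply: (vgeC HQ).
have gt : vge Q 0 tau by apply: (vgeMl HQ) => //; apply: (vgeC HQ).
have gC (k : K) := vgeC HQ k.
(* For e = c and for e = c', the values of X and tau at (a, b) are e^3 and -e(e+1). *)
have finish (e : K) : e ^+ 3 = a ^+ q.+1 -> e * (e + 1) = c * (c + 1) ->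
    vge Q 1 (X - iota (e ^+ 3)) -> vge Q 1 (tau + iota (e * (e + 1))) ->
    vge Q 1 (x - iota a) /\ vge Q 1 (y - iota b).
  move=> -> -> hX ht; split.
    apply: (vgeM0K HQ (visC HQ (expf_neq0 q a0))).
    by rewrite mulrBr -rmorphM -exprSr.
  apply: (vgeM0K HQ (visC HQ (expf_neq0 q b0))).
  by rewrite mulrBr -rmorphM -exprSr bq1 rmorphN opprK.
have hXT : vge Q 1 (X * T) by apply: (vgeMl HQ).
(* This is the node X = tau = 1. The curve equation there leaves 1 + c' + c'^2 = 0, so (a, b) itself
   lies over the node. *)
have [t1|t1] := boolP (vge Q 1 (1 - tau)).
  have X1 : vge Q 1 (X - 1).
    apply: (vge_primeX (n := 2) HQ); first by apply: (vgeB HQ gX (vge1 HQ)).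
    have -> : (X - 1) ^+ 2 = X * T + (1 - tau) * (tau ^+ 2 + tau + 1 - 3%:R * X).
      by rewrite XT; ring.
    apply: (vgeD HQ hXT); apply: (vgeMr HQ) => //.
    apply: (vgeB HQ); last by apply: (vgeMl HQ) => //; apply: (vge_nat HQ).
    by apply: (vgeD HQ); [apply: (vgeD HQ) => //; exact: (vgeX0 HQ)|exact: (vge1 HQ)].
  have e1 : 1 + c' + c' ^+ 2 = 0.
    apply/eqP; rewrite -(vge1C HQ).
    have Xm1 : vge Q 1 (X ^+ m - 1 ^+ m) by apply: (vge1_subX HQ) => //; exact: (vge1 HQ).
    have tq1 : vge Q 1 (1 ^+ q.+1 - tau ^+ q.+1) by apply: (vge1_subX HQ) => //; exact: (vge1 HQ).
    rewrite !expr1n in Xm1 tq1.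
    have -> : iota (1 + c' + c' ^+ 2) =
      - (iota c' * (1 - tau ^+ q.+1)) - (iota c' + 1) * ((X ^+ m - 1) * (X ^+ m + 1 + iota c')).
      rewrite mulrBr curveT !rmorphD rmorph1 rmorphXn; ring.
    apply: (vgeB HQ); first by rewrite (vgeN HQ); apply: (vgeMl HQ).
    apply: (vgeMl HQ); first by apply: (vgeD HQ) => //; exact: (vge1 HQ).
    apply: (vgeMr HQ) => //; apply: (vgeD HQ) => //; apply: (vgeD HQ); last exact: (vge1 HQ).
    exact: (vgeX0 HQ).
  have e3 : c' ^+ 3 = 1.
    apply/eqP; rewrite -subr_eq0; have -> : c' ^+ 3 - 1 = (c' - 1) * (1 + c' + c' ^+ 2) by ring.
    by rewrite e1 mulr0.
  have e4 : c' * (c' + 1) = -1.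
    apply/eqP; rewrite -subr_eq0 opprK; have -> : c' * (c' + 1) + 1 = 1 + c' + c' ^+ 2 by ring.
    by rewrite e1.
  apply: (finish c') => //.
    by rewrite e3 rmorph1.
  by rewrite e4 rmorphN1 -(vgeN HQ) opprB.
have vt1 : vis Q 0 (1 - tau) by apply: visP => //; apply: (vgeB HQ (vge1 HQ)).
have t10 := vis_neq0 vt1.
pose U := (X - tau) / (1 - tau).
have gU : vge Q 0 U.
  apply: (vgeMr HQ); first exact: (vgeB HQ).
  by have := vis_ge (visV HQ vt1); rewrite oppr0.
have U3 : vge Q 1 (U ^+ 3 - X).
  apply: (vgeM0K HQ (visX HQ 3 vt1)).
  have -> : (1 - tau) ^+ 3 * (U ^+ 3 - X) = X * T * (X - 1) by rewrite XT /U; field.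
  by apply: (vgeMr HQ) => //; apply: (vgeB HQ gX (vge1 HQ)).
have U2 : vge Q 1 (tau + U * (U + 1)).
  apply: (vgeM0K HQ (visX HQ 2 vt1)).
  by have -> : (1 - tau) ^+ 2 * (tau + U * (U + 1)) = X * T by rewrite XT /U; field.
have vU : vis Q 0 U.
  apply: visP => //; apply/negP => h; suff : vge Q 1 X by rewrite vgeE // QX Qx.
  have -> : X = U ^+ 3 - (U ^+ 3 - X) by ring.
  by apply: (vgeB HQ) => //; rewrite exprS; apply: (vgeMr HQ) => //; apply: (vgeX0 HQ).
have gU1 : vge Q 0 (U + 1) by apply: (vgeD HQ gU (vge1 HQ)).
have key : vge Q 1 ((U - iota c') * (U - iota c) ^+ q).
  rewrite (exprBq Hq iota) -rmorphXn -/c'.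
  have hXm : vge Q 1 ((U ^+ 3) ^+ m - X ^+ m) by apply: (vge1_subX HQ) => //; apply: (vgeX0 HQ).
  rewrite -exprM -(q1E Hq) in hXm.
  have htq : vge Q 1 (tau ^+ q.+1 - (- (U * (U + 1))) ^+ q.+1).
    apply: (vge1_subX HQ) => //; last by rewrite opprK.
    by rewrite (vgeN HQ); apply: (vgeMl HQ).
  have sg : (- (U * (U + 1))) ^+ q.+1 = U ^+ q.+1 * ((U + 1) * (U ^+ q + 1)).
    rewrite -mulN1r exprMn (sign_q1 Hq iota) mul1r exprMn; congr (_ * _).
    by rewrite exprS (exprDq Hq iota) expr1n.
  have vUq : vis Q 0 (U ^+ q.+1) by have := visX HQ q.+1 vU; rewrite mul0rn.
  apply: (vgeM0K HQ vUq).
  have gUq : vge Q 0 (U ^+ q.+1) by apply: (vgeX0 HQ).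
  have gXm : vge Q 0 (X ^+ m) by apply: (vgeX0 HQ).
  have -> : U ^+ q.+1 * ((U - iota c') * (U ^+ q - iota c')) =
     iota c' * (tau ^+ q.+1 - (- (U * (U + 1))) ^+ q.+1)
     + (iota c' + 1) * ((U ^+ q.+1 - X ^+ m) * (U ^+ q.+1 + X ^+ m + iota c')).
    by rewrite [iota c' * (_ - _)]mulrBr curveT sg !(exprS U q); ring.
  apply: (vgeD HQ); first exact: (vgeMl HQ).
  apply: (vgeMl HQ); first by apply: (vgeD HQ) => //; exact: (vge1 HQ).
  by apply: (vgeMr HQ) => //; do 2! apply: (vgeD HQ) => //.
have fin2 (e : K) : e ^+ 3 = a ^+ q.+1 -> e * (e + 1) = c * (c + 1) ->
    vge Q 1 (U - iota e) -> vge Q 1 (x - iota a) /\ vge Q 1 (y - iota b).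
  move=> h1 h2 hU; apply: (finish e) => //.
    have -> : X - iota (e ^+ 3) = (U ^+ 3 - iota e ^+ 3) - (U ^+ 3 - X) by rewrite rmorphXn; ring.
    by apply: (vgeB HQ) => //; apply: (vge1_subX HQ).
  have -> : tau + iota (e * (e + 1)) = (tau + U * (U + 1)) - (U - iota e) * (U + iota e + 1).
    by rewrite rmorphM rmorphD rmorph1; ring.
  apply: (vgeB HQ) => //; apply: (vgeMr HQ) => //.
  by apply: (vgeD HQ); [apply: (vgeD HQ)|exact: (vge1 HQ)].
have gUc k : vge Q 0 (U - iota k) by apply: (vgeB HQ).
case/orP: (vge_prime HQ (gUc c') key) => [h|/(vge_primeX HQ (gUc c)) h].
  exact: (fin2 c').
exact: (fin2 c).
Qed.

End Elsewhere.

Section AtPoint.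
Variables (zeta : K) (v : L -> int).
Hypothesis Hz : 3.-primitive_root zeta.
Hypothesis Hv : is_place iota v.
Hypothesis vxa : vge v 1 (x - iota a).
Hypothesis vyb : vge v 1 (y - iota b).
Let z := iota zeta.

Lemma zeta_rel : zeta ^+ 2 + zeta + 1 = 0.
Proof.
have z1 : zeta != 1.
  apply: contraTneq isT => z1; have := prim_order_dvd Hz 1.
  by rewrite expr1 z1 eqxx.
apply/eqP; have : (zeta - 1) * (zeta ^+ 2 + zeta + 1) == 0.
  have -> : (zeta - 1) * (zeta ^+ 2 + zeta + 1) = zeta ^+ 3 - 1 by ring.
  by rewrite (prim_expr_order Hz) subrr.
by rewrite mulf_eq0 subr_eq0 (negPf z1).
Qed.

Lemma zeta_roots (e : K) : (e == zeta) || (e == zeta ^+ 2) = (e ^+ 2 + e + 1 == 0).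
Proof.
rewrite -[e == zeta]subr_eq0 -[e == _ ^+ 2]subr_eq0 -mulf_eq0; congr (_ == 0).
have -> : (e - zeta) * (e - zeta ^+ 2) =
  e ^+ 2 - (zeta ^+ 2 + zeta + 1) * e + e + zeta ^+ 3 by ring.
by rewrite zeta_rel (prim_expr_order Hz) mul0r subr0.
Qed.

Let zr : z ^+ 2 = - z - 1.
Proof.
apply/eqP; rewrite -subr_eq0; have -> : z ^+ 2 - (- z - 1) = iota (zeta ^+ 2 + zeta + 1).
  by rewrite !rmorphD rmorphXn rmorph1; ring.
by rewrite zeta_rel rmorph0.
Qed.

Let gC (k : K) := vgeC Hv k.
Let gz : vge v 0 z. Proof. exact: gC. Qed.
Let gx : vge v 0 x. Proof. exact: (at_x0 Hv vxa). Qed.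
Let gy : vge v 0 y. Proof. exact: (at_y0 Hv vyb). Qed.
Let gX : vge v 0 X. Proof. by apply: (vgeMl Hv). Qed.
Let gt : vge v 0 tau. Proof. by apply: (vgeMl Hv). Qed.

Let Xres : vge v 1 (X - iota (c ^+ 3)).
Proof.
rewrite c3 exprSr rmorphM -mulrBr.
by apply: (vgeMl Hv).
Qed.

Let tres : vge v 1 (tau + iota (c * (c + 1))).
Proof.
have -> : tau + iota (c * (c + 1)) = iota (b ^+ q) * (y - iota b).
  by rewrite mulrBr -rmorphM -exprSr bq1 rmorphN opprK.
exact: (vgeMl Hv).
Qed.

Let vX : vis v 0 X.
Proof. by apply: (vis_cong Hv _ Xres); rewrite expf_neq0. Qed.

Let gtX : vge v 0 (tau / X).
Proof. by apply: (vgeMr Hv) => //; have := vis_ge (visV Hv vX); rewrite oppr0. Qed.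

(** Newton iteration with the derivative frozen at 3c^2, gaining one order per step. *)
Lemma cube_root_approx n : exists2 U, vge v n.+1%:Z (U ^+ 3 - X) & vge v 1 (U - iota c).
Proof.
elim: n => [|n [U hU hc]].
  exists (iota c); last by rewrite subrr vge0.
  by rewrite -rmorphXn (vge_sym Hv).
have gU := vge1_sub0 Hv hc (gC c).
pose d := (U ^+ 3 - X) * iota (3%:R * c ^+ 2)^-1.
have hd : vge v n.+1%:Z d by apply: (vgeMr Hv).
have hd0 : vge v 0 d by apply: vge_le hd.
have ic0 : iota (3%:R * c ^+ 2) != 0.
  by rewrite fmorph_eq0 mulf_neq0 ?(three_neq0 Hq idK) // expf_neq0.
exists (U - d); last first.
  have -> : U - d - iota c = (U - iota c) - d by ring.
  by apply: (vgeB Hv) => //; apply: vge_le hd.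
have eX : X = U ^+ 3 - d * iota (3%:R * c ^+ 2).
  by rewrite /d fmorphV divfK //; ring.
have -> : (U - d) ^+ 3 - X =
    - (3%:R * (d * ((U - iota c) * (U + iota c)))) + d * d * (3%:R * U - d).
  by rewrite {1}eX rmorphM rmorph_nat rmorphXn; ring.
have g3 : vge v 0 3%:R by exact: (vge_nat Hv).
have eN : n.+2%:Z = n.+1%:Z + 1 by rewrite -PoszD addn1.
apply: (vgeD Hv).
  rewrite (vgeN Hv); apply: (vgeMl Hv) => //; rewrite eN; apply: (vgeM Hv) => //.
  by apply: (vgeMr Hv) => //; apply: (vgeD Hv).
rewrite eN; apply: (vgeMr Hv).
  by apply: (vgeM Hv) => //; apply: vge_le hd.
by apply: (vgeB Hv) => //; apply: (vgeMl Hv).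
Qed.

Let vge_subX n f g k : vge v 0 f -> vge v 0 g -> vge v n (f - g) ->
  vge v n (f ^+ k - g ^+ k).
Proof.
move=> hf hg h; rewrite subrXX; apply: (vgeMr Hv) => //; apply: (vge_sum Hv) => i _.
by apply: (vgeMl Hv); apply: (vgeX0 Hv).
Qed.

Let r := res2 zeta c.
Let s := res3 zeta c.

Let zeta3 : zeta ^+ 3 = 1. Proof. exact: prim_expr_order Hz. Qed.

Let res_add : r + s = 3%:R.
Proof.
have -> : r + s = 2%:R * zeta ^+ 3 - zeta ^+ 2 - zeta ^+ 3 * zeta by rewrite /r /s /res2 /res3; ring.
have -> : 3%:R = 2%:R + 1 :> K by rewrite natr1.
by rewrite zeta3 mul1r mulr1 -(subr0 (_ + 1)) -zeta_rel; ring.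
Qed.

Lemma zeta_neq : zeta != zeta ^+ 2.
Proof.
by rewrite -[X in X != _]expr1 (eq_prim_root_expr Hz).
Qed.

Lemma zeta_q : zeta ^+ q = zeta ^+ 2.
Proof.
by case: Hq => _ _ q3 _ _; rewrite -(expr_mod q zeta3) q3.
Qed.

Lemma zeta2_q : (zeta ^+ 2) ^+ q = zeta.
Proof. by rewrite exprAC zeta_q -exprM (exprD zeta 3 1) zeta3 mul1r. Qed.

Let dz0 : zeta - zeta ^+ 2 != 0. Proof. by rewrite subr_eq0 zeta_neq. Qed.

Let res2_eq0 : (r == 0) = (c == zeta).
Proof. by rewrite mulf_eq0 (negPf dz0) subr_eq0. Qed.

Let res3_eq0 : (s == 0) = (c == zeta ^+ 2).
Proof. by rewrite mulf_eq0 -oppr_eq0 opprB (negPf dz0) subr_eq0. Qed.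

(** As q = 2 modulo 3, the q-th power exchanges zeta and zeta^2. *)
Lemma c_rational : c = c' -> (c != zeta) && (c != zeta ^+ 2).
Proof.
move=> e; apply/andP; split; apply/eqP => h; move: e zeta_neq; rewrite /c' h.
  by rewrite zeta_q => <-; rewrite eqxx.
by rewrite zeta2_q => ->; rewrite eqxx.
Qed.

(** c and c' have the same cube and the same value of e(e+1). If they differ, then c + c' = -1 and
    c^2 + cc' + c'^2 = 0, and eliminating c' leaves c^2 + c + 1 = 0. *)
Lemma c_irrational : c != c' -> (c == zeta) || (c == zeta ^+ 2).
Proof.
move=> e; have e0 : c - c' != 0 by rewrite subr_eq0.
have h1 : c + c' + 1 = 0.
  apply: (mulfI e0); rewrite mulr0.
  have -> : (c - c') * (c + c' + 1) = c * (c + 1) - c' * (c' + 1) by ring.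
  by rewrite cc' subrr.
have h2 : c ^+ 2 + c * c' + c' ^+ 2 = 0.
  apply: (mulfI e0); rewrite mulr0.
  have -> : (c - c') * (c ^+ 2 + c * c' + c' ^+ 2) = c ^+ 3 - c' ^+ 3 by ring.
  by rewrite c3 c'3 subrr.
rewrite zeta_roots.
have -> : c ^+ 2 + c + 1 = (c ^+ 2 + c * c' + c' ^+ 2) - (c + c' + 1) * (c' - 1) by ring.
by rewrite h1 h2 mul0r subr0.
Qed.

Section Approx.
Variable U : L.
Hypothesis hU3 : vge v q.+2%:Z (U ^+ 3 - X).
Hypothesis hUc : vge v 1 (U - iota c).
(** Chosen so that U V = tau up to the error of U^3 = X. *)
Let V := tau / X * U ^+ 2.
Let T1 := U + V + 1.
Let T2 := z * U + z ^+ 2 * V + 1.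
Let T3 := z ^+ 2 * U + z * V + 1.

Let gU : vge v 0 U. Proof. exact: (vge1_sub0 Hv hUc (gC c)). Qed.
Let gV : vge v 0 V. Proof. by apply: (vgeMl Hv) => //; apply: (vgeX0 Hv). Qed.
Let vU : vis v 0 U. Proof. exact: (vis_cong Hv c0 hUc). Qed.
Let gT1 : vge v 0 T1.
Proof. by apply: (vgeD Hv); [apply: (vgeD Hv)|exact: (vge1 Hv)]. Qed.

Let hUV : vge v q.+2%:Z (U * V - tau).
Proof.
have -> : U * V - tau = tau / X * (U ^+ 3 - X) by rewrite /V; field.
exact: (vgeMl Hv).
Qed.

Let hV3 : vge v q.+2%:Z (V ^+ 3 - Y).
Proof.
have -> : V ^+ 3 - Y = (tau / X) ^+ 3 * ((U ^+ 3 - X) * (U ^+ 3 + X)).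
  by rewrite /V /Y; field.
apply: (vgeMl Hv); first exact: (vgeX0 Hv).
by apply: (vgeMr Hv) => //; apply: (vgeD Hv) => //; apply: (vgeX0 Hv).
Qed.

Let zz2 : z * z ^+ 2 = 1.
Proof. by rewrite -exprS -rmorphXn (prim_expr_order Hz) rmorph1. Qed.
Let zpz2 : z + z ^+ 2 = -1. Proof. by rewrite zr; ring. Qed.

Let T23 : T2 * T3 = U ^+ 2 + V ^+ 2 - U * V - U - V + 1.
Proof.
have -> : T2 * T3 = (z * z ^+ 2) * (U ^+ 2 + V ^+ 2)
   + ((z + z ^+ 2) ^+ 2 - 2%:R * (z * z ^+ 2)) * (U * V) + (z + z ^+ 2) * (U + V) + 1.
  by rewrite /T2 /T3; ring.
by rewrite zz2 zpz2; ring.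
Qed.

Let hT : vge v q.+2%:Z (T1 * T2 * T3 - T).
Proof.
have -> : T1 * T2 * T3 - T = (U ^+ 3 - X) + (V ^+ 3 - Y) - 3%:R * (U * V - tau).
  by rewrite -mulrA T23 /T1 /T; ring.
apply: (vgeB Hv); first exact: (vgeD Hv).
by apply: (vgeMl Hv) => //; apply: (vge_nat Hv).
Qed.

Let Vres : vge v 1 (V + iota (c + 1)).
Proof.
apply: (vgeM0K Hv vU).
have -> : U * (V + iota (c + 1)) = (U * V - tau) + (tau + iota (c * (c + 1))) + (U - iota c) * iota (c + 1).
  by rewrite rmorphM; ring.
apply: (vgeD Hv); last exact: (vgeMr Hv).
by apply: (vgeD Hv) => //; apply: vge_le hUV.
Qed.

Let T1res : vge v 1 T1.
Proof.
have -> : T1 = (U - iota c) + (V + iota (c + 1)) by rewrite /T1 rmorphD rmorph1; ring.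
exact: (vgeD Hv).
Qed.

(** U^3 - c^3 agrees with X - c^3 = a^q (x - a) up to order q + 2, and x - a is a local parameter as
    b is nonzero. *)
Let vUc : vis v 1 (U - iota c).
Proof.
have e : (U - iota c) * (U ^+ 2 + U * iota c + iota c ^+ 2) =
    iota (a ^+ q) * (x - iota a) + (U ^+ 3 - X).
  have -> : iota (a ^+ q) * (x - iota a) = X - iota c ^+ 3.
    by rewrite mulrBr -rmorphM -exprSr -c3 (rmorphXn iota 3).
  by ring.
have v1 : vis v 1 (iota (a ^+ q) * (x - iota a) + (U ^+ 3 - X)).
  apply: (visD Hv); last by apply: vge_le hU3.
  rewrite -[1]add0r; apply: (visM Hv); first by rewrite (visC Hv) // expf_neq0.
  exact: (at_unif_x Hq Hxy hab a0 Hv vxa vyb b0).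
have v2 : vis v 0 (U ^+ 2 + U * iota c + iota c ^+ 2).
  have c30 : 3%:R * c ^+ 2 != 0 by rewrite mulf_neq0 ?(three_neq0 Hq idK) // expf_neq0.
  apply: (vis_cong Hv c30).
  have -> : U ^+ 2 + U * iota c + iota c ^+ 2 - iota (3%:R * c ^+ 2) =
     (U - iota c) * (U + 2%:R * iota c).
    by rewrite rmorphM rmorph_nat rmorphXn; ring.
  apply: (vgeMr Hv) => //; apply: (vgeD Hv) => //; apply: (vgeMl Hv) => //.
  exact: (vge_nat Hv).
have := visF Hv v1 v2; rewrite -e subr0 mulfK //.
exact: vis_neq0 v2.
Qed.

(** With V = T1 - 1 - U, additivity of the q-th power gives V^(q+1) = T1 W + (1 + U)(1 + U^q). *)
Let W := T1 ^+ q - (1 + U ^+ q) - (1 + U) * T1 ^+ q.-1.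

Let q_pred : q = q.-1.+1. Proof. by have := q_gt4 Hq; case: (q). Qed.

(** Replacing X^m by U^(q+1) and tau by UV turns [curveT] into c' V^(q+1) = (c'+1)(U^(q+1) + c'),
    that is, c' T1 W = (U - c')(U - c)^q. As W is a unit, T1 has order q+1 or q according as c = c'
    or not. *)
Let key : vge v q.+2%:Z (iota c' * T1 * W - (U - iota c') * (U - iota c) ^+ q).
Proof.
have Tq : T1 ^+ q = T1 * T1 ^+ q.-1 by rewrite -exprS -q_pred.
have Vq : V ^+ q = T1 ^+ q - 1 - U ^+ q.
  have -> : V = T1 - 1 - U by rewrite /T1; ring.
  by rewrite !(exprBq Hq iota) expr1n.
have vUq : vis v 0 (U ^+ q.+1) by have := visX Hv q.+1 vU; rewrite mul0rn.
apply: (vgeM0K Hv vUq).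
have -> : U ^+ q.+1 * (iota c' * T1 * W - (U - iota c') * (U - iota c) ^+ q) =
    iota c' * ((U * V) ^+ q.+1 - tau ^+ q.+1)
    - (iota c' + 1) * ((U ^+ q.+1 - X ^+ m) * (U ^+ q.+1 + X ^+ m + iota c')).
  rewrite [iota c' * (_ - _)]mulrBr curveT exprMn (exprBq Hq iota) -rmorphXn -/c'.
  have VE : V = T1 - 1 - U by rewrite /T1; ring.
  rewrite !(exprS _ q) Vq VE /W Tq; ring.
have hXm : vge v q.+2%:Z (U ^+ q.+1 - X ^+ m).
  have -> : U ^+ q.+1 = (U ^+ 3) ^+ m by rewrite -exprM -(q1E Hq).
  by apply: vge_subX => //; apply: (vgeX0 Hv).
apply: (vgeB Hv).
  by apply: (vgeMl Hv) => //; apply: vge_subX => //; apply: (vgeMl Hv).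
apply: (vgeMl Hv); first by apply: (vgeD Hv) => //; exact: (vge1 Hv).
apply: (vgeMr Hv) => //; apply: (vgeD Hv) => //.
by apply: (vgeD Hv); apply: (vgeX0 Hv).
Qed.

Let vW : vis v 0 W.
Proof.
have nz : - (1 + c') != 0 by rewrite oppr_eq0 addrC.
apply: (vis_cong Hv nz).
have -> : W - iota (- (1 + c')) = T1 ^+ q - (U ^+ q - iota c ^+ q) - (1 + U) * T1 ^+ q.-1.
  by rewrite /W rmorphN rmorphD rmorph1 -rmorphXn -/c'; ring.
have gT1X k : (0 < k)%N -> vge v 1 (T1 ^+ k).
  by case: k => // k _; rewrite exprS; apply: (vgeMr Hv) => //; apply: (vgeX0 Hv).
have [q1 q2] : (0 < q)%N /\ (0 < q.-1)%N by have := q_gt4 Hq; clear; lia.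
apply: (vgeB Hv).
  by apply: (vgeB Hv); [exact: gT1X|exact: vge_subX].
by apply: (vgeMl Hv); [apply: (vgeD Hv (vge1 Hv))|exact: gT1X].
Qed.

Let vicW : vis v 0 (iota c' * W).
Proof. by rewrite -[0]addr0; apply: (visM Hv) => //; apply: (visC Hv). Qed.

Let vT1_gen e : vis v e (U - iota c') -> q%:Z + e < q.+2%:Z -> vis v (q%:Z + e) T1.
Proof.
move=> ve lt.
have vr : vis v (q%:Z + e) ((U - iota c') * (U - iota c) ^+ q).
  rewrite addrC; apply: (visM Hv) => //.
  by have := visX Hv q vUc; rewrite -mulr_natr mul1r natz.
have vl : vis v (q%:Z + e) (iota c' * T1 * W).
  have -> : iota c' * T1 * W = (U - iota c') * (U - iota c) ^+ q +
    (iota c' * T1 * W - (U - iota c') * (U - iota c) ^+ q) by rewrite [RHS]addrC subrK.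
  by apply: (visD Hv vr); apply: vge_le key; rewrite lezD1.
have := visF Hv vl vicW; rewrite subr0.
have -> : iota c' * T1 * W = T1 * (iota c' * W) by ring.
by rewrite mulfK ?(vis_neq0 vicW).
Qed.

Let vT1_eq : c = c' -> vis v q.+1%:Z T1.
Proof.
move=> e; have := @vT1_gen 1; rewrite -e => /(_ vUc).
by rewrite -!PoszD addn1; apply; rewrite ltz_nat.
Qed.

Let vT1_neq : c != c' -> vis v q%:Z T1.
Proof.
move=> e; have := @vT1_gen 0; rewrite addr0; apply; last by rewrite ltz_nat.
have e0 : c - c' != 0 by rewrite subr_eq0.
apply: (vis_cong Hv e0).
by have -> : U - iota c' - iota (c - c') = U - iota c by rewrite rmorphB; ring.
Qed.

Lemma vge_T1 : vge v q%:Z T1.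
Proof.
have [e|e] := eqVneq c c'; last exact: vis_ge (vT1_neq e).
by apply: vge_le (vis_ge (vT1_eq e)); rewrite lez_nat.
Qed.

Let T2E : T2 = iota r + (z - z ^+ 2) * (U - iota c) + z ^+ 2 * T1.
Proof.
have z3 : z ^+ 3 = 1 by rewrite -rmorphXn zeta3 rmorph1.
rewrite /r /res2 rmorphM !rmorphB rmorphXn -/z /T2 -[X in _ + X = _]z3 /T1; ring.
Qed.

Let T3E : T3 = iota s + (z ^+ 2 - z) * (U - iota c) + z * T1.
Proof.
have z3 : z ^+ 3 = 1 by rewrite -rmorphXn zeta3 rmorph1.
have e : iota s + (z ^+ 2 - z) * (U - iota c) + z * T1 =
    z ^+ 2 * U + z * V + z - z ^+ 3 * z + z ^+ 3.
  by rewrite /s /res3 rmorphM !rmorphB rmorphXn -/z /T1; ring.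
by rewrite e z3 /T3; ring.
Qed.

Lemma T2res : vge v 1 (T2 - iota r).
Proof.
have -> : T2 - iota r = (z - z ^+ 2) * (U - iota c) + z ^+ 2 * T1 by rewrite T2E; ring.
apply: (vgeD Hv); apply: (vgeMl Hv) => //; last exact: (vgeX0 Hv).
by apply: (vgeB Hv) => //; apply: (vgeX0 Hv).
Qed.

Lemma T3res : vge v 1 (T3 - iota s).
Proof.
have -> : T3 - iota s = (z ^+ 2 - z) * (U - iota c) + z * T1 by rewrite T3E; ring.
apply: (vgeD Hv); apply: (vgeMl Hv) => //.
by apply: (vgeB Hv) => //; apply: (vgeX0 Hv).
Qed.

Let q2 : (1 < q)%N. Proof. by have := q_gt4 Hq; clear; lia. Qed.

(** If c = c', then T1 has order q+1 and T2, T3 are units. Otherwise T1 has order q, and exactly one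
    of r and s is zero, so one of T2 and T3 has order 1. *)
Lemma vis_tangentT : vis v q.+1%:Z T.
Proof.
suff h : vis v q.+1%:Z (T1 * T2 * T3).
  have -> : T = T1 * T2 * T3 - (T1 * T2 * T3 - T) by ring.
  apply: (visD Hv h); rewrite (vgeN Hv); apply: vge_le hT.
  by rewrite -PoszD lez_nat addn1.
have dzL : z - z ^+ 2 != 0 by rewrite -rmorphXn -rmorphB fmorph_eq0.
have vdz : vis v 0 (z - z ^+ 2) by rewrite -rmorphXn -rmorphB; apply: (visC Hv).
have e2 : vge v (1 + 1) T1 by apply: vge_le vge_T1; rewrite lez_nat.
have e1 : q.+1%:Z = q%:Z + 1 + 0 by rewrite addr0 -PoszD addn1.
have [e|e] := eqVneq c c'.
  have /andP[n1 n2] := c_rational e.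
  have v2 : vis v 0 T2 by apply: (vis_cong Hv _ T2res); rewrite res2_eq0.
  have v3 : vis v 0 T3 by apply: (vis_cong Hv _ T3res); rewrite res3_eq0.
  by have := visM Hv (visM Hv (vT1_eq e) v2) v3; rewrite !addr0.
have vT1 := vT1_neq e.
case/orP: (c_irrational e) => h.
  have r0 : r = 0 by apply/eqP; rewrite res2_eq0.
  have s0 : s != 0.
    apply: contra_eq_neq res_add => ->; rewrite r0 addr0 eq_sym.
    exact: (three_neq0 Hq idK).
  have v3 : vis v 0 T3 by apply: (vis_cong Hv s0 T3res).
  have v2 : vis v 1 T2.
    rewrite T2E r0 rmorph0 add0r; apply: (visD Hv).
      by rewrite -[1]add0r; apply: (visM Hv).
    by apply: (vgeMl Hv) => //; apply: (vgeX0 Hv).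
  by rewrite e1; apply: (visM Hv) => //; apply: (visM Hv).
have s0 : s = 0 by apply/eqP; rewrite res3_eq0.
have r0 : r != 0.
  apply: contra_eq_neq res_add => ->; rewrite s0 addr0 eq_sym.
  exact: (three_neq0 Hq idK).
have v2 : vis v 0 T2 by apply: (vis_cong Hv r0 T2res).
have v3 : vis v 1 T3.
  rewrite T3E s0 rmorph0 add0r; apply: (visD Hv); last exact: (vgeMl Hv).
  by rewrite -[1]add0r; apply: (visM Hv) => //; rewrite -(visN Hv) opprB.
rewrite mulrAC e1; apply: (visM Hv) => //; exact: (visM Hv).
Qed.

Let D := iota s * T2 - iota r * T3.

(** The constants cancel, and the coefficient of U - c is (z - z^2)(r + s) with r + s = 3. *)
Lemma vis_D : vis v 1 D.
Proof.
have -> : D = (z - z ^+ 2) * (U - iota c) * iota (r + s) + (iota s * z ^+ 2 - iota r * z) * T1.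
  by rewrite /D T2E T3E rmorphD; ring.
have e2 : vge v (1 + 1) T1 by apply: vge_le vge_T1; rewrite lez_nat.
apply: (visD Hv).
  rewrite -[1]addr0; apply: (visM Hv).
    rewrite -[1]add0r; apply: (visM Hv) => //.
    by rewrite -rmorphXn -rmorphB; apply: (visC Hv).
  by rewrite res_add; apply: (visC Hv); apply: (three_neq0 Hq idK).
apply: (vgeMl Hv) => //; apply: (vgeB Hv); apply: (vgeMl Hv) => //.
exact: (vgeX0 Hv).
Qed.

End Approx.

Lemma tangentT_tangent : tangent q iota x v T.
Proof.
have [U hU hUc] := cube_root_approx q.+1.
have vx : v x = 0 := vis_v (at_x_unit a0 Hv vxa).
split; [by rewrite vx|exact: (vis_tangentT hU hUc)|].
move=> Q HQ Qv; split=> h; last exact: tangentT_infty.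
have [Qx|Qx] := eqVneq (Q x) 0; last by apply: tangentT_zero => //; rewrite lt_neqAle eq_sym Qx.
have hx : vge Q 0 x by rewrite vgeE.
have hy : vge Q 0 y by rewrite vgeE // (vy_ge0 Hq Hxy HQ).
have hX : vis Q 0 X.
  by rewrite -[0]addr0; apply: (visM HQ); [rewrite (visC HQ) // expf_neq0|rewrite /vis x0 Qx eqxx].
have ht : vge Q 0 tau by apply: (vgeMl HQ) => //; apply: (vgeC HQ).
have hY : vge Q 0 Y.
  apply: (vgeMr HQ); first exact: (vgeX0 HQ).
  by have := vis_ge (visV HQ hX); rewrite oppr0.
apply: visP.
  apply: (vgeB HQ); last by apply: (vgeMl HQ) => //; apply: (vge_nat HQ).
  by apply: (vgeD HQ); [apply: (vgeD HQ) => //; apply: vis_ge|exact: (vge1 HQ)].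
apply/negP => hT; have [h1 h2] := tangentT_affine HQ Qx hT.
by apply: Qv; apply: (rat_place_uniq Hq Hxy hab a0 HQ Hv).
Qed.

(** The conjugate tangent lines as polynomials in a formal cube root of X; multiplying the root by z
    permutes them cyclically. *)
Let linP (i : nat) : {poly L} :=
  1 *: 'X^0 + (z ^+ i *: 'X^1 + (z ^+ i ^+ 2 * (tau / X)) *: 'X^2).

Let linP_horner i U : (linP i).[U] = 1 + (z ^+ i * U + z ^+ i ^+ 2 * (tau / X * U ^+ 2)).
Proof. by rewrite !hornerD !hornerZ !hornerXn expr1 expr0; ring. Qed.

Let linP_gauss Q w e i : is_place iota Q -> e <= 0 -> e <= w ->
  vge Q (e - w * 2) (tau / X) -> gauss_ge Q w e (linP i).
Proof.
move=> HQ e0 ew h; have hz k : vge Q 0 (z ^+ k) by rewrite -rmorphXn (vgeC HQ).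
apply: (gauss_geD HQ); last apply: (gauss_geD HQ); apply: gauss_ge_monom.
- by apply: vge_le (vge1 HQ); rewrite mulr0 subr0.
- by apply: vge_le (hz i); rewrite mulr1 subr_le0.
- by apply: (vgeMl HQ) => //; rewrite -exprM.
Qed.

Let formP (n : nat) (l1 l2 : K) : {poly L} :=
  (iota s *: linP 1 - iota r *: linP 2) ^+ n * (iota l1 *: linP 1 + iota l2 *: linP 2).

Let formP_gauss Q w e n l1 l2 : is_place iota Q -> e <= 0 -> e <= w ->
  vge Q (e - w * 2) (tau / X) -> gauss_ge Q w (e * n.+1%:Z) (formP n l1 l2).
Proof.
move=> HQ e0 ew h; have hl i := linP_gauss i HQ e0 ew h.
have hC k : vge Q 0 (iota k) := vgeC HQ k.
have -> : e * n.+1%:Z = e * n%:Z + e by rewrite -addn1 PoszD mulrDr mulr1.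
apply: (gauss_geM HQ); first apply: (gauss_geX HQ).
  apply: (gauss_geD HQ); first exact: (gauss_geZ HQ).
  by rewrite -scaleNr; apply: (gauss_geZ HQ) => //; rewrite (vgeN HQ).
by apply: (gauss_geD HQ); apply: (gauss_geZ HQ).
Qed.

(** The subtracted term is what the two other conjugates of the form add up to modulo t1, once s^n
    l1 = (-r)^n l2. *)
Let formF n l1 l2 : L := cube_trace X (formP n l1 l2)
  - iota (s ^+ n * l1) * cube_trace X (linP 0 ^+ n.+1).

(** A linear form has Gauss valuation at least e: take e = 0 where x has no pole, and at a pole the
    weight Q(x)/3 = Q(x) - Q(y) of the cube root. The forms have degree 3k, giving k Q(x). *)
Let formF_LD n k l1 l2 : n.+1 = (3 * k)%N -> LD iota x k (formF n l1 l2).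
Proof.
move=> nk Q HQ.
have QX : Q X = Q x by rewrite (vM HQ) ?fmorph_eq0 ?expf_neq0 // (vC HQ) add0r.
have Qt : Q tau = Q y by rewrite (vM HQ) ?fmorph_eq0 ?expf_neq0 // (vC HQ) add0r.
have gen w e : Q x = 3 * w -> e <= 0 -> e <= w -> e - w * 2 <= Q y - Q x ->
    vge Q (e * n.+1%:Z) (formF n l1 l2).
  move=> hw e0 ew h; have h' : vge Q (e - w * 2) (tau / X).
    by rewrite vgeE ?tX0 // (vF HQ) // QX Qt.
  have hQX : Q X = 3 * w by rewrite QX.
  apply: (vgeB HQ); first exact: (vge_cube_trace HQ X0 hQX (formP_gauss n l1 l2 HQ e0 ew h')).
  apply: (vgeMl HQ); first exact: (vgeC HQ).
  exact: (vge_cube_trace HQ X0 hQX (gauss_geX HQ _ (linP_gauss 0 HQ e0 ew h'))).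
split=> h.
  rewrite -(mul0r n.+1%:Z); have := vy_ge0 Hq Hxy HQ h.
  have [Qx|Qx] := eqVneq (Q x) 0.
    by move=> hy; apply: (gen 0); rewrite ?Qx ?mulr0 ?mul0r ?subr0.
  have hx : 0 < Q x by rewrite lt_neqAle eq_sym Qx.
  have := vy_pos Hq Hxy HQ hx => hxy hy; apply: (gen (Q y)) => //.
    by rewrite hxy mulrC.
  by rewrite hxy; clear; lia.
have hy := vy_neg Hq Hxy HQ h.
have -> : Q x * k%:Z = (Q x - Q y) * n.+1%:Z.
  by rewrite nk PoszM mulrA; congr (_ * _); move: hy; clear; lia.
by apply: gen => //; move: h hy; clear; lia.
Qed.

(** Modulo t1 the conjugates of the form are D^n (l1 t2 + l2 t3), s^n l1 t3^(n+1) and (-r)^n l2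
    t2^(n+1), with D = s t2 - r t3. The last two cancel against the conjugates t3^(n+1) and t2^(n+1)
    of t1^(n+1). The precision is q because t1 has order at least q. *)
Let formF_approx n l1 l2 : s ^+ n * l1 = (- r) ^+ n * l2 -> exists t1 t2 t3,
  [/\ vge v q%:Z t1, vge v 1 (t2 - iota r), vge v 1 (t3 - iota s),
      vis v 1 (iota s * t2 - iota r * t3) &
   vge v q%:Z (3%:R * formF n l1 l2 -
     (iota s * t2 - iota r * t3) ^+ n * (iota l1 * t2 + iota l2 * t3))].
Proof.
move=> hk; have [U hU hUc] := cube_root_approx q.+1.
have gU : vge v 0 U := vge1_sub0 Hv hUc (gC c).
pose V := tau / X * U ^+ 2.
have gV : vge v 0 V by apply: (vgeMl Hv) => //; apply: (vgeX0 Hv).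
pose t1 := U + V + 1; pose t2 := z * U + z ^+ 2 * V + 1; pose t3 := z ^+ 2 * U + z * V + 1.
exists t1, t2, t3; have ht1 : vge v q%:Z t1 := vge_T1 hU hUc.
split=> //; [exact: (T2res hU hUc)|exact: (T3res hU hUc)|exact: (vis_D hU hUc)|].
have g2 : vge v 0 t2.
  by apply: (vgeD Hv _ (vge1 Hv)); apply: (vgeD Hv); apply: (vgeMl Hv) => //; apply: (vgeX0 Hv).
have g3 : vge v 0 t3.
  by apply: (vgeD Hv _ (vge1 Hv)); apply: (vgeD Hv); apply: (vgeMl Hv) => //; apply: (vgeX0 Hv).
have g1 : vge v 0 t1 by apply: (vgeD Hv _ (vge1 Hv)); apply: (vgeD Hv).
have z3 : z ^+ 3 = 1 by rewrite -rmorphXn zeta3 rmorph1.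
have z4 : z ^+ 4 = z by rewrite exprS z3 mulr1.
have h2 : gauss_ge v 0 0 (linP 0) /\ gauss_ge v 0 (0 * n.+1%:Z) (formP n l1 l2).
  by split; [apply: linP_gauss|apply: formP_gauss]; rewrite // mul0r subr0.
have [hl hf] := h2.
have cl i : vge v 0 (linP 0 ^+ n.+1)`_i.
  by have := gauss_geX Hv n.+1 hl i; rewrite !mul0r subr0.
have cf i : vge v 0 (formP n l1 l2)`_i by have := hf i; rewrite !mul0r subr0.
have a1 := cube_trace_approx Hv cf gX gU zr hU.
have a2 := cube_trace_approx Hv cl gX gU zr hU.
have lE i u : (linP i).[u * U] = 1 + (z ^+ i * u * U + (z ^+ i * u) ^+ 2 * V).
  by rewrite linP_horner /V; ring.
have e00 : (linP 0).[U] = t1 by rewrite linP_horner /t1 /V expr0; ring.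
have e01 : (linP 0).[z * U] = t2 by rewrite lE /t2 expr0 mul1r; ring.
have e02 : (linP 0).[z ^+ 2 * U] = t3 by rewrite lE /t3 expr0 mul1r -exprM z4; ring.
have e10 : (linP 1).[U] = t2 by rewrite linP_horner /t2 /V expr1; ring.
have e11 : (linP 1).[z * U] = t3.
  by rewrite lE /t3 expr1 -expr2 -exprM z4; ring.
have e12 : (linP 1).[z ^+ 2 * U] = t1.
  by rewrite lE /t1 expr1 -exprS z3 expr1n; ring.
have e20 : (linP 2).[U] = t3 by rewrite linP_horner /t3 /V -exprM z4; ring.
have e21 : (linP 2).[z * U] = t1.
  by rewrite lE /t1 -exprSr z3 expr1n; ring.
have e22 : (linP 2).[z ^+ 2 * U] = t2.
  by rewrite lE /t2 -exprD z4; ring.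
have fE u w1 w2 : (linP 1).[u] = w1 -> (linP 2).[u] = w2 ->
    (formP n l1 l2).[u] = (iota s * w1 - iota r * w2) ^+ n * (iota l1 * w1 + iota l2 * w2).
  rewrite /formP; move: (linP 1) (linP 2) => p1 p2 <- <-.
  by rewrite hornerM horner_exp !hornerD hornerN !hornerZ.
rewrite (fE _ _ _ e10 e20) (fE _ _ _ e11 e21) (fE _ _ _ e12 e22) in a1.
rewrite !horner_exp e00 e01 e02 in a2.
have gs : vge v 0 (iota s) by exact: gC.
have d2 : vge v q%:Z ((iota s * t3 - iota r * t1) ^+ n * (iota l1 * t3 + iota l2 * t1)
    - iota (s ^+ n * l1) * t3 ^+ n.+1).
  have -> : iota (s ^+ n * l1) * t3 ^+ n.+1 = (iota s * t3) ^+ n * (iota l1 * t3).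
    by rewrite rmorphM rmorphXn exprMn exprS; ring.
  rewrite (_ : _ - _ = ((iota s * t3 - iota r * t1) ^+ n - (iota s * t3) ^+ n) * (iota l1 * t3 + iota l2 * t1)
     + (iota s * t3) ^+ n * (iota l2 * t1)); last by ring.
  apply: (vgeD Hv).
    apply: (vgeMr Hv); last by apply: (vgeD Hv); apply: (vgeMl Hv).
    apply: vge_subX; [by apply: (vgeB Hv); apply: (vgeMl Hv)|exact: (vgeMl Hv)|].
    by rewrite addrC addKr (vgeN Hv); apply: (vgeMl Hv).
  by apply: (vgeMl Hv); [apply: (vgeX0 Hv); apply: (vgeMl Hv)|apply: (vgeMl Hv)].
have d3 : vge v q%:Z ((iota s * t1 - iota r * t2) ^+ n * (iota l1 * t1 + iota l2 * t2)
    - iota (s ^+ n * l1) * t2 ^+ n.+1).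
  have -> : iota (s ^+ n * l1) * t2 ^+ n.+1 = (- (iota r * t2)) ^+ n * (iota l2 * t2).
    by rewrite hk rmorphM rmorphXn rmorphN -mulNr exprMn exprS; ring.
  rewrite (_ : _ - _ = ((iota s * t1 - iota r * t2) ^+ n - (- (iota r * t2)) ^+ n) * (iota l1 * t1 + iota l2 * t2)
     + (- (iota r * t2)) ^+ n * (iota l1 * t1)); last by ring.
  apply: (vgeD Hv).
    apply: (vgeMr Hv); last by apply: (vgeD Hv); apply: (vgeMl Hv).
    apply: vge_subX; [by apply: (vgeB Hv); apply: (vgeMl Hv)|by rewrite (vgeN Hv); apply: (vgeMl Hv)|].
    by rewrite opprK subrK; apply: (vgeMl Hv).
  apply: (vgeMl Hv); last exact: (vgeMl Hv).
  by apply: (vgeX0 Hv); rewrite (vgeN Hv); apply: (vgeMl Hv).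
have d1 : vge v q%:Z (iota (s ^+ n * l1) * t1 ^+ n.+1).
  by apply: (vgeMl Hv) => //; rewrite exprS; apply: (vgeMr Hv) => //; apply: (vgeX0 Hv).
have le2 : q%:Z <= q.+2%:Z by rewrite lez_nat ltnW.
have {}a1 := vge_le le2 a1; have {}a2 := vgeMl Hv (gC (s ^+ n * l1)) (vge_le le2 a2).
have := vgeB Hv (vgeB Hv (vgeD Hv a2 (vgeD Hv d2 d3)) d1) a1.
by congr (vge v _ _); rewrite /formF; ring.
Qed.

Lemma LD_order k l1 l2 : (0 < k < m)%N ->
  s ^+ (3 * k).-1 * l1 = (- r) ^+ (3 * k).-1 * l2 ->
  [/\ l1 * r + l2 * s != 0 -> exists2 F, LD iota x k F & vis v (3 * k - 1)%N%:Z F &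
      l1 = s -> l2 = - r -> exists2 F, LD iota x k F & vis v (3 * k)%N%:Z F].
Proof.
move=> /andP[k0 km] hk; have [n nk] : exists n, (3 * k)%N = n.+1.
  by exists (3 * k).-1; rewrite prednK // muln_gt0.
rewrite nk /= in hk *; rewrite subn1 /=.
(* 3k <= 3m - 3 = q - 2, so the orders 3k-1 and 3k are visible modulo order q. *)
have nq : (n.+1 < q)%N by have := q1E Hq; move: nk km k0; clear; lia.
have [t1 [t2 [t3 [h1 h2 h3 hD hF]]]] := formF_approx hk.
have v3 : vis v 0 (3%:R : L) by rewrite -(rmorph_nat iota); apply: (visC Hv); apply: (three_neq0 Hq idK).
have fin (e : nat) : (e < q)%N ->
    vis v e%:Z ((iota s * t2 - iota r * t3) ^+ n * (iota l1 * t2 + iota l2 * t3)) ->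
    exists2 F, LD iota x k F & vis v e%:Z F.
  move=> eq hv; exists (formF n l1 l2); first exact: formF_LD.
  have : vis v e%:Z (3%:R * formF n l1 l2).
    rewrite -[X in vis _ _ X](subrK ((iota s * t2 - iota r * t3) ^+ n * (iota l1 * t2 + iota l2 * t3))).
    by rewrite addrC; apply: (visD Hv hv); apply: vge_le hF; rewrite -PoszD addn1 lez_nat.
  move=> h; have := visF Hv h v3; rewrite subr0 mulrC mulKf //.
  exact: vis_neq0 v3.
split=> [h|e1 e2].
  apply: (fin n); first exact: ltnW.
  rewrite -[n%:Z]addr0; apply: (visM Hv).
    by have := visX Hv n hD; rewrite -mulr_natr mul1r natz.
  apply: (vis_cong Hv h).
  have -> : iota l1 * t2 + iota l2 * t3 - iota (l1 * r + l2 * s) =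
     iota l1 * (t2 - iota r) + iota l2 * (t3 - iota s) by rewrite rmorphD !rmorphM; ring.
  by apply: (vgeD Hv); apply: (vgeMl Hv).
apply: (fin n.+1) => //; rewrite e1 e2 rmorphN mulNr -exprSr.
by have := visX Hv n.+1 hD; rewrite -mulr_natr mul1r natz.
Qed.

(** With l1 = (-r)^(3k-1) and l2 = s^(3k-1) the linear factor has value s^(3k) - (-r)^(3k) at P. *)
Lemma LD_nonflex k : (0 < k < m)%N -> s ^+ (3 * k) != (- r) ^+ (3 * k) ->
  exists2 F, LD iota x k F & vis v (3 * k - 1)%N%:Z F.
Proof.
move=> hk ne; have [|h _] := @LD_order k ((- r) ^+ (3 * k).-1) (s ^+ (3 * k).-1) hk.
  by rewrite mulrC.
apply: h; have [n nk] : exists n, (3 * k)%N = n.+1.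
  by exists (3 * k).-1; rewrite prednK // muln_gt0; case/andP: hk.
rewrite nk /= in ne *; apply: contra ne => /eqP e.
rewrite eq_sym -subr_eq0 !exprSr; have -> : (- r) ^+ n * - r - s ^+ n * s = - ((- r) ^+ n * r + s ^+ n * s) by ring.
by rewrite e oppr0.
Qed.

(** With l1 = s and l2 = -r the form is the pure power D^(3k), and the cancellation condition is the
    hypothesis itself. *)
Lemma LD_flex k : (0 < k < m)%N -> s ^+ (3 * k) = (- r) ^+ (3 * k) ->
  exists2 F, LD iota x k F & vis v (3 * k)%N%:Z F.
Proof.
move=> hk e; have [|_ h] := @LD_order k s (- r) hk; last exact: h.
by rewrite -!exprSr prednK // muln_gt0; case/andP: hk.
Qed.

Lemma LD_order1 : exists2 F, LD iota x 1 F & vis v 1 F.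
Proof.
exists (x - iota a); last exact: (at_unif_x Hq Hxy hab a0 Hv vxa vyb b0).
move=> Q HQ; split=> h; apply: (vgeB HQ).
- by rewrite vgeE.
- exact: (vgeC HQ).
- by rewrite mulr1 vgeE.
- by apply: vge_le (vgeC HQ _); rewrite mulr1 ltW.
Qed.

End AtPoint.
End PointNotO.

(** * Generators of the three families of semigroups *)

Section Semigroups.
Variables (q : nat) (K : fieldType).
Hypothesis Hq : admissible q K.
Local Notation m := (mq q).
Local Open Scope nat_scope.

Lemma gen_semigroupD S a b : gen_semigroup S a -> gen_semigroup S b ->
  gen_semigroup S (a + b).
Proof.
move=> ha; elim: b / => [|n s hn IH hs]; first by rewrite addn0.
by rewrite addnA; apply: gen_add.
Qed.

Lemma gen_semigroup_gen (S : nat -> Prop) a : S a -> gen_semigroup S a.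
Proof. by move=> h; rewrite -[a]add0n; apply: gen_add => //; apply: gen_zero. Qed.

Let q1 := q1E Hq.
Let m1 := m_gt1 Hq.
Let q4 := q_gt4 Hq.

Definition semigroup_gens (d n : nat) : Prop :=
  [\/ n = q, n = q.+1,
      exists2 k, 0 < k < d & k < m /\ n = k * q.+1 - (3 * k - 1) |
      d < m /\ n = d * q.+1 - 3 * d].

Lemma semigroup_gens_nongap d n : d %| m -> semigroup_gens d n -> nongap q m d n.
Proof.
move=> dm; have d0 : 0 < d by apply: dvdn_gt0 dm; lia.
have ok k o : 0 < k -> o <= q -> order_ok q m d k o -> nongap q m d (k * q.+1 - o).
  by move=> k0 oq h; rewrite (nongap_level q1).
case=> [->|->|[k /andP[k0 kd] [km ->]]|[dlm ->]].
- have := @ok 1 1; rewrite mul1n subn1; apply=> //; first by apply: leq_trans q4.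
  by rewrite /order_ok m1.
- have := @ok 1 0; rewrite mul1n subn0; apply=> //.
  by rewrite /order_ok m1.
- apply: ok => //; first by lia.
  rewrite /order_ok km eqxx /=; apply/orP; right; apply/orP; left.
  by apply: contraL kd => /dvdn_leq; rewrite -leqNgt; apply.
apply: ok => //; first by lia.
by rewrite /order_ok dlm eqxx dvdnn !orbT.
Qed.

Lemma nongap_gen d (S : nat -> Prop) n : d %| m ->
  (forall k, semigroup_gens d k -> S k) -> nongap q m d n -> gen_semigroup S n.
Proof.
move=> dm h; apply: (nongap_generated q1 m1 dm).
- exact: gen_zero.
- by move=> a b; apply: gen_semigroupD.
- by apply/gen_semigroup_gen/h; constructor 1.
- by apply/gen_semigroup_gen/h; constructor 2.
- by move=> k kd km; apply/gen_semigroup_gen/h; constructor 3; exists k.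
- by move=> dlm; apply/gen_semigroup_gen/h; constructor 4.
Qed.

Lemma nongap_semigroup d (S H : nat -> Prop) : d %| m ->
  H 0 -> (forall a b, H a -> H b -> H (a + b)) ->
  (forall n, H n <-> nongap q m d n) ->
  (forall k, S k <-> semigroup_gens d k) -> forall n, H n <-> gen_semigroup S n.
Proof.
move=> dm H0 HD HN hS n; split=> [/HN h|].
  by apply: (@nongap_gen d) => // k /hS.
elim=> [//|a b _ Ha /hS /(semigroup_gens_nongap dm) /HN]; exact: HD.
Qed.

Lemma gens_H1 n : (n = q - 2 \/ n = q \/ n = q.+1) <-> semigroup_gens 1 n.
Proof.
split=> [[->|[->|->]]|].
- by constructor 4; split=> //; lia.
- by constructor 1.
- by constructor 2.
by case=> [->|->|[k]|[_ ->]]; [right; left|right; right|lia|left; lia].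
Qed.

(** The generators are those of levels k = j+1 and d = i+1: k(q+1) - (3k-1) = (q-1) + j(q-2), and
    d(q+1) - 3d = (i+1)(q-2). *)
Lemma gens_H2 i n : 1 <= i <= m - 2 ->
  (n = q \/ n = q.+1 \/
     (exists j, j < i /\ n = q - 1 + j * (q - 2)) \/
     n = q - 1 + i * (q - 2) - 1) <-> semigroup_gens i.+1 n.
Proof.
move=> /andP[i1 im]; split=> [[->|[->|[[j [ji ->]]|->]]]|].
- by constructor 1.
- by constructor 2.
- by constructor 3; exists j.+1; [|split; [lia|nia]].
- by constructor 4; split; [lia|nia].
case=> [->|->|[[//|j] /andP[_ ji] [jm ->]]|[_ ->]].
- by left.
- by right; left.
- by right; right; left; exists j; split; [|nia].
- by right; right; right; nia.
Qed.

Lemma gens_H3 n : (n = q \/ n = q.+1 \/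
     exists j, j <= m - 2 /\ n = q - 1 + j * (q - 2)) <-> semigroup_gens m n.
Proof.
split=> [[->|[->|[j [ji ->]]]]|].
- by constructor 1.
- by constructor 2.
- by constructor 3; exists j.+1; [lia|split; [lia|nia]].
case=> [->|->|[[//|j] /andP[_ ji] [jm ->]]|[]].
- by left.
- by right; left.
- by right; right; exists j; split; [lia|nia].
- by rewrite ltnn.
Qed.

End Semigroups.

(** * The P-order and the classification of points *)

Section POrder.
Variables (q : nat) (K : fieldType) (zeta : K).
Hypothesis Hq : admissible q K.
Hypothesis Hz : 3.-primitive_root zeta.
Local Notation m := (mq q).
Local Notation idK := (idfun : {rmorphism K -> K}).

(** The cube of -r/s, so that s^(3k) = (-r)^(3k) says that its k-th power is 1. *)
Definition flex_ratio (c : K) : K := ((c - zeta) / (c - zeta ^+ 2)) ^+ 3.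

Let z3 : zeta ^+ 3 = 1. Proof. exact: prim_expr_order Hz. Qed.
Let zrel := zeta_rel Hz.
Let zne : zeta != zeta ^+ 2.
Proof. by rewrite -[X in X != _]expr1 (eq_prim_root_expr Hz). Qed.
Let dz0 : zeta - zeta ^+ 2 != 0. Proof. by rewrite subr_eq0. Qed.
Let z20 : zeta ^+ 2 = - zeta - 1.
Proof. by apply/eqP; rewrite -subr_eq0 -zrel; apply/eqP; ring. Qed.

Variable c : K.
Hypothesis c0 : c != 0.
Hypothesis c1 : 1 + c != 0.
Local Notation al := (c / (1 + c)).

Let alz : (al + zeta) * (1 + c) = - zeta ^+ 2 * (c - zeta ^+ 2).
Proof.
have -> : - zeta ^+ 2 * (c - zeta ^+ 2) = - zeta ^+ 2 * c + zeta ^+ 3 * zeta by ring.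
by rewrite z3 z20; field.
Qed.

Let alz2 : (al + zeta ^+ 2) * (1 + c) = - zeta * (c - zeta).
Proof.
have -> : - zeta * (c - zeta) = - zeta * c + zeta ^+ 2 by ring.
by rewrite z20; field.
Qed.

(** The difference equals 3(zeta - zeta^2) c (1 + c). Hence the flex ratio is never 1 and its order
    is at least 2. *)
Lemma cube_diff : (c - zeta ^+ 2) ^+ 3 != (c - zeta) ^+ 3.
Proof.
rewrite -subr_eq0.
have -> : (c - zeta ^+ 2) ^+ 3 - (c - zeta) ^+ 3 = (zeta - zeta ^+ 2) *
  ((c - zeta ^+ 2) ^+ 2 + (c - zeta ^+ 2) * (c - zeta) + (c - zeta) ^+ 2) by ring.
have -> : (c - zeta ^+ 2) ^+ 2 + (c - zeta ^+ 2) * (c - zeta) + (c - zeta) ^+ 2 =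
   3%:R * (c * (1 + c)) - 3%:R * c * (zeta ^+ 2 + zeta + 1) + (zeta ^+ 2 + zeta ^+ 3 + zeta ^+ 3 * zeta) by ring.
rewrite zrel mulr0 subr0 z3 mul1r.
have -> : zeta ^+ 2 + 1 + zeta = 0 by rewrite -zrel; ring.
by rewrite addr0 !mulf_neq0 ?(three_neq0 Hq idK).
Qed.

Lemma al_neq : (al != 0) && (al != 1).
Proof.
rewrite mulf_neq0 ?invr_eq0 //=; apply/eqP => h.
have : al * (1 + c) = 1 + c by rewrite h mul1r.
by rewrite divfK // => /eqP; rewrite -subr_eq0 opprD addrCA subrr addr0 oppr_eq0 oner_eq0.
Qed.

Lemma al_zeta : (al == - zeta) = (c == zeta ^+ 2).
Proof.
rewrite -addr_eq0 -[c == _]subr_eq0 -[LHS](mulIr_eq0 _ (mulIf c1)) alz mulf_eq0.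
rewrite oppr_eq0 expf_eq0 /=; have -> : (zeta == 0) = false.
  by rewrite (prim_root_eq0 Hz).
by [].
Qed.

Lemma al_zeta2 : (al == - zeta ^+ 2) = (c == zeta).
Proof.
rewrite -addr_eq0 -[c == _]subr_eq0 -[LHS](mulIr_eq0 _ (mulIf c1)) alz2 mulf_eq0.
rewrite oppr_eq0 /=; have -> : (zeta == 0) = false.
  by rewrite (prim_root_eq0 Hz).
by [].
Qed.

(** The substitution alpha = c/(1+c) carries alpha + zeta and alpha + zeta^2 to -zeta^2 (c - zeta^2)
    and -zeta (c - zeta), up to the common factor 1 + c; the extra units have equal (3i)-th
    powers. *)
Lemma Pval_eq0 i :
  (Pval zeta i al == 0) = ((c - zeta ^+ 2) ^+ (3 * i) == (c - zeta) ^+ (3 * i)).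
Proof.
have /andP[al0 al1] := al_neq.
rewrite /Pval mulf_eq0 invr_eq0 !mulf_eq0 (negPf (three_neq0 Hq idK)) (negPf dz0).
rewrite (negPf c0) invr_eq0 (negPf c1) [al - 1 == 0]subr_eq0 (negPf al1) !orbF subr_eq0.
have e1 : (1 + c) ^+ (3 * i) != 0 by rewrite expf_neq0.
have eA : (- zeta ^+ 2) ^+ (3 * i) = (-1) ^+ i.
  rewrite exprM; have -> : (- zeta ^+ 2) ^+ 3 = - (zeta ^+ 3) ^+ 2 by ring.
  by rewrite z3 expr1n.
have eB : (- zeta) ^+ (3 * i) = (-1) ^+ i.
  rewrite exprM; have -> : (- zeta) ^+ 3 = - zeta ^+ 3 by ring.
  by rewrite z3.
rewrite -(inj_eq (mulIf e1)) -!exprMn alz alz2.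
rewrite (exprMn (3 * i) (- zeta ^+ 2)) (exprMn (3 * i) (- zeta)) eA eB.
by apply: inj_eq; apply: mulfI; rewrite expf_neq0 // oppr_eq0 oner_eq0.
Qed.

Lemma flex_ratioX i : c != zeta ^+ 2 ->
  ((c - zeta ^+ 2) ^+ (3 * i) == (c - zeta) ^+ (3 * i)) = (flex_ratio c ^+ i == 1).
Proof.
move=> h; have h' : (c - zeta ^+ 2) ^+ (3 * i) != 0 by rewrite expf_neq0 // subr_eq0.
by rewrite /flex_ratio -exprM expr_div_n -subr_eq0 -oppr_eq0 opprB subr_eq0 -(inj_eq (mulIf (invr_neq0 h'))) divff.
Qed.

Lemma has_PorderE i : (0 < i)%N ->
  has_Porder zeta al i <->
  [/\ c != zeta, c != zeta ^+ 2 & i.+1.-primitive_root (flex_ratio c)].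
Proof.
move=> i0; have /andP[al0 al1] := al_neq; split.
  move=> [[_ _ h1 h2] [_ h3 h4]].
  have hc2 : c != zeta ^+ 2 by rewrite -al_zeta.
  have hc : c != zeta by rewrite -al_zeta2.
  split=> //; have := h3 => /eqP; rewrite Pval_eq0 flex_ratioX // => /eqP w1.
  have [e pe ei] := prim_order_exists (ltn0Sn i) w1.
  suff -> : i.+1 = e by [].
  have e0 := prim_order_gt0 pe.
  (* The P-order tests only the exponents i+1 >= 2, so exponent 1 has to be excluded separately. *)
  have e1 : e != 1%N.
    apply: contra_neqN cube_diff => e1; move/eqP: (prim_expr_order pe).
    by rewrite (eqP e1) -flex_ratioX // => /eqP.
  have le := dvdn_leq (ltn0Sn i) ei; apply/eqP; rewrite eqn_leq le andbT.
  rewrite leqNgt; apply/negP => lt.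
  have := h4 e.-1; rewrite prednK // Pval_eq0 flex_ratioX // (prim_expr_order pe) eqxx.
  have -> : ((0 < e.-1) && (e <= i))%N by move: e0 e1 lt; clear; lia.
  by move=> /(_ isT).
move=> [hc hc2 hp]; split; first by rewrite al0 al1 al_zeta al_zeta2.
split=> //; first by apply/eqP; rewrite Pval_eq0 flex_ratioX // (prim_expr_order hp).
move=> k /andP[k0 ki]; rewrite Pval_eq0 flex_ratioX // -(prim_order_dvd hp).
by apply/negP => /dvdn_leq; move=> /(_ isT); rewrite ltnS leqNgt ki.
Qed.

Lemma al_quadratic : (al ^+ 2 - al + 1 == 0) = (c == zeta) || (c == zeta ^+ 2).
Proof.
have e2 : (1 + c) ^+ 2 != 0 by rewrite expf_neq0.
rewrite -(mulIr_eq0 _ (mulIf e2)) (zeta_roots Hz); congr (_ == 0); field.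
exact: c1.
Qed.

End POrder.

(** * The points of O, reduced to O_m by rotation *)

Section PointsOfO.
Variables (q : nat) (K L : fieldType) (iota : {rmorphism K -> L}).
Hypothesis Hq : admissible q K.
Local Notation m := (mq q).

Definition rotxy (p : L * L) : L * L := (p.2 ^+ 3 / p.1 ^+ 2, p.2 / p.1).

Definition at_Om (p : L * L) (a : K) (P : L -> int) : Prop :=
  [/\ a ^+ m = -1, vge P 1 (p.1 - iota a) & vge P 1 p.2].

Lemma model_iter_rot t p : model iota q p.1 p.2 ->
  model iota q (iter t rotxy p).1 (iter t rotxy p).2.
Proof. by move=> h; elim: t => [//|t IH]; apply: model_rot. Qed.

Lemma at_Om_x p a P : is_place iota P -> at_Om p a P -> P p.1 = 0.
Proof.
move=> HP [am h _]; apply: vis_v.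
exact: (vis_cong HP (a_neq0_m Hq am) h).
Qed.

Lemma Om_point p P : model iota q p.1 p.2 -> rational_place iota P ->
  P p.1 = 0 -> vge P 1 p.2 -> exists a, at_Om p a P.
Proof.
move=> Hp rP Px Py; have [HP _] := rP.
have [a [b [a0 hab ha hb]]] := rational_coords Hq Hp rP Px.
have b0 : b = 0.
  by apply: (residue_uniq HP hb); rewrite rmorph0 subr0.
exists a; split=> //; apply/eqP; rewrite -addr_eq0.
by move/eqP: hab; rewrite b0 expr0n add0r mulf_eq0 expf_eq0 (negPf a0) andbF.
Qed.

Lemma rot_neg p P : model iota q p.1 p.2 -> is_place iota P -> P p.1 < 0 ->
  P (rotxy p).1 = 0 /\ 0 < P (rotxy p).2.
Proof.
move=> Hp HP h; have x0 := x_neq0 Hp; have y0 := y_neq0 Hq Hp.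
have := vy_neg Hq Hp HP h; rewrite !(vF HP) ?expf_neq0 // !(vXz HP).
by move: h; clear; lia.
Qed.

Lemma rot_pos p P : model iota q p.1 p.2 -> is_place iota P -> 0 < P p.1 ->
  P (rotxy p).1 < 0.
Proof.
move=> Hp HP h; have x0 := x_neq0 Hp; have y0 := y_neq0 Hq Hp.
have := vy_pos Hq Hp HP h; rewrite !(vF HP) ?expf_neq0 // !(vXz HP).
by move: h; clear; lia.
Qed.

Lemma at_Om1 p a P : model iota q p.1 p.2 -> is_place iota P -> at_Om (rotxy p) a P ->
  P p.1 < 0.
Proof.
move=> Hp HP h; have x0 := x_neq0 Hp; have y0 := y_neq0 Hq Hp.
have := at_Om_x HP h; have [_ _] := h.
rewrite vgeE ?mulf_neq0 ?invr_eq0 // !(vF HP) ?expf_neq0 // !(vXz HP).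
by clear; lia.
Qed.

Lemma at_Om2 p a P : model iota q p.1 p.2 -> is_place iota P ->
  at_Om (rotxy (rotxy p)) a P -> 0 < P p.1.
Proof.
move=> Hp HP /(at_Om1 (model_iter_rot 1 Hp) HP) h.
have x0 := x_neq0 Hp; have y0 := y_neq0 Hq Hp.
rewrite ltNge; apply/negP => le; move: h.
have [e|ne] := eqVneq (P p.1) 0.
  have := vy_ge0 Hq Hp HP; rewrite e => /(_ (lexx 0)).
  by rewrite /= !(vF HP) ?expf_neq0 // !(vXz HP) e; clear; lia.
have lt : P p.1 < 0 by rewrite lt_neqAle ne.
by have [/= -> _] := rot_neg Hp HP lt; rewrite ltxx.
Qed.

(** Poles of x become points of O_m after one rotation, zeros of x after two. *)
Lemma in_OP x y P : model iota q x y -> rational_place iota P ->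
  in_O iota q x y P <-> exists (t : 'I_3) a, at_Om (iter t rotxy (x, y)) a P.
Proof.
move=> Hxy rP; have [HP _] := rP; have y0 := y_neq0 Hq Hxy.
have Hp : model iota q (x, y).1 (x, y).2 by [].
split=> [[h|[h|[a [[Px [_ /residueE hb]] am]]]]|[[t t3] [a h]]].
- have h1 := rot_pos Hp HP h; have H1 := model_iter_rot 1 Hp.
  have [h2 h3] := rot_neg H1 HP h1.
  have [|a ha] := Om_point (model_iter_rot 2 Hp) rP h2.
    by rewrite vgeE -?gtz0_ge1 // (y_neq0 Hq (model_iter_rot 2 Hp)).
  by exists (inord 2), a; rewrite inordK.
- have [h2 h3] := rot_neg Hp HP h.
  have [|a ha] := Om_point (model_iter_rot 1 Hp) rP h2.
    by rewrite vgeE -?gtz0_ge1 // (y_neq0 Hq (model_iter_rot 1 Hp)).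
  by exists (inord 1), a; rewrite inordK.
- have [|a' ha] := Om_point Hp rP Px; first by move: hb; rewrite rmorph0 subr0.
  by exists ord0, a'.
move: h => /=; case: t t3 => [|[|[|//]]] _ /= h.
- right; right; exists a; have [am ha hy] := h.
  split; last by rewrite am addNr.
  split; first exact: at_Om_x HP h.
  by split; apply/residueE; rewrite ?rmorph0 ?subr0.
- by right; left; apply: at_Om1 Hp HP h.
- by left; apply: at_Om2 Hp HP h.
Qed.

Lemma at_Om_place p a : model iota q p.1 p.2 -> a ^+ m = -1 ->
  exists P, rational_place iota P /\ at_Om p a P.
Proof.
move=> Hp am; have [P [rP ha Px Py _]] := place_Om Hq Hp am.
exists P; split=> //; split=> //.
by rewrite vgeE ?Py // (y_neq0 Hq Hp).
Qed.

Lemma at_Om_uniq p a P P' : model iota q p.1 p.2 ->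
  is_place iota P -> is_place iota P' -> at_Om p a P -> at_Om p a P' -> P = P'.
Proof.
move=> Hp HP HP' [am h1 h2] [_ h3 h4].
have hab : 0 ^+ q.+1 + a ^+ m * (a ^+ m + 1) = 0 :> K.
  by rewrite am addNr mulr0 expr0n addr0.
by apply: (rat_place_uniq Hq Hp hab (a_neq0_m Hq am)); rewrite // rmorph0 subr0.
Qed.

Lemma at_Om_inj x y (t t' : 'I_3) a a' P : model iota q x y -> is_place iota P ->
  at_Om (iter t rotxy (x, y)) a P -> at_Om (iter t' rotxy (x, y)) a' P -> t = t' /\ a = a'.
Proof.
move=> Hxy HP h h'; have Hp : model iota q (x, y).1 (x, y).2 by [].
have s0 b : at_Om (x, y) b P -> P x = 0 := @at_Om_x _ _ _ HP.
have s1 b : at_Om (rotxy (x, y)) b P -> P x < 0 := @at_Om1 _ _ _ Hp HP.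
have s2 b : at_Om (rotxy (rotxy (x, y))) b P -> 0 < P x := @at_Om2 _ _ _ Hp HP.
have tt' : t = t'.
  apply/val_inj; move: h h'; case: t t' => [[|[|[|//]]] ?] [[|[|[|//]]] ?] //=.
  - by move=> /s0 e /s1; rewrite e ltxx.
  - by move=> /s0 e /s2; rewrite e ltxx.
  - by move=> /s1 e /s0 e'; rewrite e' ltxx in e.
  - by move=> /s1 e /s2 /(lt_trans e); rewrite ltxx.
  - by move=> /s2 e /s0 e'; rewrite e' ltxx in e.
  - by move=> /s2 e /s1 /(lt_trans e); rewrite ltxx.
split=> //; rewrite -tt' in h'.
have [_ ha _] := h; have [_ ha' _] := h'.
exact: (residue_uniq HP ha ha').
Qed.

Lemma weierstrass_O x y P : model iota q x y -> periodic_closure q K ->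
  rational_place iota P -> in_O iota q x y P ->
  forall n, weierstrass iota P n <-> nongap q m 1 n.
Proof.
move=> Hxy Hcl rP /(in_OP Hxy rP) [t [a [am h1 h2]]] n.
by apply: (nongap_Om Hq (model_iter_rot t (p := (x, y)) Hxy) Hcl rP.1 am).
Qed.

End PointsOfO.

(** * The points outside O, sorted by the order of the flex ratio *)

Section PointsNotO.
Variables (q : nat) (K L : fieldType) (iota : {rmorphism K -> L}) (x y : L) (zeta : K).
Hypothesis Hq : admissible q K.
Hypothesis Hxy : model iota q x y.
Hypothesis Hcl : periodic_closure q K.
Hypothesis Hz : 3.-primitive_root zeta.
Local Notation m := (mq q).
Local Notation idK := (idfun : {rmorphism K -> K}).

Definition at_point (a b : K) (P : L -> int) : Prop :=
  vge P 1 (x - iota a) /\ vge P 1 (y - iota b).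

Definition on_curve (a b : K) : Prop :=
  [/\ a != 0, b != 0 & b ^+ q.+1 + a ^+ m * (a ^+ m + 1) = 0].

Lemma point_notO P : rational_place iota P -> ~ in_O iota q x y P ->
  exists a b, on_curve a b /\ at_point a b P.
Proof.
move=> rP nO; have Px : P x = 0.
  apply/eqP; apply/negPn/negP; rewrite neq_lt => /orP[h|h]; apply: nO.
    by right; left.
  by left.
have [a [b [a0 hab ha hb]]] := rational_coords Hq Hxy rP Px.
exists a, b; split=> //; split=> //; apply/eqP => b0; apply: nO; right; right.
exists a; split; first by split=> //; split; apply/residueE; rewrite // -b0.
by apply/eqP; move/eqP: hab; rewrite b0 expr0n add0r mulf_eq0 expf_eq0 (negPf a0) andbF.
Qed.

Lemma at_point_notO a b P : is_place iota P -> on_curve a b -> at_point a b P ->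
  ~ in_O iota q x y P /\ coords iota x y P a b.
Proof.
move=> HP [a0 b0 hab] [ha hb]; have Px := vis_v (at_x_unit a0 HP ha).
split; last by split=> //; split; apply/residueE.
move=> [h|[h|[a' [[_ [_ /residueE hb']] _]]]]; try by rewrite Px ltxx in h.
by have e := residue_uniq HP hb hb'; rewrite e eqxx in b0.
Qed.

Lemma alpha_isP a b P al : is_place iota P -> on_curve a b -> at_point a b P ->
  alpha_is iota q x y P al <-> al = a ^+ m / (1 + a ^+ m).
Proof.
move=> HP hc hp; have [nO co] := at_point_notO HP hc hp; split.
  move=> [_ [a' [b' [[_ [/residueE ha' _]] ->]]]].
  by rewrite (residue_uniq HP ha' hp.1).
by move=> ->; split=> //; exists a, b.
Qed.

Lemma on_curve_c a b : on_curve a b -> (a ^+ m != 0) && (1 + a ^+ m != 0).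
Proof.
move=> [a0 b0 hab]; rewrite expf_neq0 //=; apply: contra_neq b0 => e.
by move/eqP: hab; rewrite addrC [_ + 1]addrC e mulr0 add0r expf_eq0 /= => /eqP.
Qed.

Lemma c_conj a b : on_curve a b -> (a ^+ m) ^+ q = a ^+ m \/
  (a ^+ m == zeta) || (a ^+ m == zeta ^+ 2).
Proof.
move=> [a0 b0 hab]; have [e|e] := eqVneq (a ^+ m) ((a ^+ m) ^+ q); first by left.
by right; exact: (c_irrational Hq hab Hz).
Qed.

(** If c^q = c, the q-th power exchanges c - zeta and c - zeta^2. Their quotient has (q+1)-st power
    1, and since q+1 = 3m its cube has order dividing m. *)
Lemma c_class a b : on_curve a b -> let c := a ^+ m in
  (c == zeta) || (c == zeta ^+ 2) \/
  exists d, [/\ (1 < d)%N, (d %| m)%N &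
    [/\ c != zeta, c != zeta ^+ 2 & d.-primitive_root (flex_ratio zeta c)]].
Proof.
move=> hc c; have [a0 b0 hab] := hc; have /andP[c0 c1] := on_curve_c hc.
have [cq|] := c_conj hc; last by left.
right; have /andP[n1 n2] := c_rational Hq Hz (esym cq).
have u0 : c - zeta != 0 by rewrite subr_eq0.
have u0' : c - zeta ^+ 2 != 0 by rewrite subr_eq0.
have m0 : (0 < m)%N by apply: ltnW (m_gt1 Hq).
have fm : flex_ratio zeta c ^+ m = 1.
  rewrite /flex_ratio -exprM -(q1E Hq) exprSr expr_div_n !(exprBq Hq idK) cq.
  by rewrite (zeta_q Hq Hz) (zeta2_q Hq Hz); rewrite -/c mulf_div mulrC [(c - zeta) * _]mulrC mulVf ?mulf_neq0.
have [d pd dm] := prim_order_exists m0 fm; exists d; split=> //.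
have := prim_order_gt0 pd; rewrite leq_eqVlt => /orP[/eqP d1|//].
move: (cube_diff Hq Hz c0 c1); rewrite -[3%N]muln1 flex_ratioX //.
by rewrite d1 (prim_expr_order pd) eqxx.
Qed.

Lemma weierstrass_notO a b P d : is_place iota P -> on_curve a b -> at_point a b P ->
  let c := a ^+ m in (d %| m)%N ->
  (forall k, (0 < k < d)%N -> (c - zeta ^+ 2) ^+ (3 * k) != (c - zeta) ^+ (3 * k)) ->
  ((d < m)%N -> (c - zeta ^+ 2) ^+ (3 * d) = (c - zeta) ^+ (3 * d)) ->
  forall n, weierstrass iota P n <-> nongap q m d n.
Proof.
move=> HP [a0 b0 hab] [ha hb] c dm h1 h2.
have dz : zeta ^+ 2 - zeta != 0 by rewrite subr_eq0 eq_sym (zeta_neq Hz).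
have rs k : (res3 zeta c ^+ (3 * k) == (- res2 zeta c) ^+ (3 * k)) =
    ((c - zeta ^+ 2) ^+ (3 * k) == (c - zeta) ^+ (3 * k)).
  have -> : - res2 zeta c = (zeta ^+ 2 - zeta) * (c - zeta) by rewrite /res2; ring.
  rewrite /res3 !(exprMn (3 * k)); apply: inj_eq; apply: mulfI.
  by rewrite expf_neq0.
have d0 : (0 < d)%N by apply: dvdn_gt0 dm; apply: ltnW (m_gt1 Hq).
apply: (weierstrass_nongap Hq Hxy Hcl HP (tangentT_tangent Hq Hxy hab a0 b0 Hz HP ha hb) dm).
- exact: (LD_order1 Hq Hxy hab a0 b0 HP ha hb).
- move=> k /andP[k0 kd] km; apply: (LD_nonflex Hq Hxy hab a0 b0 Hz HP ha hb).
    by rewrite k0.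
  by rewrite rs h1 ?k0.
move=> dlm; apply: (LD_flex Hq Hxy hab a0 b0 Hz HP ha hb); first by rewrite d0.
by apply/eqP; rewrite rs h2.
Qed.

Lemma weierstrass_P a b P d : is_place iota P -> on_curve a b -> at_point a b P ->
  let c := a ^+ m in (d %| m)%N -> c != zeta ^+ 2 ->
  d.-primitive_root (flex_ratio zeta c) ->
  forall n, weierstrass iota P n <-> nongap q m d n.
Proof.
move=> HP hc hp c dm n2 pd; apply: (weierstrass_notO HP hc hp dm).
  move=> k /andP[k0 kd]; rewrite flex_ratioX // -(prim_order_dvd pd).
  by apply/negP => /(dvdn_leq k0); rewrite leqNgt kd.
by move=> _; apply/eqP; rewrite flex_ratioX // (prim_expr_order pd).
Qed.

Lemma weierstrass_R a b P : is_place iota P -> on_curve a b -> at_point a b P ->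
  let c := a ^+ m in (c == zeta) || (c == zeta ^+ 2) ->
  forall n, weierstrass iota P n <-> nongap q m m n.
Proof.
move=> HP hc hp c h; apply: (weierstrass_notO HP hc hp (dvdnn m)); last by rewrite ltnn.
have dz : zeta - zeta ^+ 2 != 0 by rewrite subr_eq0 (zeta_neq Hz).
move=> k /andP[k0 _]; have k3 : (0 < 3 * k)%N by rewrite muln_gt0.
have [e|e] := orP h; rewrite -/c (eqP e) subrr expr0n gtn_eqF //.
  by rewrite expf_neq0.
by rewrite eq_sym expf_neq0 // -opprB oppr_eq0.
Qed.

End PointsNotO.

Lemma has_card_rel (I : finType) (T : Type) (S : {set I}) (A : T -> Prop)
  (R : I -> T -> Prop) :
  (forall i, i \in S -> exists2 P, A P & R i P) ->
  (forall P, A P -> exists2 i, i \in S & R i P) ->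
  (forall i P P', A P -> A P' -> R i P -> R i P' -> P = P') ->
  (forall i i' P, A P -> R i P -> R i' P -> i = i') -> has_card A #|S|.
Proof.
move=> h1 h2 h3 h4.
have /boolp.choice [f hf] : forall k : 'I_#|S|, exists P, A P /\ R (enum_val k) P.
  by move=> k; have [P] := h1 _ (enum_valP k); exists P.
exists f; split=> [k k' e|P].
  apply: enum_val_inj; have [Ak Rk] := hf k; have [_ Rk'] := hf k'.
  by rewrite -e in Rk'; apply: h4 Ak Rk Rk'.
split=> [AP|[k ->]]; last by have [] := hf k.
have [i iS Ri] := h2 P AP; exists (enum_rank_in iS i); have [Ak Rk] := hf (enum_rank_in iS i).
by rewrite enum_rankK_in // in Rk; apply: h3 AP Ak Ri Rk.
Qed.

(** * Counting points *)

Section Counting.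
Variables (q : nat) (K : finFieldType) (zeta : K).
Hypothesis Hq : admissible q K.
Hypothesis Hz : 3.-primitive_root zeta.
Local Notation m := (mq q).
Local Notation idK := (idfun : {rmorphism K -> K}).

(** In the cyclic group of order q^2 - 1 the condition on e says that e is an n-th power; the fibre
    is a coset of the n-th roots of unity. *)
Lemma card_pow_fibre n (e : K) : (n %| q ^ 2 - 1)%N -> e != 0 ->
  e ^+ ((q ^ 2 - 1) %/ n) = 1 -> #|[set a : K | a ^+ n == e]| = n.
Proof.
set N := (q ^ 2 - 1)%N => nN e0 he.
have N0 : (0 < N)%N by have := q_gt4 Hq; rewrite /N; clear; nia.
have n0 : (0 < n)%N by apply: dvdn_gt0 nN.
have [g pg] := prim_root_exists Hq (dvdnn N).
have eN : e ^+ N = 1.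
  by rewrite -(divnK nN) exprM he expr1n.
have [j ej] := prim_rootP pg eN.
have nj : (n %| j)%N.
  have : (N %| j * (N %/ n))%N by rewrite (prim_order_dvd pg) exprM -ej he.
  have Nn0 : (0 < N %/ n)%N by rewrite divn_gt0 // dvdn_leq.
  by rewrite -{1}(divnK nN) mulnC dvdn_pmul2r.
have [z pz] := prim_root_exists Hq nN.
pose a0 := g ^+ (j %/ n).
have a0n : a0 ^+ n = e by rewrite /a0 -exprM divnK.
have a00 : a0 != 0 by apply: contraNneq e0 => h; rewrite -a0n h expr0n gtn_eqF.
have -> : [set a : K | a ^+ n == e] = [set a0 * z ^+ (i : 'I_n) | i : 'I_n].
  apply/setP => a; rewrite in_set; apply/eqP/imsetP => [h|[i _ ->]].
    have : (a / a0) ^+ n = 1 by rewrite expr_div_n h a0n divff.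
    by case/(prim_rootP pz) => i hi; exists i; rewrite // -hi mulrC divfK.
  by rewrite exprMn a0n -exprM mulnC exprM (prim_expr_order pz) expr1n mulr1.
rewrite card_imset ?card_ord // => i i' /(mulfI a00)/eqP.
rewrite (eq_prim_root_expr pz) !modn_small // => /eqP; exact: val_inj.
Qed.

Lemma card_prim_root d : (d %| q ^ 2 - 1)%N ->
  #|[set u : K | d.-primitive_root u]| = totient d.
Proof.
move=> dN; have [z pz] := prim_root_exists Hq dN; have d0 := prim_order_gt0 pz.
have -> : [set u : K | d.-primitive_root u] =
    [set z ^+ (i : 'I_d) | i : 'I_d & coprime d i].
  apply/setP => u; rewrite in_set; apply/idP/imsetP => [pu|[i]].
    have [i ei] := prim_rootP pz (prim_expr_order pu); exists i => //.
    by move: pu; rewrite ei (prim_root_exp_coprime _ pz) in_set coprime_sym.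
  by rewrite in_set => ci ->; rewrite (prim_root_exp_coprime _ pz) coprime_sym.
rewrite card_in_imset => [|i i' _ _ /eqP].
  rewrite totient_count_coprime big_mkord -sum1dep_card [LHS]big_mkcond.
  by apply: eq_bigr => i _; case: (coprime d i).
rewrite (eq_prim_root_expr pz) !modn_small // => /eqP; exact: val_inj.
Qed.

Definition points_over (C : {set K}) : {set K * K} :=
  [set u | (u.1 ^+ m \in C) && (u.2 ^+ q.+1 == - (u.1 ^+ m * (u.1 ^+ m + 1)))].

(* Every [c] in [C] has [m] preimages under [a |-> a ^+ m], and then [b] has
   [q.+1] values. *)
Definition fibred (C : {set K}) : Prop := forall c, c \in C ->
  [/\ c != 0, c + 1 != 0, c ^+ (3 * q.-1) = 1 & (- (c * (c + 1))) ^+ q.-1 = 1].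

Lemma card_points_over C : fibred C -> #|points_over C| = (#|C| * (m * q.+1))%N.
Proof.
move=> hC; have m0 : (0 < m)%N := ltnW (m_gt1 Hq).
rewrite -sum1_card (partition_big (fun u : K * K => u.1 ^+ m) (mem C)) /=; last first.
  by move=> u; rewrite in_set => /andP[].
rewrite -sum_nat_const; apply: eq_bigr => c cC; have [c0 c1 c2 c3] := hC c cC.
rewrite sum1dep_card.
have -> : [set u : K * K | (u \in points_over C) && (u.1 ^+ m == c)] =
    setX [set a : K | a ^+ m == c] [set b : K | b ^+ q.+1 == - (c * (c + 1))].
  apply/setP => [[a b]]; rewrite !in_set /=.
  by have [->|ne] := eqVneq (a ^+ m) c; rewrite ?cC ?andbT //= andbF.
have qN : (q ^ 2 - 1 = q.-1 * q.+1)%N by have := q_gt4 Hq; clear; nia.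
rewrite cardsX !card_pow_fibre ?(m_dvd Hq) ?(q1_dvd Hq) //.
- by rewrite oppr_eq0 mulf_neq0.
- by rewrite qN mulnK.
by rewrite qN (q1E Hq) mulnA mulnK // mulnC.
Qed.

Lemma fibred_Fq (C : {set K}) :
  (forall c, c \in C -> [/\ c != 0, c + 1 != 0 & c ^+ q = c]) -> fibred C.
Proof.
move=> hC c /hC [c0 c1 cq]; have q0 : (0 < q)%N by apply: leq_trans (q_gt4 Hq).
have F (e : K) : e != 0 -> e ^+ q = e -> e ^+ q.-1 = 1.
  by move=> e0 eq; apply: (mulfI e0); rewrite mulr1 -exprS prednK.
split=> //; first by rewrite mulnC exprM F // expr1n.
by rewrite F ?oppr_eq0 ?mulf_neq0 // (exprNq Hq idK) exprMn (exprDq Hq idK) expr1n cq.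
Qed.

Lemma has_card_O (L : fieldType) (iota : {rmorphism K -> L}) (x y : L) :
  model iota q x y ->
  has_card (fun P => rational_place iota P /\ in_O iota q x y P) q.+1.
Proof.
move=> Hxy.
pose S := setX [set: 'I_3] [set a : K | a ^+ m == -1].
have -> : q.+1 = #|S|.
  have qN : (q ^ 2 - 1 = m * (3 * q.-1))%N.
    by have := q1E Hq; have := q_gt4 Hq; clear; nia.
  rewrite cardsX cardsT card_ord card_pow_fibre ?(m_dvd Hq) ?oppr_eq0 ?oner_eq0 //.
    exact: (q1E Hq).
  have m0 : (0 < m)%N := ltnW (m_gt1 Hq).
  rewrite qN mulKn // exprM -signr_odd /= expr1.
  have := sign_q1 Hq idK; rewrite -{1}[q](@prednK q) ?(leq_trans _ (q_gt4 Hq)) //.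
  by rewrite !exprS !mulN1r opprK.
have Hp : model iota q (x, y).1 (x, y).2 by [].
apply: (@has_card_rel _ _ S _ (fun (u : 'I_3 * K) P => at_Om q iota (iter u.1 (@rotxy L) (x, y)) u.2 P)).
- move=> [t a]; rewrite !in_set /= => /eqP am.
  have [P [rP hP]] := at_Om_place Hq (model_iter_rot Hq t Hp) am.
  by exists P => //; split=> //; apply/(in_OP Hq Hxy rP); exists t, a.
- move=> P [rP /(in_OP Hq Hxy rP) [t [a h]]]; exists (t, a) => //.
  by rewrite !in_set /=; have [-> _ _] := h.
- move=> [t a] P P' [[HP _] _] [[HP' _] _].
  exact: (at_Om_uniq Hq (model_iter_rot Hq t Hp) HP HP').
move=> [t a] [t' a'] P [[HP _] _] h h'.
by have /= [-> ->] := at_Om_inj Hq Hxy HP h h'.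
Qed.

Let z3 : zeta ^+ 3 = 1. Proof. exact: prim_expr_order Hz. Qed.
Let zrel := zeta_rel Hz.
Let zne := zeta_neq Hz.

Definition flex_values (d : nat) : {set K} :=
  [set c | [&& c != zeta, c != zeta ^+ 2 & d.-primitive_root (flex_ratio zeta c)]].

(** The (q+1)-st powers of c - zeta and c - zeta^2 agree because d divides m; expanding with zeta^q
    = zeta^2 gives c^q = c. *)
Lemma flex_values_fibred d : (1 < d)%N -> (d %| m)%N -> fibred (flex_values d).
Proof.
move=> d1 dm; apply: fibred_Fq => c; rewrite in_set => /and3P[n1 n2 pd].
have u0 : c - zeta != 0 by rewrite subr_eq0.
have u0' : c - zeta ^+ 2 != 0 by rewrite subr_eq0.
have not1 : flex_ratio zeta c != 1.
  by rewrite -[flex_ratio _ _]expr1 -(prim_order_dvd pd) dvdn1 gtn_eqF.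
have zz : zeta != 0 by rewrite (prim_root_eq0 Hz).
split.
- apply: contra_neq not1 => ->; rewrite /flex_ratio !sub0r invrN mulrNN expr_div_n.
  by rewrite -exprM (exprM zeta 3 2) z3 expr1n divr1.
- apply: contra_neq not1 => /eqP; rewrite addr_eq0 => /eqP ->; rewrite /flex_ratio.
  have -> : -1 - zeta = zeta ^+ 2 by rewrite -[LHS]addr0 -zrel; ring.
  have -> : -1 - zeta ^+ 2 = zeta by rewrite -[LHS]addr0 -zrel; ring.
  by rewrite expr_div_n -exprM (exprM zeta 3 2) z3 expr1n divr1.
have h : (c - zeta) ^+ q.+1 = (c - zeta ^+ 2) ^+ q.+1.
  have := prim_expr_order pd; have /dvdnP[k mE] := dm.
  move/(congr1 (fun w => w ^+ k)); rewrite expr1n -exprM [(d * k)%N]mulnC -mE.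
  rewrite /flex_ratio -exprM -(q1E Hq) expr_div_n => e.
  by rewrite -[LHS](divfK (expf_neq0 q.+1 u0')) e mul1r.
rewrite !(exprSr _ q) !(exprBq Hq idK) (zeta_q Hq Hz) (zeta2_q Hq Hz) in h.
have dz : zeta - zeta ^+ 2 != 0 by rewrite subr_eq0.
apply: (mulfI dz); move/eqP: h; rewrite -subr_eq0 => /eqP h.
apply/eqP; rewrite -subr_eq0 -oppr_eq0 -h; apply/eqP; ring.
Qed.

(** The fractional linear map c -> (c - zeta)/(c - zeta^2) is a bijection onto the w with w^3 of
    order d, and every such cube has 3 cube roots in K, as d divides (q^2 - 1)/3. *)
Lemma card_flex_values d : (1 < d)%N -> (d %| m)%N ->
  #|flex_values d| = (3 * totient d)%N.
Proof.
move=> d1 dm; pose W := [set w : K | d.-primitive_root (w ^+ 3)].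
pose f (w : K) := (zeta - zeta ^+ 2 * w) / (1 - w).
pose g (c : K) := (c - zeta) / (c - zeta ^+ 2).
have dz : zeta - zeta ^+ 2 != 0 by rewrite subr_eq0.
have W1 w : w \in W -> 1 - w != 0.
  rewrite in_set => pw; rewrite subr_eq0 eq_sym; apply: contraTneq pw => ->.
  by apply/negP => p1; have := prim_order_dvd p1 1; rewrite dvdn1 !expr1n eqxx gtn_eqF.
have W0 w : w \in W -> w != 0.
  by rewrite in_set => /prim_root_eq0; rewrite expf_eq0 /= gtn_eqF ?(ltnW d1) // => ->.
have f1 w : w \in W -> f w - zeta = (zeta - zeta ^+ 2) * w / (1 - w).
  by move=> /W1 w1; rewrite /f; field; rewrite w1.
have f2 w : w \in W -> f w - zeta ^+ 2 = (zeta - zeta ^+ 2) / (1 - w).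
  by move=> /W1 w1; rewrite /f; field; rewrite w1.
have gf w : w \in W -> g (f w) = w.
  by move=> hw; rewrite /g f1 // f2 //; have := W1 w hw => w1; field; rewrite w1 dz.
have -> : flex_values d = f @: W.
  apply/setP => c; rewrite in_set; apply/and3P/imsetP => [[n1 n2 pd]|[w hw ->]].
    have u0' : c - zeta ^+ 2 != 0 by rewrite subr_eq0.
    exists (g c); first by rewrite in_set.
    have e : 1 - g c = (zeta - zeta ^+ 2) / (c - zeta ^+ 2) by rewrite /g; field.
    apply: (mulIf (mulf_neq0 dz (invr_neq0 u0'))); rewrite -[in RHS]e /f divfK; last first.
      by rewrite e mulf_neq0 ?invr_eq0.
    by rewrite /g; field.
  have w1 := W1 w hw; split.
  - by rewrite -subr_eq0 f1 // !mulf_neq0 ?invr_eq0 // W0.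
  - by rewrite -subr_eq0 f2 // mulf_neq0 ?invr_eq0.
  by rewrite /flex_ratio -/(g _) gf //; rewrite in_set in hw.
rewrite card_in_imset; last by move=> w w' hw hw' e; rewrite -(gf w hw) e gf.
have qN : (q ^ 2 - 1 = m * q.-1 * 3)%N.
  by have := q1E Hq; have := q_gt4 Hq; clear; nia.
have N3 : (3 %| q ^ 2 - 1)%N by rewrite qN dvdn_mull.
have dN : (d %| q ^ 2 - 1)%N by rewrite qN -mulnA dvdn_mulr.
rewrite -sum1_card (partition_big (fun w => w ^+ 3) (fun u => d.-primitive_root u)) /=; last first.
  by move=> w; rewrite in_set.
rewrite -(card_prim_root dN) mulnC -sum_nat_const.
rewrite [RHS](eq_bigl (fun u : K => d.-primitive_root u)); last by move=> u; rewrite in_set.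
apply: eq_bigr => u pu; rewrite sum1dep_card.
have -> : [set w : K | (w \in W) && (w ^+ 3 == u)] = [set w : K | w ^+ 3 == u].
  by apply/setP => w; rewrite !in_set; case: eqP => [->|]; rewrite ?pu ?andbF.
have u0 : u != 0 by rewrite (prim_root_eq0 pu) -lt0n ltnW.
rewrite (card_pow_fibre N3 u0) // qN mulnK //.
by have /dvdnP[k ->] := dm; rewrite [(k * d)%N]mulnC -mulnA exprM (prim_expr_order pu) expr1n.
Qed.

(** Although zeta is not fixed by the q-th power, zeta^3 = 1 and -zeta (zeta + 1) = 1 settle both
    conditions, likewise for zeta^2. *)
Lemma zetas_fibred : fibred [set zeta; zeta ^+ 2].
Proof.
have z1 : zeta + 1 = - zeta ^+ 2 by rewrite -[LHS]subr0 -zrel; ring.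
have z2 : zeta ^+ 2 + 1 = - zeta by rewrite -[LHS]subr0 -zrel; ring.
have zz : zeta != 0 by rewrite (prim_root_eq0 Hz).
move=> c; rewrite in_set2 => /orP[] /eqP->.
  rewrite z1 oppr_eq0 expf_neq0 // exprM z3 expr1n mulrN opprK -exprS z3 expr1n.
  by split.
rewrite z2 oppr_eq0 expf_neq0 // -exprM mulnC -mulnA exprM z3 expr1n mulrN opprK -exprSr z3 expr1n.
by split.
Qed.

Lemma card_zetas : #|[set zeta; zeta ^+ 2]| = 2%N.
Proof. by rewrite cards2 zne. Qed.

Section Points.
Variables (L : fieldType) (iota : {rmorphism K -> L}) (x y : L).
Hypothesis Hxy : model iota q x y.

Lemma has_card_notO (C : {set K}) (A : (L -> int) -> Prop) : fibred C ->
  (forall P, A P -> rational_place iota P /\ ~ in_O iota q x y P) ->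
  (forall a b P, rational_place iota P -> on_curve q a b -> at_point iota x y a b P ->
     A P <-> a ^+ m \in C) ->
  has_card A (#|C| * (m * q.+1)).
Proof.
move=> hC hA hAC; rewrite -(card_points_over hC).
have key a b : (a, b) \in points_over C -> on_curve q a b.
  rewrite in_set /= => /andP[aC /eqP e]; have [c0 c1 _ _] := hC _ aC.
  have m0 : (0 < m)%N := ltnW (m_gt1 Hq).
  split; last by rewrite e addNr.
    by apply: contraNneq c0 => ->; rewrite expr0n gtn_eqF.
  by apply: contra_eq_neq e => ->; rewrite expr0n eq_sym oppr_eq0 mulf_neq0.
apply: (@has_card_rel _ _ _ _ (fun (u : K * K) P => on_curve q u.1 u.2 /\ at_point iota x y u.1 u.2 P)).
- move=> [a b] ab; have hc := key a b ab; have [a0 b0 hab] := hc.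
  have [P [rP _ h1 h2]] := rat_place_exists Hq Hxy hab a0.
  exists P; last by split.
  by apply/(hAC a b) => //; move: ab; rewrite in_set => /andP[].
- move=> P AP; have [rP nO] := hA P AP; have [a [b [hc hp]]] := point_notO Hq Hxy rP nO.
  exists (a, b) => //; rewrite in_set /= (hAC a b P rP hc hp).1 //.
  by have [_ _ /eqP] := hc; rewrite addr_eq0.
- move=> [a b] P P' /hA[[HP _] _] /hA[[HP' _] _] [[/= a0 b0 hab] [h1 h2]] [_ [h3 h4]].
  exact: (rat_place_uniq Hq Hxy hab a0 HP HP').
move=> [a b] [a' b'] P /hA[[HP _] _] [_ [h1 h2]] [_ [h3 h4]].
by move: (residue_uniq HP h1 h3) (residue_uniq HP h2 h4) => /= -> ->.
Qed.

Lemma has_card_P i : (0 < i)%N -> (i.+1 %| m)%N ->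
  has_card (fun P => rational_place iota P /\
    exists al, alpha_is iota q x y P al /\ has_Porder zeta al i) (q.+1 ^ 2 * totient i.+1).
Proof.
(* 3 phi(i+1) values of c, each with m(q+1) points, and 3m = q+1. *)
move=> i0 im; have -> : (q.+1 ^ 2 * totient i.+1 = #|flex_values i.+1| * (m * q.+1))%N.
  rewrite card_flex_values // {1}(q1E Hq); have := q1E Hq; move: (totient _) (m) (q.+1) => k l n ->.
  by rewrite expnS expn1; clear; lia.
apply: has_card_notO; first exact: flex_values_fibred.
  by move=> P [rP [al [[nO _] _]]].
move=> a b P rP hc hp; have /andP[c0 c1] := on_curve_c hc.
rewrite in_set; split.
  move=> [_ [al [/(alpha_isP _ rP.1 hc hp) -> /(has_PorderE Hq Hz c0 c1 i0)]]].
  by move=> [-> -> ->].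
move=> /and3P h; split=> //; exists (a ^+ m / (1 + a ^+ m)); split.
  exact/(alpha_isP _ rP.1 hc hp).
exact/(has_PorderE Hq Hz c0 c1 i0).
Qed.

Lemma has_card_R :
  has_card (fun P => rational_place iota P /\
    exists al, alpha_is iota q x y P al /\ al ^+ 2 - al + 1 = 0) (2 * m * q.+1).
Proof.
have -> : (2 * m * q.+1 = #|[set zeta; zeta ^+ 2]| * (m * q.+1))%N.
  by rewrite card_zetas mulnA.
apply: has_card_notO; first exact: zetas_fibred.
  by move=> P [rP [al [[nO _] _]]].
move=> a b P rP hc hp; have /andP[c0 c1] := on_curve_c hc.
rewrite in_set2 -(al_quadratic Hz c1); split.
  by move=> [_ [al [/(alpha_isP _ rP.1 hc hp) -> /eqP]]].
move=> /eqP h; split=> //; exists (a ^+ m / (1 + a ^+ m)); split=> //.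
exact/(alpha_isP _ rP.1 hc hp).
Qed.

End Points.
End Counting.

Lemma has_card_inhabited (T : Type) (A : T -> Prop) n :
  has_card A n -> (0 < n)%N -> exists P, A P.
Proof.
by case=> f [_ hf] n0; exists (f (Ordinal n0)); apply/hf; exists (Ordinal n0).
Qed.

(** * Classification of the rational points and their semigroups *)

Section Classes.
Variables (q : nat) (K L : fieldType) (iota : {rmorphism K -> L}) (x y : L) (zeta : K).
Hypothesis Hq : admissible q K.
Hypothesis Hxy : model iota q x y.
Hypothesis Hcl : periodic_closure q K.
Hypothesis Hz : 3.-primitive_root zeta.
Local Notation m := (mq q).
Local Notation ratpt := (rational_place iota).
Local Notation H := (weierstrass iota).
Local Notation ClassP i P := (ratpt P /\
  exists al, alpha_is iota q x y P al /\ has_Porder zeta al i).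
Local Notation ClassR P := (ratpt P /\
  exists al, alpha_is iota q x y P al /\ al ^+ 2 - al + 1 = 0).

Lemma rational_place_class P : ratpt P ->
  (ratpt P /\ in_O iota q x y P) \/ ClassR P \/
  exists i, [/\ (1 <= i <= m - 1)%N, (i.+1 %| m)%N & ClassP i P].
Proof.
move=> rP; have [|nO] := boolp.EM (in_O iota q x y P); first by left.
right; have [a [b [hc hp]]] := point_notO Hq Hxy rP nO.
have /andP[c0 c1] := on_curve_c hc.
have al : alpha_is iota q x y P (a ^+ m / (1 + a ^+ m)).
  exact/(alpha_isP _ rP.1 hc hp).
have [h|[[|[|i]] [// d1 dm [n1 n2 pd]]]] := c_class Hq Hz hc; [left|right].
  by split=> //; exists (a ^+ m / (1 + a ^+ m)); split=> //; apply/eqP; rewrite (al_quadratic Hz c1).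
exists i.+1; split=> //.
  have := dvdn_leq (ltnW (m_gt1 Hq)) dm; have := m_gt1 Hq.
  by move: (m) => k; clear; lia.
by split=> //; exists (a ^+ m / (1 + a ^+ m)); split=> //; apply/(has_PorderE Hq Hz c0 c1).
Qed.

Lemma nongap_P i P : (0 < i)%N -> (i.+1 %| m)%N -> ClassP i P ->
  forall n, H P n <-> nongap q m i.+1 n.
Proof.
move=> i0 im [rP [al [ha]]]; have [nO _] := ha.
have [a [b [hc hp]]] := point_notO Hq Hxy rP nO; have /andP[c0 c1] := on_curve_c hc.
move: ha => /(alpha_isP _ rP.1 hc hp) -> /(has_PorderE Hq Hz c0 c1 i0) [n1 n2 pd].
exact: (weierstrass_P Hq Hxy Hcl Hz rP.1 hc hp im n2 pd).
Qed.

Lemma nongap_R P : ClassR P -> forall n, H P n <-> nongap q m m n.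
Proof.
move=> [rP [al [ha]]]; have [nO _] := ha.
have [a [b [hc hp]]] := point_notO Hq Hxy rP nO; have /andP[c0 c1] := on_curve_c hc.
move: ha => /(alpha_isP _ rP.1 hc hp) -> /eqP; rewrite (al_quadratic Hz c1).
exact: (weierstrass_R Hq Hxy Hcl Hz rP.1 hc hp).
Qed.

Lemma weierstrass_semigroup P d S : ratpt P -> (d %| m)%N ->
  (forall n, H P n <-> nongap q m d n) -> (forall k, S k <-> semigroup_gens q d k) ->
  forall n, H P n <-> gen_semigroup S n.
Proof.
move=> [HP _] dm; apply: (nongap_semigroup Hq dm).
  exact: (weierstrass0 HP).
exact: (weierstrassD HP).
Qed.

End Classes.

Theorem theorem4p6 (q : nat) (K : finFieldType) (L : fieldType)
  (iota : {rmorphism K -> L}) (x y : L) (zeta : K) :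
  (exists p k : nat, [/\ prime p, (0 < k)%N & q = (p ^ k)%N]) ->
  (5 <= q)%N -> (q %% 3 = 2)%N ->
  #|K| = (q ^ 2)%N ->
  (* y^(q+1) + x^(2m) + x^m = 0 *)
  y ^+ q.+1 + x ^+ (2 * mq q) + x ^+ mq q = 0 ->
  (* x is transcendental over K *)
  (forall p : {poly K}, (map_poly iota p).[x] = 0 -> p = 0) ->
  (* L = K(x, y) *)
  (forall f : L, exists P Q : {poly {poly K}},
     eval2 iota Q x y != 0 /\ f = eval2 iota P x y / eval2 iota Q x y) ->
  (* zeta is a primitive cube root of unity *)
  3.-primitive_root zeta ->
  let ratpt := rational_place iota in
  let H := weierstrass iota in
  let m := mq q in
  let ClassO := fun P => ratpt P /\ in_O iota q x y P in
  let ClassP := fun (i : nat) P =>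
    ratpt P /\ exists al, alpha_is iota q x y P al /\ has_Porder zeta al i in
  let ClassR := fun P =>
    ratpt P /\ exists al, alpha_is iota q x y P al /\ al ^+ 2 - al + 1 = 0 in
  (* number of distinct Weierstrass semigroups at rational points *)
  (exists S : 'I_(size (divisors m)) -> (nat -> Prop),
     [/\ (forall k1 k2, (forall n, S k1 n <-> S k2 n) -> k1 = k2),
         (forall k, exists P, ratpt P /\ forall n, H P n <-> S k n)
       & (forall P, ratpt P -> exists k, forall n, H P n <-> S k n)]) /\
  (* every rational point is in one of the classes below *)
  (forall P, ratpt P ->
     ClassO P \/ ClassR P \/
     exists i, [/\ (1 <= i <= m - 1)%N, (i.+1 %| m)%N & ClassP i P]) /\
  (* (1) *)
  ((forall P, ClassO P -> forall n, H P n <-> H1 q n) /\ has_card ClassO q.+1) /\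
  (* (2) *)
  (forall i, (1 <= i <= m - 2)%N -> (i.+1 %| m)%N ->
     (forall P, ClassP i P -> forall n, H P n <-> H2 q i n) /\
     has_card (ClassP i) (q.+1 ^ 2 * totient i.+1)%N) /\
  (* (3) *)
  ((forall P, ClassP (m - 1)%N P -> forall n, H P n <-> H3 q n) /\
   has_card (ClassP (m - 1)%N) (q.+1 ^ 2 * totient m)%N /\
   (forall P, ClassR P -> forall n, H P n <-> H3 q n) /\
   has_card ClassR (2 * m * q.+1)%N).
Proof.
move=> hp q5 q3 cK h1 h2 h3 Hz.
have Hq : admissible q K := admissible_fin hp q5 q3 cK.
have Hcl : periodic_closure q K := periodic_closure_fin Hq.
have Hxy : model iota q x y by split.
move=> ratpt H m ClassO ClassP ClassR.
have m1 : (1 < m)%N := m_gt1 Hq.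
have m0 : (0 < m)%N := ltnW m1.
have HO P : ClassO P -> forall n, H P n <-> nongap q m 1 n.
  by move=> [rP PO]; apply: (weierstrass_O Hq Hxy Hcl rP PO).
have HP i P : (0 < i)%N -> (i.+1 %| m)%N -> ClassP i P ->
    forall n, H P n <-> nongap q m i.+1 n := @nongap_P _ _ _ _ _ _ _ Hq Hxy Hcl Hz i P.
have HR P : ClassR P -> forall n, H P n <-> nongap q m m n :=
  @nongap_R _ _ _ _ _ _ _ Hq Hxy Hcl Hz P.
have cO : has_card ClassO q.+1 := has_card_O Hq Hxy.
have cP i : (0 < i)%N -> (i.+1 %| m)%N -> has_card (ClassP i) (q.+1 ^ 2 * totient i.+1)%N.
  exact: (has_card_P Hq Hz Hxy).
have cl P : ratpt P -> ClassO P \/ ClassR P \/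
    exists i, [/\ (1 <= i <= m - 1)%N, (i.+1 %| m)%N & ClassP i P].
  exact: (rational_place_class Hq Hxy Hz).
have pm : (m - 1).+1 = m by rewrite subn1 prednK.
have pm0 : (0 < m - 1)%N by rewrite subn_gt0.
split; last split; [|exact: cl|split; last split; last split; last split; last split].
(* The divisor 1 is realized on O, a divisor d > 1 at points of P-order d - 1; the counts, being
   positive, supply the points. *)
- pose S (k : 'I_(size (divisors m))) n : Prop := nongap q m (nth 0%N (divisors m) k) n.
  have divk (k : 'I_(size (divisors m))) : (nth 0%N (divisors m) k %| m)%N.
    by rewrite dvdn_divisors // mem_nth.
  have kdiv d : (d %| m)%N -> exists k : 'I_(size (divisors m)), nth 0%N (divisors m) k = d.
    rewrite dvdn_divisors // => dm; have lt : (index d (divisors m) < size (divisors m))%N.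
      by rewrite index_mem.
    by exists (Ordinal lt); rewrite /= nth_index.
  exists S; split=> [k1 k2 h|k|P rP].
  + apply/val_inj/eqP; rewrite -(nth_uniq 0%N (ltn_ord k1) (ltn_ord k2) (divisors_uniq m)); apply/eqP.
    apply: (nongap_inj (q1E Hq) _ _ (divk k1) (divk k2) m0) => [||n].
    * exact: dvdn_gt0 (divk k1).
    * exact: dvdn_gt0 (divk k2).
    * by apply/idP/idP => /h.
  + have := divk k; rewrite /S; case: (nth _ _ _) => [|[|i]] dm.
    * by move: dm m0; rewrite dvd0n => /eqP->.
    * by have [P PO] := has_card_inhabited cO (ltn0Sn q); exists P; split; [case: PO|exact: HO].
    have [|P PP] := has_card_inhabited (cP i.+1 (ltn0Sn i) dm).
      by rewrite muln_gt0 expn_gt0 totient_gt0.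
    by exists P; split; [case: PP|exact: HP].
  case: (cl P rP) => [/HO h|[/HR h|[i [/andP[i0 _] im /(HP i P i0 im) h]]]].
  + by have [k ek] := kdiv 1%N (dvd1n m); exists k; rewrite /S ek.
  + by have [k ek] := kdiv m (dvdnn m); exists k; rewrite /S ek.
  by have [k ek] := kdiv i.+1 im; exists k; rewrite /S ek.
- split=> // P PO; apply: (weierstrass_semigroup Hq PO.1 (dvd1n m) (HO P PO)).
  exact: (gens_H1 Hq).
- move=> i hi im; have i0 : (0 < i)%N by case/andP: hi.
  split; last exact: cP.
  move=> P PP; apply: (weierstrass_semigroup Hq PP.1 im (HP i P i0 im PP)) => n.
  exact: (gens_H2 Hq).
- move=> P PP; have im : ((m - 1).+1 %| m)%N by rewrite pm.
  have := HP _ P pm0 im PP; rewrite pm => h.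
  apply: (weierstrass_semigroup Hq PP.1 (dvdnn m) h); exact: (gens_H3 Hq).
- by have := cP _ pm0; rewrite pm; apply.
- move=> P PR; apply: (weierstrass_semigroup Hq PR.1 (dvdnn m) (HR P PR)).
  exact: (gens_H3 Hq).
exact: (has_card_R Hq Hz Hxy).
Qed.
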